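(* Let $f:\widehat{\mathbb{C}}\to\widehat{\mathbb{C}}$ be a rational map of degree at least two. Then the set $\mathcal{LM}$ of Lyubich–Minsky functions of $f$ is a subset of the set $\mathcal{Z}$ of Zalcman functions of $f$. Consequently the Lyubich–Minsky lamination is contained in the Zalcman lamination: $\mathcal{A}^{\mathcal{LM}}\subset\mathcal{A}^{\mathcal{Z}}$.
   Context: Let $\mathcal{U}$ be the space of non-constant meromorphic functions $\psi:\mathbb{C}\to\widehat{\mathbb{C}}$ with the topology of uniform convergence (spherical metric) on compact sets; $J=J(f)$ is the Julia set; $\mathbb{N}=\{0,1,2,\dots\}$. Lyubich–Minsky functions. A backward orbit is $\hat z=(z_0,z_{-1},z_{-2},\dots)\in\widehat{\mathbb{C}}^{\mathbb{N}}$ with $f(z_{-n-1})=z_{-n}$ for all $n$. It is regular if there is a neighborhood $U_0$ of $z_0$ whose iterated pullbacks $\cdots\to U_{-2}\to U_{-1}\to U_0$ along $\hat z$ (with $U_{-n-1}$ the component of $f^{-1}(U_{-n})$ containing $z_{-n-1}$) are such that $f$ is univalent on $U_{-n}$ for all sufficiently large $n$. $\mathcal{R}\subset\widehat{\mathbb{C}}^{\mathbb{N}}$ is the set of regular backward orbits; its path components are called leaves, $L(\hat z)$ being the leaf containing $\hat z$. Each leaf is a Riemann surface in which a point $\hat\zeta=(\zeta_{-n})_{n\ge0}$ has as basic neighborhoods the sets of backward orbits $\{\hat w=(w_{-n})_{n\ge0}: w_{-n}\in U_{-n}\ \forall n\}$, where $U_0$ is a connected open neighborhood of $\zeta_0$,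 $U_{-n-1}$ is the component of $f^{-1}(U_{-n})$ containing $\zeta_{-n-1}$, and $f$ is univalent on $U_{-n}$ for all sufficiently large $n$, and for which the projections $\hat w\mapsto w_{-n}$ are holomorphic; each leaf is isomorphic to $\mathbb{C}$, $\mathbb{D}$ or an annulus. $\mathcal{R}_{\mathbb{C}}$ is the union of the leaves isomorphic to $\mathbb{C}$. Let $\pi_0(\hat z)=z_0$. For $\hat z\in\mathcal{R}_{\mathbb{C}}$, $\mathcal{LM}(\hat z)$ is the set of $\psi=\pi_0\circ\phi\in\mathcal{U}$ where $\phi:\mathbb{C}\to L(\hat z)$ is a conformal isomorphism with $\phi(0)=\hat z$. $\mathcal{LM}:=\bigcup_{\hat z\in\mathcal{R}_{\mathbb{C}}}\mathcal{LM}(\hat z)$. Zalcman functions. For $z_0\in J$, $z_0\ne\infty$, $\mathcal{Z}(z_0)=\mathcal{Z}_f(z_0)$ is the set of $\psi\in\mathcal{U}$ for which there are $n_k\to\infty$, $z_k\to z_0$, $\rho_k\in\mathbb{C}^*$ with $\rho_k\to0$, such that $f^{n_k}(z_k+\rho_k w)\to\psi(w)$ uniformly on compact subsets of $\mathbb{C}$. If $\infty\in J$, $\mathcal{Z}(\infty):=\{1/\phi:\phi\in\mathcal{Z}_F(0)\}$ with $F(z)=1/f(1/z)$. $\mathcal{Z}:=\bigcup_{z_0\in J}\mathcal{Z}(z_0)$. Laminations. Both $\mathcal{K}=\mathcal{LM}$ and $\mathcal{K}=\mathcal{Z}$ satisfy $f\circ\mathcal{K}=\mathcal{K}=\mathcal{K}\circ\mathrm{Aff}$,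 where $\mathrm{Aff}$ is the set of complex affine maps of $\mathbb{C}$. Let $\widehat{\mathcal{U}}=\mathcal{U}^{\mathbb{N}}$ (product topology) and let $\widehat{\mathcal{K}}$ be the set of $\hat\psi=(\psi_0,\psi_{-1},\dots)\in\widehat{\mathcal{U}}$ with $\psi_{-n}\in\mathcal{K}$ and $f\circ\psi_{-n-1}=\psi_{-n}$ for all $n\in\mathbb{N}$. The group $\mathbb{C}^*$ acts on $\widehat{\mathcal{U}}$ by $(\psi_{-n}(w))_n\mapsto(\psi_{-n}(aw))_n$. $\mathcal{A}^{\mathcal{K}}$ is the closure of $\widehat{\mathcal{K}}/\mathbb{C}^*$ in the quotient space $\widehat{\mathcal{U}}/\mathbb{C}^*$. *)

(* Defs.v *)
From HB Require Import structures.
From mathcomp Require Import all_boot all_order all_algebra generic_quotient.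
From mathcomp Require Import all_classical all_reals all_analysis.
From mathcomp.real_closed Require Import complex.
From mathcomp Require Import ring lra.

Set Implicit Arguments.
Unset Strict Implicit.
Unset Printing Implicit Defensive.

Import Order.TTheory GRing.Theory Num.Theory.
Import numFieldNormedType.Exports.
Import ComplexField.Normc.

Local Open Scope classical_set_scope.
Local Open Scope ring_scope.
Local Open Scope complex_scope.
Local Open Scope quotient_scope.

(* [R[i]] itself carries no topology in the library; its regular module
   [R[i]^o] is a normed space over [R[i]], so that [derivable _ _ 1] on it is
   complex differentiability. *)
Notation Cplx R := (R[i]^o) (only parsing).

(* The point at infinity is [None]. [sphere] is a fresh name for
   [option R[i]] so that it can be given the spherical metric below. *)
Definition sphere (R : realType) : Type := option R[i].

HB.instance Definition _ (R : realType) := Choice.on (sphere R).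

Section SphericalMetric.
Variable R : realType.
Local Arguments normc : simpl never.
Implicit Types (P Q V : R[i] * R[i]) (x y z : sphere R).

(* The chordal metric. It induces the same uniform structure as the geodesic
   distance, which is [2 * asin (chordal x y / 2)]. *)
Definition chordal x y : R :=
  match x, y with
  | Some z, Some w => 2 * normc (z - w) /
      (Num.sqrt (1 + normc z ^+ 2) * Num.sqrt (1 + normc w ^+ 2))
  | Some z, None | None, Some z => 2 / Num.sqrt (1 + normc z ^+ 2)
  | None, None => 0
  end.

(* Homogeneous coordinates, in which the chordal metric has a single formula. *)
Definition homog x : R[i] * R[i] := if x is Some w then (w, 1) else (1, 0).
Definition hnorm P : R := Num.sqrt (normc P.1 ^+ 2 + normc P.2 ^+ 2).
Definition hdet P Q : R[i] := P.1 * Q.2 - P.2 * Q.1.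
Definition hdot P Q : R[i] := P.1 * Q.1^* + P.2 * Q.2^*.

Lemma normc_ge0 (z : R[i]) : 0 <= normc z.
Proof. by case: z => a b; rewrite /normc sqrtr_ge0. Qed.

Lemma normcC (z : R[i]) : normc z^* = normc z.
Proof. by case: z => a b; rewrite /normc /= sqrrN. Qed.

Lemma nc0 : normc (0 : R[i]) = 0. Proof. exact: normc0. Qed.
Lemma nc1 : normc (1 : R[i]) = 1. Proof. exact: normc1. Qed.

Lemma hnorm_gt0 x : 0 < hnorm (homog x).
Proof.
rewrite /hnorm sqrtr_gt0; case: x => [z|] /=.
  by rewrite nc1 expr1n ltr_wpDl// sqr_ge0.
by rewrite nc1 nc0 expr1n expr0n /= addr0.
Qed.

Lemma chordalE x y :
  chordal x y = 2 * normc (hdet (homog x) (homog y)) / (hnorm (homog x) * hnorm (homog y)).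
Proof.
case: x => [z|]; case: y => [w|]; rewrite /chordal /hdet /hnorm /=.
- by rewrite mulr1 mul1r nc1 expr1n ![_ + 1]addrC.
- rewrite mulr0 mulr1 sub0r normcN !nc1 nc0 !expr1n expr0n /= addr0 sqrtr1.
  by rewrite !mulr1 addrC.
- rewrite mulr1 mul0r subr0 !nc1 nc0 !expr1n expr0n /= addr0 sqrtr1.
  by rewrite mulr1 mul1r [_ + 1]addrC.
- by rewrite mulr0 mul0r subr0 nc0 mulr0 mul0r.
Qed.

Lemma hdot_le P Q : normc (hdot P Q) <= hnorm P * hnorm Q.
Proof.
apply: le_trans (le_normcD _ _) _; rewrite !normcM !normcC /hnorm.
rewrite -sqrtrM ?addr_ge0 ?sqr_ge0//.
have := normc_ge0 P.1; have := normc_ge0 P.2.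
have := normc_ge0 Q.1; have := normc_ge0 Q.2.
move: (normc _) (normc _) (normc _) (normc _) => a b c d d0 c0 b0 a0.
have e0 : 0 <= a * c + b * d by rewrite addr_ge0 ?mulr_ge0.
rewrite -(ger0_norm e0) -sqrtr_sqr; apply: ler_wsqrtr.
have := sqr_ge0 (a * d - b * c); lra.
Qed.

Lemma hdotvv V : normc (hdot V V) = hnorm V ^+ 2.
Proof.
have normc_real (a : R) : 0 <= a -> normc a%:C = a.
  by move=> a0; rewrite /normc /= expr0n /= addr0 sqrtr_sqr ger0_norm.
have sqr_normcE (z : R[i]) : z * z^* = (normc z ^+ 2)%:C.
  by rewrite -sqr_normc normc_def rmorphXn; case: z.
rewrite /hnorm sqr_sqrtr ?addr_ge0 ?sqr_ge0// /hdot !sqr_normcE -rmorphD.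
by rewrite normc_real // addr_ge0 ?sqr_ge0.
Qed.

Lemma hdet_plucker P Q V :
  hdet P Q * hdot V V = hdet P V * hdot Q V + hdet V Q * hdot P V.
Proof. by rewrite /hdet /hdot; ring. Qed.

Lemma chordalxx x : chordal x x = 0.
Proof.
by rewrite chordalE /hdet mulrC [X in X - _]mulrC subrr nc0 mulr0 mulr0.
Qed.

Lemma chordal_sym x y : chordal x y = chordal y x.
Proof.
rewrite !chordalE -normcN [hnorm _ * _]mulrC; congr (_ * normc _ / _).
by rewrite /hdet; ring.
Qed.

Lemma chordal_positivity x y : chordal x y = 0 -> x = y.
Proof.
move=> /eqP; rewrite chordalE mulf_eq0 invr_eq0.
rewrite (gt_eqF (mulr_gt0 (hnorm_gt0 x) (hnorm_gt0 y))) orbF.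
rewrite mulf_eq0 pnatr_eq0 /= => /eqP/eq0_normc/eqP.
rewrite /hdet; case: x => [z|]; case: y => [w|] //=.
- by rewrite mulr1 mul1r subr_eq0 => /eqP ->.
- by rewrite mulr0 mulr1 sub0r oppr_eq0 oner_eq0.
- by rewrite mulr1 mul0r subr0 oner_eq0.
Qed.

Lemma triangle_arith (dxz dxy dyz nx ny nz p q : R) :
  0 < nx -> 0 < ny -> 0 < nz -> 0 <= dxy -> 0 <= dyz ->
  p <= nx * ny -> q <= nz * ny -> dxz * ny ^+ 2 <= dxy * q + dyz * p ->
  2 * dxz / (nx * nz) <= 2 * dxy / (nx * ny) + 2 * dyz / (ny * nz).
Proof.
move=> nx0 ny0 nz0 dxy0 dyz0 lep leq le.
have key : dxz * ny <= dxy * nz + dyz * nx.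
  rewrite -(ler_pM2r ny0); apply: (@le_trans _ _ (dxy * q + dyz * p)).
    by rewrite -mulrA -expr2.
  by rewrite mulrDl -!mulrA lerD // ler_wpM2l.
have nxN := lt0r_neq0 nx0; have nyN := lt0r_neq0 ny0.
have nzN := lt0r_neq0 nz0.
rewrite -(ler_pM2r (mulr_gt0 (mulr_gt0 nx0 ny0) nz0)).
have -> : 2 * dxz / (nx * nz) * (nx * ny * nz) = 2 * (dxz * ny).
  by field; apply/andP.
have -> : (2 * dxy / (nx * ny) + 2 * dyz / (ny * nz)) * (nx * ny * nz) =
    2 * (dxy * nz + dyz * nx).
  by field; apply/and3P.
by rewrite ler_pM2l.
Qed.

Lemma chordal_triangle y x z : chordal x z <= chordal x y + chordal y z.
Proof.
rewrite !chordalE.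
apply: (triangle_arith (hnorm_gt0 x) (hnorm_gt0 y) (hnorm_gt0 z)
  (normc_ge0 _) (normc_ge0 _) (hdot_le (homog x) (homog y))
  (hdot_le (homog z) (homog y))).
rewrite -hdotvv -normcM hdet_plucker -!normcM; exact: le_normcD.
Qed.

HB.instance Definition _ := @isMetric.Build R (sphere R)
  chordal chordalxx chordal_positivity chordal_sym chordal_triangle.

End SphericalMetric.

Section RationalMaps.
Variable R : realType.

Definition sinv (x : sphere R) : sphere R :=
  match x with
  | Some z => if z == 0 then None else Some z^-1
  | None => Some 0
  end.

(* The map [p / q] on the sphere, for coprime [p] and [q]; its value at
   infinity is read off the coefficients of index [max (deg p) (deg q)]. *)
Definition ratfun (p q : {poly R[i]}) (x : sphere R) : sphere R :=
  match x with
  | Some z => if q.[z] == 0 then None else Some (p.[z] / q.[z])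
  | None => let d := (maxn (size p) (size q)).-1 in
            if q`_d == 0 then None else Some (p`_d / q`_d)
  end.

Definition rational_map_of_degree (f : sphere R -> sphere R) (d : nat) : Prop :=
  exists p q : {poly R[i]},
    [/\ q != 0, coprimep p q, d = (maxn (size p) (size q)).-1 & f = ratfun p q].

Definition normal_on (f : sphere R -> sphere R) (U : set (sphere R)) : Prop :=
  forall m : nat -> nat, exists (k : nat -> nat) (g : sphere R -> sphere R),
    {homo k : i j / (i < j)%N} /\
    forall K : set (sphere R), compact K -> K `<=` U ->
      {uniform K, (fun j => iter (m (k j)) f) @ \oo --> g}.

Definition Fatou (f : sphere R -> sphere R) : set (sphere R) :=
  [set z | exists2 U, open_nbhs z U & normal_on f U].

Definition Julia (f : sphere R -> sphere R) : set (sphere R) := ~` Fatou f.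

End RationalMaps.

Arguments sinv {R} x.

Section MeromorphicFunctions.
Variable R : realType.

(* Complex differentiability of a sphere-valued map, in the chart [z] around
   finite values and in the chart [1/z] around infinity. Thanks to continuity
   the default value of [odflt] is irrelevant near [z]. *)
Definition cdifferentiable_at (g : Cplx R -> sphere R) (z : Cplx R) : Prop :=
  {for z, continuous g} /\
  if g z is Some _
  then derivable ((fun w => odflt 0 (g w)) : Cplx R -> Cplx R) z 1
  else derivable ((fun w => odflt 0 (sinv (g w))) : Cplx R -> Cplx R) z 1.

Definition nonconstant_meromorphic :
    set {family compact, Cplx R -> sphere R} :=
  [set psi | (forall z, cdifferentiable_at psi z) /\
             ~ (exists c, forall z, psi z = c)].

(* The space U: [set_type] gives it the subspace topology of the topology of
   compact convergence for the chordal metric. *)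
Definition Uspace : Type := set_type nonconstant_meromorphic.

HB.instance Definition _ := Topological.on Uspace.

End MeromorphicFunctions.

Section LyubichMinsky.
Variables (R : realType) (f : sphere R -> sphere R).

(* A backward orbit (z_0, z_{-1}, z_{-2}, ...) is indexed by n |-> z_{-n}. *)
Definition orbits : Type := {ptws nat -> sphere R}.

HB.instance Definition _ := Topological.on orbits.

Implicit Types z w : orbits.

Definition backward_orbit z : Prop := forall n, f (z n.+1) = z n.

Fixpoint pullback z (U0 : set (sphere R)) (n : nat) : set (sphere R) :=
  if n is m.+1 then connected_component (f @^-1` pullback z U0 m) (z n) else U0.

(* [f] being rational, univalence is just injectivity. *)
Definition univalent_from z (U0 : set (sphere R)) (N : nat) : Prop :=
  forall n, (N <= n)%N -> set_inj (pullback z U0 n) f.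

Definition regular_orbits : set orbits :=
  [set z | backward_orbit z /\
     exists2 U0, open_nbhs (z 0%N) U0 & exists N, univalent_from z U0 N].

(* Path component of [z] in [regular_orbits], for the product topology. *)
Definition leaf z : set orbits :=
  [set w | exists gamma : R -> orbits,
     [/\ {within `[0, 1]%classic, continuous gamma},
         forall t : R, t \in `[0, 1] -> regular_orbits (gamma t),
         gamma 0 = z & gamma 1 = w]].

Definition box z (U0 : set (sphere R)) : set orbits :=
  [set w | backward_orbit w /\ forall n, pullback z U0 n (w n)].

Definition leaf_nbhs z (A : set orbits) : Prop :=
  exists U0, [/\ open_nbhs (z 0%N) U0, connected U0,
                 exists N, univalent_from z U0 N & box z U0 `<=` A].

(* A homeomorphism from C onto the leaf of [z], for the topology of the leaf,
   which is holomorphic (hence biholomorphic). The charts of the leaf around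
   [phi u] are the projections to the [N]-th coordinate, restricted to a box on
   whose pullbacks [f] is univalent from the index [N] on. *)
Definition conformal_iso z (phi : Cplx R -> orbits) : Prop :=
  [/\ set_bij setT (leaf z) phi,
      forall (u : Cplx R) A, leaf_nbhs (phi u) A -> nbhs u (phi @^-1` A),
      forall (u : Cplx R) A, nbhs u A -> leaf_nbhs (phi u) (phi @` A) &
      forall (u : Cplx R) U0 N, open_nbhs (phi u 0%N) U0 -> connected U0 ->
        univalent_from (phi u) U0 N ->
        cdifferentiable_at (fun v => phi v N) u].

(* Regular orbits whose leaf is isomorphic to C (as opposed to a disk or an
   annulus). *)
Definition affine_orbits : set orbits :=
  [set z | regular_orbits z /\ exists phi, conformal_iso z phi].

Definition LM_at z : set (Cplx R -> sphere R) :=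
  [set psi | nonconstant_meromorphic psi /\
     exists phi, [/\ conformal_iso z phi, phi 0 = z &
                     psi = fun u => phi u 0%N]].

Definition LM : set (Cplx R -> sphere R) := \bigcup_(z in affine_orbits) LM_at z.

End LyubichMinsky.

Section Zalcman.
Variable R : realType.

Definition Zalcman_finite (f : sphere R -> sphere R) (z0 : Cplx R) :
    set (Cplx R -> sphere R) :=
  [set psi | nonconstant_meromorphic psi /\
     exists (n : nat -> nat) (z rho : nat -> Cplx R),
       [/\ n @ \oo --> \oo, z @ \oo --> z0, forall k, rho k != 0,
           rho @ \oo --> (0 : Cplx R) &
           {family compact,
             (fun k (w : Cplx R) => iter (n k) f (Some (z k + rho k * w)))
               @ \oo --> psi}]].

Definition Zalcman_at (f : sphere R -> sphere R) (z0 : sphere R) :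
    set (Cplx R -> sphere R) :=
  if z0 is Some z then Zalcman_finite f z
  else [set sinv \o phi | phi in Zalcman_finite (sinv \o f \o sinv) 0].

Definition Zalcman (f : sphere R -> sphere R) : set (Cplx R -> sphere R) :=
  \bigcup_(z0 in Julia f) Zalcman_at f z0.

End Zalcman.

Section Laminations.
Variable R : realType.

Definition Uhat : Type := {ptws nat -> Uspace R}.

HB.instance Definition _ := Topological.on Uhat.

Implicit Types Psi : Uhat.

(* The orbit equivalence relation of the action of the nonzero scalars. *)
Definition same_orbit Psi1 Psi2 : bool :=
  `[< exists2 a : R[i], a != 0 &
      forall n (w : R[i]), val (Psi2 n) w = val (Psi1 n) (a * w) >].

Lemma same_orbit_refl : reflexive same_orbit.
Proof.
by move=> Psi; apply/asboolP; exists 1 => [|n w]; rewrite ?oner_eq0 ?mul1r.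
Qed.

Lemma same_orbit_sym : symmetric same_orbit.
Proof.
suff H Psi1 Psi2 : same_orbit Psi1 Psi2 -> same_orbit Psi2 Psi1.
  by move=> Psi1 Psi2; apply/idP/idP => /H.
move=> /asboolP[a a0 E]; apply/asboolP; exists a^-1 => [|n w].
  by rewrite invr_eq0.
by rewrite E mulrA divff // mul1r.
Qed.

Lemma same_orbit_trans : transitive same_orbit.
Proof.
move=> Psi2 Psi1 Psi3 /asboolP[a a0 E1] /asboolP[b b0 E2]; apply/asboolP.
exists (a * b) => [|n w]; first by rewrite mulf_neq0.
by rewrite E2 E1 mulrA.
Qed.

Canonical same_orbit_equiv :=
  EquivRel same_orbit same_orbit_refl same_orbit_sym same_orbit_trans.

Definition Uhat_mod_scalars : Type :=
  quotient_topology {eq_quot same_orbit}.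

HB.instance Definition _ := Topological.on Uhat_mod_scalars.

Definition Khat (f : sphere R -> sphere R) (K : set (Cplx R -> sphere R)) :
    set Uhat :=
  [set Psi | forall n, K (val (Psi n)) /\
     forall w : R[i], f (val (Psi n.+1) w) = val (Psi n) w].

Definition lamination (f : sphere R -> sphere R) (K : set (Cplx R -> sphere R)) :
    set Uhat_mod_scalars :=
  closure ((\pi_(quotient_topology {eq_quot same_orbit}) : Uhat -> Uhat_mod_scalars)
             @` Khat f K).

End Laminations.

(* Main.v *)
(* For an affine leaf with uniformization [phi], the coordinates
   [psi_n u = phi u n] satisfy [f^n o psi_n = psi], and on every disc they are
   injective for [n] large. Then [f] is injective on [psi_n D] for [n] large, so
   [psi_n] omits on [D] one point of each of two pairs with the same image under
   [f]. By a Koebe type estimate an injective map of a large disc omitting two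
   values is nearly constant on smaller discs; being injective, it is moreover
   nearly affine in a suitable chart, with slope tending to [0]. Inverting this
   affine map turns [f^n o psi_n = psi] into the convergence of
   [f^n (z + rho w)] to [psi w], which also shows that the limit of the [z] is
   in the Julia set, since [psi] is not constant. *)

Require Import Defs.
From mathcomp Require Import all_boot all_order all_algebra.
From mathcomp Require Import all_classical all_reals all_analysis.
From mathcomp.real_closed Require Import complex.
From mathcomp Require Import ring lra.

Set Implicit Arguments.
Unset Strict Implicit.
Unset Printing Implicit Defensive.

Import Order.TTheory GRing.Theory Num.Theory.
Import numFieldNormedType.Exports.
Import ComplexField.Normc.

Local Open Scope classical_set_scope.
Local Open Scope ring_scope.
Local Open Scope complex_scope.

(** The coordinates [psi_n] come with no quantitative control: they are only known to be injective
    on larger and larger discs. All constants must therefore be independent of the map, of the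
    radius and of the two omitted values, which vary with [n]; their size is irrelevant because the
    radius tends to infinity. Every estimate rests on one maximum principle, which tolerates two
    points where the function is merely continuous, so that it applies directly to difference
    quotients, whose differentiability at the base point is unknown. It is obtained from Goursat's
    bisection with Riemann sums over squares. Nonvanishing of the derivative is only obtained at
    some point [w] of the unit disc, and the slope of the affine map is the increment of the
    injective map from [w] to [w + 1]. The final convergence comes from a covering statement: each
    value of the affine map on a disc is taken by the injective map at a nearby point, and
    continuity of [psi] does the rest. *)

Local Notation Re := complex.Re.
Local Notation Im := complex.Im.
Local Arguments normc : simpl never.

(** * Modulus, real and imaginary parts *)

Section ComplexBasics.
Variable R : realType.
Implicit Types (z w : R[i]) (x y s : R).

(* [normc] with codomain exactly [R], as required by [lra]. *)
Definition cabs z : R := normc z.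

Lemma cabs_ge0 z : 0 <= cabs z. Proof. exact: normc_ge0. Qed.
Lemma cabs_eq0 z : cabs z = 0 -> z = 0. Proof. exact: eq0_normc. Qed.
Lemma cabs0 : cabs 0 = 0. Proof. exact: normc0. Qed.
Lemma cabs1 : cabs 1 = 1. Proof. exact: normc1. Qed.
Lemma cabsD z w : cabs (z + w) <= cabs z + cabs w. Proof. exact: le_normcD. Qed.
Lemma cabsN z : cabs (- z) = cabs z. Proof. exact: normcN. Qed.
Lemma cabsM z w : cabs (z * w) = cabs z * cabs w. Proof. exact: normcM. Qed.
Lemma cabsV z : cabs z^-1 = (cabs z)^-1. Proof. exact: normcV. Qed.

Lemma cabs_gt0 z : z != 0 -> 0 < cabs z.
Proof.
move=> z0; rewrite lt_neqAle cabs_ge0 andbT eq_sym.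
by apply: contra z0 => /eqP/cabs_eq0 ->.
Qed.

Lemma cabs_distC z w : cabs (z - w) = cabs (w - z).
Proof. by rewrite -cabsN opprB. Qed.

Lemma cabsB z w : cabs (z - w) <= cabs z + cabs w.
Proof. by rewrite -[cabs w]cabsN; exact: cabsD. Qed.

Lemma cabs_tri w z z' : cabs (z - z') <= cabs (z - w) + cabs (w - z').
Proof.
have -> : z - z' = (z - w) + (w - z') by ring.
exact: cabsD.
Qed.

Lemma cabs_sub z w : cabs z - cabs w <= cabs (z - w).
Proof. by rewrite lerBlDr; apply: le_trans (cabsD _ _); rewrite subrK. Qed.

Lemma cabsR x : cabs x%:C = `|x|.
Proof. by rewrite /cabs /normc /= expr0n /= addr0 sqrtr_sqr. Qed.

Definition ii : R[i] := 0 +i* 1.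

Lemma cabsi : cabs ii = 1.
Proof. by rewrite /cabs /normc /= expr0n /= add0r expr1n sqrtr1. Qed.

Lemma cabsX z n : cabs (z ^+ n) = cabs z ^+ n.
Proof. by elim: n => [|n IH]; rewrite ?expr0 ?cabs1// !exprS cabsM IH. Qed.

Lemma cabs_div z w : cabs (z / w) = cabs z / cabs w.
Proof. by rewrite cabsM cabsV. Qed.

Lemma cabs_nat n : cabs (n%:R : R[i]) = n%:R.
Proof. by rewrite -[n%:R](rmorph_nat (real_complex R)) cabsR ger0_norm. Qed.

Lemma cabs_Re z : `|Re z| <= cabs z.
Proof.
case: z => a b; rewrite /cabs /normc /= -sqrtr_sqr ler_wsqrtr//.
by rewrite lerDl sqr_ge0.
Qed.

Lemma cabs_Im z : `|Im z| <= cabs z.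
Proof.
case: z => a b; rewrite /cabs /normc /= -sqrtr_sqr ler_wsqrtr//.
by rewrite lerDr sqr_ge0.
Qed.

Lemma cabs_sqr z : cabs z ^+ 2 = Re z ^+ 2 + Im z ^+ 2.
Proof. by case: z => a b; rewrite /cabs /normc sqr_sqrtr// addr_ge0// sqr_ge0. Qed.

Lemma complexRI z : z = (Re z)%:C + ii * (Im z)%:C.
Proof. exact: complexE. Qed.

Lemma cabs_le_ReIm z : cabs z <= `|Re z| + `|Im z|.
Proof.
rewrite [in cabs z](complexRI z); apply: le_trans (cabsD _ _) _.
by rewrite cabsM cabsi mul1r !cabsR.
Qed.

Lemma ReD z w : Re (z + w) = Re z + Re w. Proof. by case: z w => ? ? [? ?]. Qed.
Lemma ImD z w : Im (z + w) = Im z + Im w. Proof. by case: z w => ? ? [? ?]. Qed.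
Lemma ReN z : Re (- z) = - Re z. Proof. by case: z. Qed.
Lemma ImN z : Im (- z) = - Im z. Proof. by case: z. Qed.
Lemma ReM z w : Re (z * w) = Re z * Re w - Im z * Im w.
Proof. by case: z w => ? ? [? ?]. Qed.
Lemma ImM z w : Im (z * w) = Re z * Im w + Im z * Re w.
Proof. by case: z w => ? ? [? ?]. Qed.
Lemma ReRC x : Re x%:C = x. Proof. by []. Qed.
Lemma ImRC x : Im x%:C = 0. Proof. by []. Qed.
Lemma ReiE : Re ii = 0. Proof. by []. Qed.
Lemma ImiE : Im ii = 1. Proof. by []. Qed.
Lemma RexiE x y : Re (x +i* y) = x. Proof. by []. Qed.
Lemma ImxiE x y : Im (x +i* y) = y. Proof. by []. Qed.
Definition ReImE := (ReD, ImD, ReN, ImN, ReM, ImM, ReRC, ImRC, ReiE, ImiE, RexiE, ImxiE).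

End ComplexBasics.
Arguments ii {R}.

(** * Bisection of squares *)

Section SquareInduction.
Variable R : realType.
Implicit Types (P : R -> R -> R -> Prop) (x y s p q d : R).

Lemma nested_intervals (x s : nat -> R) :
  (forall n, x n <= x n.+1) -> (forall n, x n.+1 + s n.+1 <= x n + s n) ->
  (forall n, 0 <= s n) -> exists p, forall n, x n <= p <= x n + s n.
Proof.
move=> xI xsD s0.
have xm m n : (m <= n)%N -> x m <= x n.
  move=> /subnK <-; elim: (n - m)%N => [|k IH]; first by rewrite add0n.
  by apply: le_trans IH _; rewrite addSn.
have xsm m n : (m <= n)%N -> x n + s n <= x m + s m.
  move=> /subnK <-; elim: (n - m)%N => [|k IH]; first by rewrite add0n.
  by apply: le_trans IH; rewrite addSn.
have B m n : x m <= x n + s n.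
  case: (leqP m n) => mn; first by have := xm _ _ mn; have := s0 n; lra.
  by have := xsm _ _ (ltnW mn); have := s0 m; lra.
exists (sup (range x)) => n; apply/andP; split.
  apply: ub_le_sup; last by exists n.
  by exists (x n + s n) => _ [m _ <-].
apply: ge_sup; first by exists (x 0%N), 0%N.
by move=> _ [m _ <-].
Qed.

(** Cousin's lemma: if [P] failed on the square it would fail on one of its quarters, and the nested
    failing squares shrink to a point [(p, q)] where the local hypothesis is violated. It plays the
    role of compactness below; with a [P] that ignores [y] it serves for intervals. *)
Lemma square_ind P x0 y0 s0 : 0 < s0 ->
  (forall x y s, 0 < s -> P x y (s / 2) -> P (x + s / 2) y (s / 2) ->
     P x (y + s / 2) (s / 2) -> P (x + s / 2) (y + s / 2) (s / 2) -> P x y s) ->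
  (forall p q, x0 <= p <= x0 + s0 -> y0 <= q <= y0 + s0 ->
     exists2 d, 0 < d & forall x y s, 0 < s -> s < d ->
       x0 <= x -> x + s <= x0 + s0 -> y0 <= y -> y + s <= y0 + s0 ->
       x <= p <= x + s -> y <= q <= y + s -> P x y s) ->
  P x0 y0 s0.
Proof.
move=> s0_gt0 Pq Ploc; apply: contrapT => nP0.
(* A failing square travels with the proof of its failure, so that the choice of a failing quarter
   can be iterated. *)
have step (t : {t : R * R * R | 0 < t.2 /\ ~ P t.1.1 t.1.2 t.2}) :
  {t' : {t : R * R * R | 0 < t.2 /\ ~ P t.1.1 t.1.2 t.2} |
    [/\ (sval t').2 = (sval t).2 / 2,
     ((sval t').1.1 = (sval t).1.1 \/ (sval t').1.1 = (sval t).1.1 + (sval t).2 / 2) &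
     ((sval t').1.2 = (sval t).1.2 \/ (sval t').1.2 = (sval t).1.2 + (sval t).2 / 2)]}.
  case: t => -[[x y] s] /= [s_gt0 nP]; apply: cid.
  have s2 : 0 < s / 2 by lra.
  apply: contrapT => H; apply: nP; apply: Pq => //; apply: contrapT => nP; apply: H.
  - by exists (exist _ (x, y, s / 2) (conj s2 nP)); split=> //=; left.
  - by exists (exist _ (x + s / 2, y, s / 2) (conj s2 nP)); split=> //=; [right|left].
  - by exists (exist _ (x, y + s / 2, s / 2) (conj s2 nP)); split=> //=; [left|right].
  - by exists (exist _ (x + s / 2, y + s / 2, s / 2) (conj s2 nP)); split=> //=; right.
pose t0 : {t : R * R * R | 0 < t.2 /\ ~ P t.1.1 t.1.2 t.2} :=
  exist _ (x0, y0, s0) (conj s0_gt0 nP0).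
pose u n := sval (iter n (fun t => sval (step t)) t0).
have uS n : [/\ (u n.+1).2 = (u n).2 / 2,
     ((u n.+1).1.1 = (u n).1.1 \/ (u n.+1).1.1 = (u n).1.1 + (u n).2 / 2) &
     ((u n.+1).1.2 = (u n).1.2 \/ (u n.+1).1.2 = (u n).1.2 + (u n).2 / 2)].
  by rewrite /u iterS; case: (step _).
have uP n : 0 < (u n).2 /\ ~ P (u n).1.1 (u n).1.2 (u n).2.
  by rewrite /u; case: (iter _ _ _).
have [p pP] : exists p, forall n, (u n).1.1 <= p <= (u n).1.1 + (u n).2.
  apply: (nested_intervals (x := fun n => (u n).1.1) (s := fun n => (u n).2)) => n.
  - by have [_ [->|->] _] := uS n; have [h _] := uP n; lra.
  - by have [-> [->|->] _] := uS n; have [h _] := uP n; lra.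
  - by have [h _] := uP n; lra.
have [q qP] : exists q, forall n, (u n).1.2 <= q <= (u n).1.2 + (u n).2.
  apply: (nested_intervals (x := fun n => (u n).1.2) (s := fun n => (u n).2)) => n.
  - by have [_ _ [->|->]] := uS n; have [h _] := uP n; lra.
  - by have [-> _ [->|->]] := uS n; have [h _] := uP n; lra.
  - by have [h _] := uP n; lra.
have uin n : [/\ x0 <= (u n).1.1, (u n).1.1 + (u n).2 <= x0 + s0,
    y0 <= (u n).1.2 & (u n).1.2 + (u n).2 <= y0 + s0].
  elim: n => [|n [h1 h2 h3 h4]]; first by split.
  have [h _] := uP n; have [-> [->|->] [->|->]] := uS n; clear -h h1 h2 h3 h4; split; lra.
have [d d0 dP] := Ploc p q (pP 0%N) (qP 0%N).
(* The decay of the side like [2 ^ n] is weakened to a decay like [n.+1], which suffices to fall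
   below [d]. *)
have us n : (u n).2 * n.+1%:R <= s0.
  suff: (u n).2 * 2 ^+ n <= s0.
    apply: le_trans; rewrite ler_pM2l; last by case: (uP n).
    by rewrite -natrX ler_nat ltn_expl.
  elim: n => [|n IH]; first by rewrite expr0 mulr1.
  have [-> _ _] := uS n; rewrite exprS; apply: le_trans IH.
  by rewrite mulrA divfK.
have [n nP] : exists n, s0 / d < n%:R by exists (Num.trunc (s0 / d)).+1; apply: truncnS_gt.
have [un0 unP] := uP n; apply: unP; have [? ? ? ?] := uin n.
apply: dP => //; rewrite ?pP ?qP//.
move: nP; rewrite ltr_pdivrMr// => nP.
have := us n; have := uP n => -[h _].
rewrite -natr1 => h1; rewrite ltNge; apply/negP => h2.
have : d * n%:R <= (u n).2 * n%:R by rewrite ler_wpM2r.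
by lra.
Qed.

End SquareInduction.

(** * Continuity and complex differentiability with real moduli *)

Section Cdiff.
Variable R : realType.
Implicit Types (z w c v l : R[i]) (x y s e d : R) (g h : R[i] -> R[i]).

Definition ccont g z := forall e, 0 < e ->
  exists2 d, 0 < d & forall w, cabs (w - z) < d -> cabs (g w - g z) <= e.

(* Caratheodory's form of complex differentiability: [k z] is the derivative. *)
Definition cdiff g z := exists2 k : R[i] -> R[i], ccont k z &
  forall w, g w = g z + k w * (w - z).

Lemma ccont_cst c z : ccont (fun=> c) z.
Proof. by move=> e e0; exists 1 => // w _; rewrite subrr cabs0 ltW. Qed.

Lemma ccont_id z : ccont (fun w => w) z.
Proof. by move=> e e0; exists e => // w /ltW. Qed.

Lemma eq_ccont g h z d : 0 < d -> (forall w, cabs (w - z) < d -> g w = h w) ->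
  ccont g z -> ccont h z.
Proof.
move=> d0 gh gc e e0; have [d' d'0 H] := gc e e0.
exists (Num.min d d'); first by rewrite lt_min d0.
move=> w; rewrite lt_min => /andP[wd wd'].
by rewrite -!gh ?H// subrr cabs0.
Qed.

Lemma ccontD g h z : ccont g z -> ccont h z -> ccont (fun w => g w + h w) z.
Proof.
move=> gc hc e e0; have e2 : 0 < e / 2 by lra.
have [d d0 H] := gc _ e2; have [d' d'0 H'] := hc _ e2.
exists (Num.min d d'); first by rewrite lt_min d0.
move=> w; rewrite lt_min => /andP[wd wd'].
have -> : g w + h w - (g z + h z) = (g w - g z) + (h w - h z) by ring.
by apply: le_trans (cabsD _ _) _; have := H _ wd; have := H' _ wd'; lra.
Qed.

Lemma ccontM g h z : ccont g z -> ccont h z -> ccont (fun w => g w * h w) z.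
Proof.
move=> gc hc e e0.
have A0 := cabs_ge0 (g z); have B0 := cabs_ge0 (h z).
pose A := cabs (g z) + 1; pose B := cabs (h z) + 1.
have e1 : 0 < Num.min 1 (e / (A + B)).
  by rewrite lt_min ltr01 divr_gt0 // /A /B; lra.
have [d d0 H] := gc _ e1; have [d' d'0 H'] := hc _ e1.
exists (Num.min d d'); first by rewrite lt_min d0.
move=> w; rewrite lt_min => /andP[wd wd'].
have -> : g w * h w - g z * h z = (g w - g z) * h w + g z * (h w - h z) by ring.
apply: le_trans (cabsD _ _) _; rewrite !cabsM.
have := H' _ wd'; rewrite le_min => /andP[k1 k2].
have := H _ wd; rewrite le_min => /andP[k3 k4].
have hB : cabs (h w) <= B by have := cabs_sub (h w) (h z); rewrite /B; lra.
have AB : 0 < A + B by rewrite /A /B; lra.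
have -> : e = e / (A + B) * B + A * (e / (A + B)) by field; rewrite gt_eqF.
apply: lerD; apply: ler_pM => //; rewrite ?cabs_ge0//.
by rewrite /A; lra.
Qed.

Lemma ccontN g z : ccont g z -> ccont (fun w => - g w) z.
Proof.
move=> gc e e0; have [d d0 H] := gc _ e0; exists d => // w /H.
by have -> : - g w - - g z = - (g w - g z) by [ring]; rewrite cabsN.
Qed.

Lemma ccontB g h z : ccont g z -> ccont h z -> ccont (fun w => g w - h w) z.
Proof. by move=> gc hc; apply: ccontD => //; apply: ccontN. Qed.

Lemma ccontV g z : g z != 0 -> ccont g z -> ccont (fun w => (g w)^-1) z.
Proof.
move=> gz gc e e0; have A0 := cabs_gt0 gz.
have e1 : 0 < Num.min (cabs (g z) / 2) (e * cabs (g z) ^+ 2 / 2).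
  by rewrite lt_min divr_gt0// divr_gt0// mulr_gt0// exprn_gt0.
have [d d0 H] := gc _ e1; exists d => // w wd.
have := H _ wd; rewrite le_min => /andP[k1 k2].
have k3 : cabs (g z) / 2 <= cabs (g w).
  by have := cabs_sub (g z) (g w); rewrite cabs_distC; lra.
have gw : g w != 0 by apply/eqP => gw; move: k3; rewrite gw cabs0; lra.
have -> : (g w)^-1 - (g z)^-1 = (g z - g w) / (g w * g z) by field; rewrite gw gz.
rewrite cabs_div cabsM cabs_distC ler_pdivrMr ?mulr_gt0 ?cabs_gt0//.
apply: le_trans k2 _.
have : e * cabs (g z) * (cabs (g z) / 2) <= e * cabs (g z) * cabs (g w).
  by rewrite ler_pM2l // mulr_gt0.
by lra.
Qed.

Lemma ccont_neq0 g z : ccont g z -> g z != 0 ->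
  exists2 d, 0 < d & forall w, cabs (w - z) < d -> g w != 0.
Proof.
move=> gc gz; have A0 := cabs_gt0 gz.
have [d d0 H] := gc (cabs (g z) / 2) ltac:(lra); exists d => // w /H k.
by apply/eqP => gw; move: k; rewrite gw sub0r cabsN; lra.
Qed.

Lemma cdiff_ccont g z : cdiff g z -> ccont g z.
Proof.
move=> [k kc E].
have : ccont (fun w => g z + k w * (w - z)) z.
  apply: ccontD; first exact: ccont_cst.
  by apply: ccontM => //; apply: ccontB; [exact: ccont_id|exact: ccont_cst].
by apply: (@eq_ccont _ _ _ 1) => // w _; rewrite -E.
Qed.

Lemma cdiff_cst c z : cdiff (fun=> c) z.
Proof. by exists (fun=> 0) => [|w]; [exact: ccont_cst|rewrite mul0r addr0]. Qed.

Lemma cdiff_id z : cdiff (fun w => w) z.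
Proof. by exists (fun=> 1) => [|w]; [exact: ccont_cst|ring]. Qed.

(** The expansion in [cdiff] is demanded at every point, whereas [g] and [h] agree only near [z]:
    the factor for [h] is rebuilt as a difference quotient, which near [z] coincides with [k]. *)
Lemma eq_cdiff g h z d : 0 < d -> (forall w, cabs (w - z) < d -> g w = h w) ->
  cdiff g z -> cdiff h z.
Proof.
move=> d0 gh [k kc E].
exists (fun w => if w == z then k z else (h w - h z) / (w - z)).
  apply: (eq_ccont d0) kc => w wd; case: eqVneq => [->//|wz].
  have zz : cabs (z - z) < d by rewrite subrr cabs0.
  by rewrite -!gh// E addrC addKr mulfK// subr_eq0.
move=> w; case: eqVneq => [->|wz]; first by rewrite subrr mulr0 addr0.
by rewrite divfK ?subr_eq0// addrC subrK.
Qed.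

Lemma cdiffD g h z : cdiff g z -> cdiff h z -> cdiff (fun w => g w + h w) z.
Proof.
move=> [k kc E] [l lc F]; exists (fun w => k w + l w); first exact: ccontD.
by move=> w; rewrite E F; ring.
Qed.

Lemma cdiffM g h z : cdiff g z -> cdiff h z -> cdiff (fun w => g w * h w) z.
Proof.
move=> gd hd; have hc := cdiff_ccont hd; case: gd hd => [k kc E] [l lc F].
exists (fun w => k w * h w + g z * l w).
  by apply: ccontD; apply: ccontM => //; exact: ccont_cst.
by move=> w; rewrite E F; ring.
Qed.

Lemma cdiffN g z : cdiff g z -> cdiff (fun w => - g w) z.
Proof.
move=> [k kc E]; exists (fun w => - k w); first exact: ccontN.
by move=> w; rewrite E; ring.
Qed.

Lemma cdiffB g h z : cdiff g z -> cdiff h z -> cdiff (fun w => g w - h w) z.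
Proof. by move=> gc hc; apply: cdiffD => //; apply: cdiffN. Qed.

Lemma cdiffV g z : g z != 0 -> cdiff g z -> cdiff (fun w => (g w)^-1) z.
Proof.
move=> gz gd; have gc := cdiff_ccont gd; case: gd => [k kc E].
have [d d0 H] := ccont_neq0 gc gz.
apply: (@eq_cdiff (fun w => (g z)^-1 - k w / (g w * g z) * (w - z)) _ _ d) => //.
  move=> w /H gw; have kE : k w * (w - z) = g w - g z by rewrite (E w); ring.
  by rewrite mulrAC kE; field; rewrite gw gz.
exists (fun w => - (k w / (g w * g z))).
  apply: ccontN; apply: ccontM => //; apply: ccontV; first by rewrite mulf_neq0.
  by apply: ccontM => //; exact: ccont_cst.
by move=> w; ring.
Qed.

Lemma cdiff_div g h z : h z != 0 -> cdiff g z -> cdiff h z ->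
  cdiff (fun w => g w / h w) z.
Proof. by move=> hz gd hd; apply: cdiffM => //; apply: cdiffV. Qed.

Lemma cdiffX g n z : cdiff g z -> cdiff (fun w => g w ^+ n) z.
Proof.
move=> gd; elim: n => [|n IH].
  by apply: (@eq_cdiff (fun=> 1) _ _ 1) => //; exact: cdiff_cst.
by apply: (@eq_cdiff (fun w => g w * g w ^+ n) _ _ 1) => //; [move=> w _; rewrite exprS|exact: cdiffM].
Qed.

Lemma ccontX g n z : ccont g z -> ccont (fun w => g w ^+ n) z.
Proof.
move=> gd; elim: n => [|n IH].
  by apply: (@eq_ccont (fun=> 1) _ _ 1) => //; exact: ccont_cst.
by apply: (@eq_ccont (fun w => g w * g w ^+ n) _ _ 1) => //; [move=> w _; rewrite exprS|exact: ccontM].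
Qed.

(** A factor vanishing at [p] turns continuity at [p] into differentiability; this absorbs the
    exceptional points of [max_mod]. *)
Lemma cdiff_mulid g p : ccont g p -> cdiff (fun w => (w - p) * g w) p.
Proof. by move=> gc; exists g => // w; ring. Qed.

End Cdiff.

(** * Goursat's theorem for squares *)

Section Goursat.
Variable R : realType.
Implicit Types (z w c v l a b : R[i]) (x y s e d t : R) (g h : R[i] -> R[i]).

(* Riemann sums of [g] over the contour of a square with lower left corner [c]
   and side [s], with [2 ^ n] equally spaced samples on each edge. Opposite
   edges are sampled at translated points, so that the sums of an affine
   function vanish exactly. *)
Fixpoint avg g n z v : R[i] :=
  if n is m.+1 then (avg g m z (v / 2) + avg g m (z + v / 2) (v / 2)) / 2 else g z.

Definition csum g n c (s : R[i]) : R[i] :=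
  s * (avg g n c s - avg g n (c + ii * s) s
       + ii * (avg g n (c + s) (ii * s) - avg g n c (ii * s))).

(** The average over an edge at level [n.+1] is the mean of the averages over its halves at level
    [n], and the two sums over an inner edge use the same samples with opposite signs; hence the
    additivity is exact. *)
Lemma csumS g n c (h : R[i]) : csum g n.+1 c (h + h) =
  csum g n c h + csum g n (c + h) h + csum g n (c + ii * h) h + csum g n (c + h + ii * h) h.
Proof.
have two : (2 : R[i]) != 0 by rewrite pnatr_eq0.
rewrite /csum /=.
have -> : (h + h) / 2 = h by field.
have -> : ii * (h + h) / 2 = ii * h by field.
have -> : c + ii * (h + h) = c + ii * h + ii * h by ring.
have -> : c + (h + h) = c + h + h by ring.
have -> : c + ii * h + ii * h + h = c + h + ii * h + ii * h by ring.
have -> : c + ii * h + h = c + h + ii * h by ring.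
have -> : c + h + h + ii * h = c + h + ii * h + h by ring.
by field.
Qed.

(** An average is an iterated midpoint of values on the segment, so it inherits their
    midpoint-convex properties. *)
Lemma avg_ind (Q : R[i] -> Prop) g n z v :
  (forall a b, Q a -> Q b -> Q ((a + b) / 2)) ->
  (forall t, 0 <= t <= 1 -> Q (g (z + t%:C * v))) -> Q (avg g n z v).
Proof.
move=> Q2; elim: n z v => [|n IH] z v H /=.
  by have := H 0 ltac:(lra); rewrite mul0r addr0.
have two : (2 : R[i]) != 0 by rewrite pnatr_eq0.
apply: Q2; apply: IH => t t01.
  have := H (t / 2) ltac:(lra); congr (Q (g (_ + _))).
  by rewrite rmorphM fmorphV rmorph_nat; ring.
have := H ((1 + t) / 2) ltac:(lra); congr (Q (g _)).
by rewrite rmorphM fmorphV rmorph_nat rmorphD rmorph1; field.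
Qed.

Lemma avgD g h n z v : avg (fun w => g w + h w) n z v = avg g n z v + avg h n z v.
Proof. by elim: n z v => [//|n IH] z v /=; rewrite !IH; ring. Qed.

Lemma avgZ c g n z v : avg (fun w => c * g w) n z v = c * avg g n z v.
Proof. by elim: n z v => [//|n IH] z v /=; rewrite !IH; ring. Qed.

Lemma avg_affine a b n z w v :
  avg (fun u => a + b * u) n (z + w) v = avg (fun u => a + b * u) n z v + b * w.
Proof.
have two : (2 : R[i]) != 0 by rewrite pnatr_eq0.
elim: n z v => [|n IH] z v /=; first by ring.
have -> : z + w + v / 2 = z + v / 2 + w by [ring].
by rewrite !IH; field.
Qed.

Lemma csumD g h n c s : csum (fun w => g w + h w) n c s%:C = csum g n c s%:C + csum h n c s%:C.
Proof. by rewrite /csum !avgD; ring. Qed.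

Lemma csumZ b g n c s : csum (fun w => b * g w) n c s%:C = b * csum g n c s%:C.
Proof. by rewrite /csum !avgZ; ring. Qed.

Lemma csum_affine a b n c (s : R[i]) : csum (fun u => a + b * u) n c s = 0.
Proof. by rewrite /csum !avg_affine; ring. Qed.

Lemma eq_csum g h n c (s : R[i]) : (forall w, g w = h w) -> csum g n c s = csum h n c s.
Proof. by move=> gh; congr (csum _ _ _ _); apply/funext. Qed.

Lemma avg_le B g n z v : (forall t, 0 <= t <= 1 -> cabs (g (z + t%:C * v)) <= B) ->
  cabs (avg g n z v) <= B.
Proof.
move=> H; apply: (@avg_ind (fun a => cabs a <= B)) => // a b aB bB.
rewrite cabs_div cabs_nat ler_pdivrMr//; apply: le_trans (cabsD _ _) _; lra.
Qed.

Lemma csum_le B g n c s : 0 <= s ->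
  (forall t, 0 <= t <= 1 -> cabs (g (c + t%:C * s%:C)) <= B) ->
  (forall t, 0 <= t <= 1 -> cabs (g (c + ii * s%:C + t%:C * s%:C)) <= B) ->
  (forall t, 0 <= t <= 1 -> cabs (g (c + s%:C + t%:C * (ii * s%:C))) <= B) ->
  (forall t, 0 <= t <= 1 -> cabs (g (c + t%:C * (ii * s%:C))) <= B) ->
  cabs (csum g n c s%:C) <= 4 * s * B.
Proof.
move=> s0 H1 H2 H3 H4.
have K1 := avg_le n H1; have K2 := avg_le n H2.
have K3 := avg_le n H3; have K4 := avg_le n H4.
rewrite /csum cabsM cabsR ger0_norm//.
have -> : 4 * s * B = s * (B + B + (B + B)) by ring.
apply: ler_wpM2l => //; apply: le_trans (cabsD _ _) _; apply: lerD.
  by apply: le_trans (cabsB _ _) _; apply: lerD.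
by rewrite cabsM cabsi mul1r; apply: le_trans (cabsB _ _) _; apply: lerD.
Qed.

Definition insq x y s z := (x <= Re z <= x + s) && (y <= Im z <= y + s).

Lemma insq_edges x y s t : 0 <= s -> 0 <= t <= 1 ->
  let c : R[i] := x +i* y in
  [/\ insq x y s (c + t%:C * s%:C), insq x y s (c + ii * s%:C + t%:C * s%:C),
      insq x y s (c + s%:C + t%:C * (ii * s%:C)) & insq x y s (c + t%:C * (ii * s%:C))].
Proof.
move=> s0 /andP[t0 t1] c; rewrite /insq /c !ReImE.
have h1 : 0 <= t * s by rewrite mulr_ge0.
have h2 : t * s <= s by rewrite ler_piMl.
by split; lra.
Qed.

Lemma csum_le_sq B g n x y s : 0 <= s -> (forall z, insq x y s z -> cabs (g z) <= B) ->
  cabs (csum g n (x +i* y) s%:C) <= 4 * s * B.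
Proof. by move=> s0 H; apply: csum_le => // t /(insq_edges x y s0)[]; auto. Qed.

(* The multiplicity with which [x, x + s] contains [a]: half at the endpoints,
   so that it is exactly additive under bisection. *)
Definition mult (a : R) x s : R := (x <= a < x + s)%R%:R + (x < a <= x + s)%R%:R.

Lemma mult_add (a : R) x s : 0 < s -> mult a x s = mult a x (s / 2) + mult a (x + s / 2) (s / 2).
Proof.
move=> s0; rewrite /mult -[x + s / 2 + _]addrA -splitr.
have [h1|h1|h1] := ltgtP x a; have [h2|h2|h2] := ltgtP a (x + s);
  have [h3|h3|h3] := ltgtP a (x + s / 2); rewrite /=; lra.
Qed.
Lemma mult_ge0 (a : R) x s : 0 <= mult a x s.
Proof. by rewrite /mult addr_ge0. Qed.

Lemma mult_le (a : R) x s : mult a x s <= 2.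
Proof. by rewrite /mult; do 2 case: (_ && _); rewrite /=; lra. Qed.

Lemma mult_ge1 (a : R) x s : 0 < s -> x <= a <= x + s -> 1 <= mult a x s.
Proof.
by move=> s0; rewrite /mult; have [h1|h1|h1] := ltgtP x a;
  have [h2|h2|h2] := ltgtP a (x + s); rewrite //=; lra.
Qed.

Lemma insq_dist x y s z w : insq x y s z -> insq x y s w -> cabs (z - w) <= 2 * s.
Proof.
move=> /andP[z1 z2] /andP[w1 w2]; apply: le_trans (cabs_le_ReIm _) _.
rewrite !ReImE.
have : `|Re z - Re w| <= s by rewrite ler_norml; lra.
have : `|Im z - Im w| <= s by rewrite ler_norml; lra.
by lra.
Qed.

(** Bisection against a majorant that is additive like the contour sums. Away from [a] the affine
    part of [g] contributes nothing and the rest is small compared with the area; near [a] only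
    boundedness is available, and it is paid for by a point mass at [a]. *)
Lemma goursat g a B x0 y0 s0 : 0 < s0 ->
  (forall z, insq x0 y0 s0 z -> z != a -> cdiff g z) ->
  (forall z, insq x0 y0 s0 z -> cabs (g z) <= B) ->
  forall e, 0 < e -> exists M, forall n, (M <= n)%N -> cabs (csum g n (x0 +i* y0) s0%:C) <= e.
Proof.
move=> s0_gt0 gd gB e e0.
have B0 : 0 <= B.
  apply: le_trans (gB (x0 +i* y0) _); first exact: cabs_ge0.
  by rewrite /insq /=; lra.
pose e1 := e / (2 * s0 ^+ 2).
have e1_gt0 : 0 < e1 by rewrite divr_gt0// mulr_gt0// exprn_gt0.
(* The area term totals [e / 2] on the whole square, and so does at most the point mass, a product
   of two multiplicities being at most [4]. *)
pose mu x y s := e1 * s ^+ 2 + e / 8 * (mult (Re a) x s * mult (Im a) y s).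
suff [M H] : exists M, forall n, (M <= n)%N ->
    cabs (csum g n (x0 +i* y0) s0%:C) <= mu x0 y0 s0.
  exists M => n /H h; apply: le_trans h _; rewrite /mu.
  have -> : e1 * s0 ^+ 2 = e / 2 by rewrite /e1; field; rewrite gt_eqF.
  have : mult (Re a) x0 s0 * mult (Im a) y0 s0 <= 2 * 2.
    by apply: ler_pM; rewrite ?mult_ge0 ?mult_le.
  have : 0 < e / 8 by lra.
  move: (_ * mult _ _ _) => m ? m4.
  have : e / 8 * m <= e / 8 * (2 * 2) by rewrite ler_pM2l.
  by lra.
apply: (@square_ind _ (fun x y s => exists M, forall n, (M <= n)%N ->
    cabs (csum g n (x +i* y) s%:C) <= mu x y s)) => //.
- move=> x y s s_gt0 [M1 H1] [M2 H2] [M3 H3] [M4 H4].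
  exists (maxn (maxn M1 M2) (maxn M3 M4)).+1 => -[//|n].
  rewrite ltnS !geq_max => /andP[/andP[n1 n2] /andP[n3 n4]].
  have hs : s%:C = (s / 2)%:C + (s / 2)%:C :> R[i] by rewrite -rmorphD -splitr.
  rewrite {1}hs csumS.
  have -> : (x +i* y) + (s / 2)%:C = (x + s / 2) +i* y.
    by apply/eqP; rewrite eq_complex !ReImE /= addr0 !eqxx.
  have -> : (x +i* y) + ii * (s / 2)%:C = x +i* (y + s / 2).
    by apply/eqP; rewrite eq_complex !ReImE; apply/andP; split; apply/eqP; ring.
  have -> : ((x + s / 2) +i* y) + ii * (s / 2)%:C = (x + s / 2) +i* (y + s / 2).
    by apply/eqP; rewrite eq_complex !ReImE; apply/andP; split; apply/eqP; ring.
  have -> : mu x y s = mu x y (s / 2) + mu (x + s / 2) y (s / 2)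
      + mu x (y + s / 2) (s / 2) + mu (x + s / 2) (y + s / 2) (s / 2).
    by rewrite /mu (mult_add _ x)// (mult_add _ y)//; field.
  do 3 (apply: le_trans (cabsD _ _) _; apply: lerD; last by auto).
  by auto.
- move=> p q px qy.
  have [pa|pa] := eqVneq (p +i* q) a.
    (* For a side below [d] the perimeter times [B] stays below [e / 8], which the point mass
       exceeds since both multiplicities are at least [1]. *)
    pose d := e / 8 / (4 * B + 1).
    have d0 : 0 < d by rewrite !divr_gt0//; lra.
    exists d => // x y s s_gt0 sd h1 h2 h3 h4 h5 h6; exists 0%N => n _.
    apply: le_trans (@csum_le_sq B _ _ _ _ _ (ltW s_gt0) _) _.
      move=> z /andP[z1 z2]; apply: gB; rewrite /insq; lra.
    have m1 : 1 <= mult (Re a) x s * mult (Im a) y s.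
      by apply: (@mulr_ege1 R); apply: mult_ge1 => //; rewrite -pa.
    rewrite /mu; have : 0 <= e1 * s ^+ 2 by rewrite mulr_ge0// ?sqr_ge0 ?ltW.
    have : e / 8 * 1 <= e / 8 * (mult (Re a) x s * mult (Im a) y s) by rewrite ler_pM2l//; lra.
    move: sd; rewrite /d ltr_pdivlMr; last by lra.
    by lra.
  have [k kc E] := gd (p +i* q) ltac:(rewrite /insq /=; lra) pa.
  have [d d0 H] := kc (e1 / 8) ltac:(lra).
  exists (d / 2); first by lra.
  move=> x y s s_gt0 sd h1 h2 h3 h4 h5 h6; exists 0%N => n _.
  set z0 := p +i* q in E H.
  (* The tangent map at [z0] is split off; what remains is at most [e1 / 8 * (2 * s)], and times the
     perimeter [4 * s] this is the area term. *)
  rewrite (@eq_csum _ (fun w => ((g z0 - k z0 * z0) + k z0 * w) + (k w - k z0) * (w - z0))); last first.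
    by move=> w; rewrite E; ring.
  rewrite csumD csum_affine add0r.
  apply: le_trans (@csum_le_sq (e1 / 8 * (2 * s)) _ _ _ _ _ (ltW s_gt0) _) _.
    move=> z zs; have zz : cabs (z - z0) <= 2 * s.
      by apply: insq_dist zs _; rewrite /insq /z0 /=; lra.
    rewrite cabsM; apply: ler_pM; rewrite ?cabs_ge0//; apply: H; lra.
  rewrite /mu.
  have : 0 <= e / 8 * (mult (Re a) x s * mult (Im a) y s).
    by rewrite !mulr_ge0 ?mult_ge0//; lra.
  lra.
Qed.

End Goursat.

(** * Maximum principle with exceptional points *)

Section MaxMod.
Variable R : realType.
Implicit Types (z w c v l a b p : R[i]) (x y s e d t : R) (g h k : R[i] -> R[i]).

Lemma ImV w : Im w^-1 = - Im w / (Re w ^+ 2 + Im w ^+ 2).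
Proof. by case: w => x y /=; rewrite mulNr. Qed.

Lemma ReV w : Re w^-1 = Re w / (Re w ^+ 2 + Im w ^+ 2).
Proof. by case: w => x y. Qed.

Lemma Re_half z : Re (z / 2) = Re z / 2.
Proof.
have -> : (2 : R[i])^-1 = (2^-1)%:C by rewrite fmorphV rmorph_nat.
by rewrite !ReImE mulr0 subr0.
Qed.

Lemma Im_half z : Im (z / 2) = Im z / 2.
Proof.
have -> : (2 : R[i])^-1 = (2^-1)%:C by rewrite fmorphV rmorph_nat.
by rewrite !ReImE mulr0 add0r.
Qed.

Lemma bounded_sq k x y s : 0 < s -> (forall z, insq x y s z -> ccont k z) ->
  exists B, forall z, insq x y s z -> cabs (k z) <= B.
Proof.
move=> s0 kc.
apply: (@square_ind _ (fun x y s => exists B, forall z, insq x y s z -> cabs (k z) <= B)) => //.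
  move=> {s0 kc}x {}y {}s s0 [B1 H1] [B2 H2] [B3 H3] [B4 H4].
  exists (Num.max (Num.max B1 B2) (Num.max B3 B4)) => z /andP[z1 z2].
  rewrite !le_max.
  have [h1|h1] := leP (Re z) (x + s / 2); have [h2|h2] := leP (Im z) (y + s / 2).
  - by rewrite H1// /insq; lra.
  - by rewrite H3 ?orbT// /insq; lra.
  - by rewrite H2 ?orbT// /insq; lra.
  - by rewrite H4 ?orbT// /insq; lra.
move=> p q px qy; have [|d d0 H] := kc (p +i* q) _ 1 ltr01; first by rewrite /insq /=; lra.
exists (d / 2); first by lra.
move=> x' y' s' s'0 s'd _ _ _ _ px' qy'; exists (cabs (k (p +i* q)) + 1) => z zs.
have : cabs (z - (p +i* q)) <= 2 * s' by apply: insq_dist zs _; rewrite /insq /=; lra.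
move=> h; have := H z ltac:(lra); have := cabs_sub (k z) (k (p +i* q)); lra.
Qed.

Lemma insq_center z w t : insq (Re z - t) (Im z - t) (2 * t) w -> cabs (w - z) <= 2 * t.
Proof.
move=> /andP[w1 w2]; apply: le_trans (cabs_le_ReIm _) _; rewrite !ReImE.
have : `|Re w - Re z| <= t by rewrite ler_norml; lra.
have : `|Im w - Im z| <= t by rewrite ler_norml; lra.
by lra.
Qed.

(* Cauchy's integral formula, in the weak form that the value at the center is
   controlled by the values on the boundary. The factor [2] does not matter, as
   it disappears when the bound is applied to powers of [g]. *)
Lemma weak_max_mod g z t B : 0 < t ->
  (forall w, cabs (w - z) <= 2 * t -> cdiff g w) ->
  (forall w, t <= cabs (w - z) -> cabs (w - z) <= 2 * t -> cabs (g w) <= B) -> cabs (g z) <= 2 * B.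
Proof.
move=> t0 gd gB; pose x0 : R := Re z - t; pose y0 : R := Im z - t; pose c : R[i] := x0 +i* y0.
(* [G] is differentiable off [z] and bounded, so its contour sums tend to [0]: those of
   [g w / (w - z)] and of [g z / (w - z)] differ by little. *)
pose G w := (g w - g z) / (w - z).
have s0 : 0 < 2 * t by lra.
have zz : cabs (z - z) <= 2 * t by rewrite subrr cabs0; lra.
have [k kc E] := gd z zz.
have Gk w : w != z -> G w = k w.
  by move=> wz; rewrite /G E (addrC (g z)) addrK mulfK// subr_eq0.
have Gd w : insq (Re z - t) (Im z - t) (2 * t) w -> w != z -> cdiff G w.
  move=> /insq_center wz w0; apply: cdiff_div; first by rewrite subr_eq0.
    by apply: cdiffB; [exact: gd|exact: cdiff_cst].
  by apply: cdiffB; [exact: cdiff_id|exact: cdiff_cst].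
have [BG GB] : exists BG, forall w, insq (Re z - t) (Im z - t) (2 * t) w -> cabs (G w) <= BG.
  have [w ws|BG H] := @bounded_sq k (Re z - t) (Im z - t) (2 * t) s0.
    have [->//|wz] := eqVneq w z; apply: (@eq_ccont _ G); last exact/cdiff_ccont/Gd.
      by apply: (@cabs_gt0 _ (w - z)); rewrite subr_eq0.
    move=> u uw; apply: Gk; apply/eqP => uz.
    by move: uw; rewrite uz cabs_distC ltxx.
  exists BG => w ws; have [->|wz] := eqVneq w z; last by rewrite Gk// H.
  rewrite /G subrr mul0r cabs0; apply: le_trans (H w ws); exact: cabs_ge0.
have edges u : 0 <= u <= 1 ->
  [/\ Im (c + u%:C * (2 * t)%:C - z) = - t /\ `|Re (c + u%:C * (2 * t)%:C - z)| <= t,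
      Im (c + ii * (2 * t)%:C + u%:C * (2 * t)%:C - z) = t /\
        `|Re (c + ii * (2 * t)%:C + u%:C * (2 * t)%:C - z)| <= t,
      Re (c + (2 * t)%:C + u%:C * (ii * (2 * t)%:C) - z) = t /\
        `|Im (c + (2 * t)%:C + u%:C * (ii * (2 * t)%:C) - z)| <= t &
      Re (c + u%:C * (ii * (2 * t)%:C) - z) = - t /\
        `|Im (c + u%:C * (ii * (2 * t)%:C) - z)| <= t].
  move=> /andP[u0 u1]; rewrite /c !ReImE /x0 /y0.
  have h1 : 0 <= u * t by rewrite mulr_ge0// ltW.
  have h2 : u * t <= t by rewrite ler_piMl// ltW.
  by split; split; rewrite ?ler_norml; lra.
(* The contour of the square of half side [t] lies in the annulus where [gB] applies. *)
have near_re a : (`|Re a| = t /\ `|Im a| <= t \/ `|Im a| = t /\ `|Re a| <= t) ->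
    t <= cabs a /\ cabs a <= 2 * t.
  move=> H; split; last by apply: le_trans (cabs_le_ReIm _) _; case: H => -[]; lra.
  by case: H => -[<- _]; [exact: cabs_Re|exact: cabs_Im].
have tt : `|t| = t by rewrite ger0_norm// ltW.
have ntt : `|- t| = t by rewrite normrN.
have H1 n : cabs (csum (fun w => g w / (w - z)) n c (2 * t)%:C) <= 8 * B.
  have -> : 8 * B = 4 * (2 * t) * (B / t) by field; rewrite gt_eqF.
  have gB' w : t <= cabs (w - z) /\ cabs (w - z) <= 2 * t -> cabs (g w / (w - z)) <= B / t.
    move=> [w1 w2]; rewrite cabs_div; apply: ler_pM; rewrite ?invr_ge0 ?cabs_ge0//; first exact: gB.
    by rewrite lef_pV2// ?posrE//; lra.
  apply: csum_le; first by lra.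
  - by move=> u /edges[[e1 e2] _ _ _]; apply/gB'/near_re; right; rewrite e1.
  - by move=> u /edges[_ [e1 e2] _ _]; apply/gB'/near_re; right; rewrite e1.
  - by move=> u /edges[_ _ [e1 e2] _]; apply/gB'/near_re; left; rewrite e1.
  - by move=> u /edges[_ _ _ [e1 e2]]; apply/gB'/near_re; left; rewrite e1.
have inv_le (a b : R) : `|b| = t -> `|a| <= t -> 1 / (2 * t) <= t / (a ^+ 2 + b ^+ 2).
  move=> bt at_; have b2 : b ^+ 2 = t ^+ 2 by rewrite -(real_normK (num_real b)) bt.
  have a2 : a ^+ 2 <= t ^+ 2.
    by rewrite -(real_normK (num_real a)) ler_pXn2r// nnegrE ltW.
  have t2 : 0 < t ^+ 2 by rewrite exprn_gt0.
  have a20 := sqr_ge0 a.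
  rewrite b2 ler_pdivlMr; last by lra.
  rewrite mulrAC ler_pdivrMr//; lra.
(* A lower bound for the winding number integral, whose modulus is [2 * pi]: each edge average
   contributes at least [1 / (2 * t)] to the imaginary part, and the four are multiplied by the side
   [2 * t]. *)
have H2 n : 4 <= cabs (csum (fun w => 1 / (w - z)) n c (2 * t)%:C).
  apply: le_trans (cabs_Im _); apply: le_trans (ler_norm _).
  rewrite /csum.
  set a1 := avg _ _ c (2 * t)%:C; set a2 := avg _ _ _ (2 * t)%:C.
  set a3 := avg _ _ (c + (2 * t)%:C) _; set a4 := avg _ _ _ (ii * (2 * t)%:C).
  have I1 : 1 / (2 * t) <= Im a1.
    rewrite /a1.
    apply: (@avg_ind _ (fun a => 1 / (2 * t) <= Im a)).
      by move=> a b ? ?; rewrite Im_half ImD; lra.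
    move=> u /edges[[e1 e2] _ _ _]; cbv beta; rewrite [1 / (_ - z)]div1r ImV e1 opprK.
    by apply: inv_le; rewrite ?ntt ?tt.
  have I2 : 1 / (2 * t) <= - Im a2.
    rewrite /a2.
    apply: (@avg_ind _ (fun a => 1 / (2 * t) <= - Im a)).
      by move=> a b ? ?; rewrite Im_half ImD; lra.
    move=> u /edges[_ [e1 e2] _ _]; cbv beta; rewrite [1 / (_ - z)]div1r ImV mulNr opprK e1.
    by apply: inv_le; rewrite ?ntt ?tt.
  have I3 : 1 / (2 * t) <= Re a3.
    rewrite /a3.
    apply: (@avg_ind _ (fun a => 1 / (2 * t) <= Re a)).
      by move=> a b ? ?; rewrite Re_half ReD; lra.
    move=> u /edges[_ _ [e1 e2] _]; cbv beta; rewrite [1 / (_ - z)]div1r ReV e1 addrC.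
    by apply: inv_le; rewrite ?ntt ?tt.
  have I4 : 1 / (2 * t) <= - Re a4.
    rewrite /a4.
    apply: (@avg_ind _ (fun a => 1 / (2 * t) <= - Re a)).
      by move=> a b ? ?; rewrite Re_half ReD; lra.
    move=> u /edges[_ _ _ [e1 e2]]; cbv beta; rewrite [1 / (_ - z)]div1r ReV -mulNr e1 opprK addrC.
    by apply: inv_le; rewrite ?ntt ?tt.
  rewrite !ReImE.
  have e4 : 4 = 2 * t * (4 * (1 / (2 * t))) by field; rewrite gt_eqF.
  have : 2 * t * (4 * (1 / (2 * t))) <= 2 * t * (Im a1 - Im a2 + Re a3 - Re a4).
    by rewrite ler_pM2l//; lra.
  by rewrite -e4; lra.
apply/ler_addgt0Pr => e e0.
have [M HM] := goursat s0 Gd GB (e := 4 * e) ltac:(lra).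
have h3 := HM M (leqnn _); have h1 := H1 M; have h2 := H2 M.
have E2 : csum (fun w => g w / (w - z)) M c (2 * t)%:C =
    csum G M c (2 * t)%:C + g z * csum (fun w => 1 / (w - z)) M c (2 * t)%:C.
  rewrite -csumZ -csumD; apply: eq_csum => w; rewrite /G; ring.
have h4 : cabs (g z * csum (fun w => 1 / (w - z)) M c (2 * t)%:C) <= 8 * B + 4 * e.
  have -> : g z * csum (fun w => 1 / (w - z)) M c (2 * t)%:C =
    csum (fun w => g w / (w - z)) M c (2 * t)%:C - csum G M c (2 * t)%:C.
    by rewrite E2; ring.
  by apply: le_trans (cabsB _ _) _; apply: lerD.
move: h4; rewrite cabsM => h4.
have : cabs (g z) * 4 <= cabs (g z) * cabs (csum (fun w => 1 / (w - z)) M c (2 * t)%:C).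
  by rewrite ler_wpM2l// cabs_ge0.
by lra.
Qed.

Lemma pow_bound (x y M B : R) : 0 < x -> 0 <= B -> 0 <= y ->
  (forall n, x * y ^+ n.+1 <= M * B ^+ n.+1) -> y <= B.
Proof.
move=> x0 B0 y0 H; rewrite leNgt; apply/negP => By.
have [B00|Bn0] := eqVneq B 0.
  have := H 0%N; rewrite B00 !expr1 mulr0 => h.
  have : 0 < x * y by rewrite mulr_gt0//; lra.
  by lra.
have B1 : 0 < B by rewrite lt_neqAle eq_sym Bn0.
pose q := y / B - 1.
have q0 : 0 < q by rewrite /q subr_gt0 ltr_pdivlMr// mul1r.
have bern n : 1 + n%:R * q <= (1 + q) ^+ n.
  elim: n => [|n IH]; first by rewrite mul0r addr0 expr0.
  rewrite exprS -natr1; have h1 : (1 + q) * (1 + n%:R * q) <= (1 + q) * (1 + q) ^+ n.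
    by rewrite ler_pM2l//; lra.
  have h2 : 0 <= n%:R * (q * q) by apply: mulr_ge0 => //; apply: mulr_ge0; lra.
  by lra.
have key n : x * (1 + n.+1%:R * q) <= M.
  apply: le_trans (_ : x * (1 + q) ^+ n.+1 <= _); first by rewrite ler_pM2l.
  have -> : 1 + q = y / B by rewrite /q addrC subrK.
  by rewrite expr_div_n mulrA ler_pdivrMr ?exprn_gt0.
have [n nP] : exists n, M / (x * q) < n%:R.
  by exists (Num.trunc (M / (x * q))).+1; apply: truncnS_gt.
have := key n; move: nP; rewrite ltr_pdivrMr ?mulr_gt0// -natr1 => h1 h2.
have : 0 < x * q by rewrite mulr_gt0.
by lra.
Qed.

(** The weak principle is applied to [(w - p1) * (w - p2) * g w ^ n.+1], which is differentiable at
    [p1] and [p2] as well. The factors [2] and [A] do not depend on [n] and are removed by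
    [pow_bound]; this asks for the linear factors to be nonzero at the center. *)
Lemma max_mod g z t p1 p2 B : 0 < t -> p1 != z -> p2 != z ->
  (forall w, cabs (w - z) <= 2 * t -> w != p1 -> w != p2 -> cdiff g w) ->
  (forall w, cabs (w - z) <= 2 * t -> ccont g w) ->
  (forall w, t <= cabs (w - z) -> cabs (w - z) <= 2 * t -> cabs (g w) <= B) -> cabs (g z) <= B.
Proof.
move=> t0 p1z p2z gd gc gB.
have B0 : 0 <= B.
  apply: le_trans (cabs_ge0 (g (z + t%:C))) (gB _ _ _); rewrite addrC addKr cabsR ger0_norm; lra.
pose A := (2 * t + cabs (z - p1)) * (2 * t + cabs (z - p2)).
apply: (@pow_bound (cabs (z - p1) * cabs (z - p2)) _ (2 * A)); rewrite ?cabs_ge0//.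
  by rewrite mulr_gt0// cabs_gt0// subr_eq0 eq_sym.
move=> n; pose h w := (w - p1) * ((w - p2) * g w ^+ n.+1).
have -> : cabs (z - p1) * cabs (z - p2) * cabs (g z) ^+ n.+1 = cabs (h z).
  by rewrite /h !cabsM cabsX mulrA.
rewrite -mulrA; apply: (@weak_max_mod _ _ t) => // w.
  move=> wz.
  have idd p u : cdiff (fun w => w - p) u.
    by apply: cdiffB; [exact: cdiff_id|exact: cdiff_cst].
  have gcn : ccont (fun w => g w ^+ n.+1) w by apply/ccontX/gc.
  have [wp1|wp1] := eqVneq w p1.
    rewrite {1}wp1 /h; apply: cdiff_mulid; apply: ccontM; last by rewrite -wp1.
    exact/cdiff_ccont/idd.
  have [wp2|wp2] := eqVneq w p2.
    rewrite /h; apply: cdiffM; first exact: idd.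
    by rewrite {1}wp2; apply: cdiff_mulid; rewrite -wp2.
  by rewrite /h; do 2 (apply: cdiffM; first exact: idd); apply/cdiffX/gd.
move=> w1 w2; rewrite /h !cabsM cabsX mulrA; apply: ler_pM; rewrite ?mulr_ge0 ?exprn_ge0 ?cabs_ge0//.
  apply: ler_pM; rewrite ?cabs_ge0//.
    by have := cabs_tri z w p1; lra.
  by have := cabs_tri z w p2; lra.
by apply: lerXn2r; rewrite ?nnegrE ?cabs_ge0//; apply: gB.
Qed.

End MaxMod.

(** * Uniformity on discs, Schwarz lemma, minimum principle *)

Section Disc.
Variable R : realType.
Implicit Types (z w c v l a b p : R[i]) (x y s r e d t : R) (g h k : R[i] -> R[i]).

(** A Lebesgue number argument. [A z d] may be any condition that survives a decrease of [d]: a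
    modulus [d], but also a bound or an index threshold in the guise of [d^-1]. *)
Lemma disc_unif (A : R[i] -> R -> Prop) c r :
  (forall z d d', 0 < d' -> d' <= d -> A z d -> A z d') ->
  (forall z, cabs (z - c) <= r -> exists2 d, 0 < d &
     forall w, cabs (w - c) <= r -> cabs (w - z) < d -> A w d) ->
  exists2 d, 0 < d & forall z, cabs (z - c) <= r -> A z d.
Proof.
move=> Ad Aloc.
pose P x y s := exists2 d, 0 < d & forall z, cabs (z - c) <= r -> insq x y s z -> A z d.
pose r1 := `|r| + 1.
have r1_gt : r < r1 by rewrite /r1; have := ler_norm r; lra.
have r1_gt0 : 0 < r1 by rewrite /r1; have := normr_ge0 r; lra.
suff [d d0 H] : P (Re c - r1) (Im c - r1) (2 * r1).
  exists d => // z zr; apply: H => //.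
  have := cabs_Re (z - c); have := cabs_Im (z - c).
  by rewrite !ReImE !ler_norml /insq; lra.
apply: square_ind; first by lra.
  move=> x y s s0 [d1 d1_gt0 H1] [d2 d2_gt0 H2] [d3 d3_gt0 H3] [d4 d4_gt0 H4].
  pose d := Num.min (Num.min d1 d2) (Num.min d3 d4).
  have d0 : 0 < d by rewrite !lt_min d1_gt0 d2_gt0 d3_gt0 d4_gt0.
  have : d <= d by [].
  rewrite {2}/d !le_min => /andP[/andP[dd1 dd2] /andP[dd3 dd4]].
  exists d => // z zr /andP[z1 z2].
  have [h1|h1] := leP (Re z) (x + s / 2); have [h2|h2] := leP (Im z) (y + s / 2).
  - by apply: Ad dd1 _ => //; apply: H1 => //; rewrite /insq; lra.
  - by apply: Ad dd3 _ => //; apply: H3 => //; rewrite /insq; lra.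
  - by apply: Ad dd2 _ => //; apply: H2 => //; rewrite /insq; lra.
  - by apply: Ad dd4 _ => //; apply: H4 => //; rewrite /insq; lra.
move=> p q px qy; pose z0 : R[i] := p +i* q.
have [zr|zr] := leP (cabs (z0 - c)) r.
  have [d d0 H] := Aloc z0 zr; exists (d / 2); first by lra.
  move=> x y s s0 sd _ _ _ _ px' qy'; exists d => // z zc zs; apply: H => //.
  have : cabs (z - z0) <= 2 * s by apply: insq_dist zs _; rewrite /insq /z0 /=; lra.
  lra.
exists ((cabs (z0 - c) - r) / 2); first by lra.
move=> x y s s0 sd _ _ _ _ px' qy'; exists 1 => // z zc zs; exfalso.
have : cabs (z - z0) <= 2 * s by apply: insq_dist zs _; rewrite /insq /z0 /=; lra.
have := cabs_tri z z0 c; rewrite (cabs_distC z0 z); lra.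
Qed.

Lemma disc_unif_cont k c r e : 0 < e -> (forall z, cabs (z - c) <= r -> ccont k z) ->
  exists2 d, 0 < d & forall z w, cabs (z - c) <= r -> cabs (w - c) <= r ->
    cabs (w - z) < d -> cabs (k w - k z) <= e.
Proof.
move=> e0 kc.
have [||d d0 H] := @disc_unif (fun z d => forall w, cabs (w - c) <= r ->
    cabs (w - z) < d -> cabs (k w - k z) <= e) c r.
- by move=> z d d' _ dd H w wc wz; apply: H => //; exact: lt_le_trans dd.
- move=> z zc; have [d d0 H] := kc z zc (e / 2) ltac:(lra).
  exists (d / 2); first by lra.
  move=> w wc wz v vc vw; have h1 := H w ltac:(lra).
  have h2 := H v ltac:(have := cabs_tri w v z; lra).
  by have := cabs_tri (k z) (k v) (k w); rewrite (cabs_distC (k z)); lra.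
by exists d => // z w zc wc; apply: H.
Qed.

Lemma disc_bounded k c r : (forall z, cabs (z - c) <= r -> ccont k z) ->
  exists2 B, 0 < B & forall z, cabs (z - c) <= r -> cabs (k z) <= B.
Proof.
move=> kc.
have [||d d0 H] := @disc_unif (fun z d => cabs (k z) <= d^-1) c r.
- by move=> z d d' d'0 dd H; apply: le_trans H _; rewrite lef_pV2// posrE//; lra.
- move=> z zc; have [d d0 H] := kc z zc 1 ltr01.
  have k0 := cabs_ge0 (k z).
  have k1 : 0 < (cabs (k z) + 1)^-1 by rewrite invr_gt0; lra.
  exists (Num.min d (cabs (k z) + 1)^-1); first by rewrite lt_min d0.
  move=> w wc; rewrite lt_min => /andP[wd _].
  apply: (@le_trans _ _ (cabs (k z) + 1)).
    by have := H w wd; have := cabs_sub (k w) (k z); lra.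
  rewrite -[X in X <= _]invrK lef_pV2 ?posrE ?lt_min ?d0// ge_min lexx orbT//.
by exists d^-1 => //; rewrite invr_gt0.
Qed.

Lemma diff_quot g a : cdiff g a -> exists k, [/\ ccont k a,
  forall w, g w = g a + k w * (w - a), forall w, w != a -> k w = (g w - g a) / (w - a),
  forall w, w != a -> ccont g w -> ccont k w & forall w, w != a -> cdiff g w -> cdiff k w].
Proof.
move=> [k kc E]; exists k.
have Ek w : w != a -> k w = (g w - g a) / (w - a).
  by move=> wa; rewrite E (addrC (g a)) addrK mulfK// subr_eq0.
have Ed w : w != a -> 0 < cabs (w - a) by move=> wa; apply: cabs_gt0; rewrite subr_eq0.
have Ew w u : cabs (u - w) < cabs (w - a) -> u != a.
  by move=> uw; apply/eqP => ua; move: uw; rewrite ua cabs_distC ltxx.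
split=> // w wa gw.
  apply: (@eq_ccont _ (fun w => (g w - g a) / (w - a)) _ _ _ (Ed w wa)).
    by move=> u /Ew/Ek.
  apply: ccontM; first by apply: ccontB => //; exact: ccont_cst.
  apply: ccontV; first by rewrite subr_eq0.
  by apply: ccontB; [exact: ccont_id|exact: ccont_cst].
apply: (@eq_cdiff _ (fun w => (g w - g a) / (w - a)) _ _ _ (Ed w wa)).
  by move=> u /Ew/Ek.
apply: cdiff_div; first by rewrite subr_eq0.
  by apply: cdiffB => //; exact: cdiff_cst.
by apply: cdiffB; [exact: cdiff_id|exact: cdiff_cst].
Qed.

(** The maximum principle for the difference quotient at [a], with center [z] because [a] is one of
    its exceptional points; the other, [p], is left to the caller. On the annulus around [z] the
    distance to [a] is at least [s / 8], whence the bound [2 * B / (s / 8)]. *)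
Lemma schwarz_lip g a p z s B : 0 < s -> p != a -> p != z ->
  (forall w, cabs (w - a) < s -> w != p -> cdiff g w) ->
  (forall w, cabs (w - a) < s -> ccont g w) ->
  (forall w, cabs (w - a) < s -> cabs (g w) <= B) ->
  cabs (z - a) <= s / 8 -> cabs (g z - g a) <= 16 * B / s * cabs (z - a).
Proof.
move=> s0 pa pz gd gc gB za.
have [->|z_a] := eqVneq z a; first by rewrite !subrr cabs0 mulr0.
have aa : cabs (a - a) < s by rewrite subrr cabs0.
have B0 : 0 <= B by apply: le_trans (gB a aa); exact: cabs_ge0.
have [|k [kc E Ek kcw kdw]] := diff_quot (g := g) (a := a); first by apply: gd => //; rewrite eq_sym.
rewrite {1}E (addrC (g a)) addrK cabsM; apply: ler_wpM2r; first exact: cabs_ge0.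
have in_s w : cabs (w - z) <= 2 * (s / 4) -> cabs (w - a) < s.
  by have := cabs_tri z w a; lra.
apply: (@max_mod _ k z (s / 4) a p) => //; first by lra.
- by rewrite eq_sym.
- by move=> w /in_s wz wa wp; apply: kdw => //; apply: gd.
- by move=> w /in_s wz; have [->//|wa] := eqVneq w a; apply: kcw => //; apply: gc.
move=> w w1 w2; have := in_s w w2 => wa.
have wa8 : s / 8 <= cabs (w - a) by have := cabs_tri a w z; rewrite (cabs_distC a z); lra.
have w_a : w != a by apply/eqP => wE; move: wa8; rewrite wE subrr cabs0; lra.
rewrite Ek// cabs_div ler_pdivrMr; last by lra.
apply: le_trans (cabsB _ _) _; have h1 := gB w wa; have h2 := gB a aa.
have : 16 * B / s * (s / 8) <= 16 * B / s * cabs (w - a).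
  by rewrite ler_wpM2l// divr_ge0//; [lra|exact: ltW].
have -> : 16 * B / s * (s / 8) = 2 * B by field; rewrite gt_eqF.
lra.
Qed.

(** An omitted [w] would make [(g u - w)^-1] differentiable, with a value at the center above its
    bound [m^-1] on the annulus. *)
Lemma attained_center g a t m w : 0 < t -> (forall u, cabs (u - a) <= 2 * t -> cdiff g u) ->
  (forall u, t <= cabs (u - a) -> cabs (u - a) <= 2 * t -> m <= cabs (g u - w)) ->
  cabs (g a - w) < m -> exists2 u, cabs (u - a) <= 2 * t & g u = w.
Proof.
move=> t0 gd gm gam; apply: contrapT => nw.
have gw u : cabs (u - a) <= 2 * t -> g u - w != 0.
  by move=> ua; rewrite subr_eq0; apply/eqP => guw; apply: nw; exists u.
have m0 : 0 < m by apply: le_lt_trans gam; exact: cabs_ge0.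
have aa : cabs (a - a) <= 2 * t by rewrite subrr cabs0; lra.
(* There is no exceptional point here; [a + 1] fills the two places in [max_mod]. *)
have a1 : a + 1 != a by rewrite -subr_eq0 addrC addKr oner_neq0.
have vd u : cabs (u - a) <= 2 * t -> cdiff (fun u => (g u - w)^-1) u.
  move=> ua; apply: cdiffV; first exact: gw.
  by apply: cdiffB; [exact: gd|exact: cdiff_cst].
have : cabs ((g a - w)^-1) <= m^-1.
  apply: (@max_mod _ (fun u => (g u - w)^-1) a t (a + 1) (a + 1)) => //.
  - by move=> u ua _ _; exact: vd.
  - by move=> u ua; apply/cdiff_ccont/vd.
  move=> u u1 u2; rewrite cabsV lef_pV2 ?posrE//; first exact: gm.
  by apply/cabs_gt0/gw.
by rewrite cabsV lef_pV2 ?posrE// ?cabs_gt0 ?gw//; lra.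
Qed.

End Disc.

(** * Square roots and inverses on discs *)

Section Koebe.
Variable R : realType.
Implicit Types (z w c v l a b p : R[i]) (x y s r e d t : R) (g h k G H : R[i] -> R[i]).

Lemma ccont_comp g k z : ccont g z -> ccont k (g z) -> ccont (fun w => k (g w)) z.
Proof.
move=> gc kc e e0; have [d d0 Hd] := kc e e0.
have [d' d'0 Hd'] := gc (d / 2) ltac:(lra); exists d' => // w /Hd' h; apply: Hd; lra.
Qed.

Lemma Re_sqrtc_ge0 z : 0 <= Re (sqrtc z).
Proof. by case: z => x y; rewrite /sqrtc /= sqrtr_ge0. Qed.

Lemma Re_sqrtc_gt0 z : cabs (z - 1) < 1 -> 0 < Re (sqrtc z).
Proof.
move=> z1; rewrite lt_neqAle Re_sqrtc_ge0 andbT; apply/eqP => s0.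
have : Re z = Re (sqrtc z) ^+ 2 - Im (sqrtc z) ^+ 2.
  by rewrite -{1}(sqr_sqrtc z) expr2 !ReImE !expr2.
have := sqr_ge0 (Im (sqrtc z)); rewrite -s0 expr0n /=.
have := le_lt_trans (cabs_Re _) z1.
have -> : Re (z - 1) = Re z - 1 by case: (z).
rewrite ltr_norml; lra.
Qed.

(** The difference of the roots is [w - z] divided by their sum, whose real part is at least
    [Re (sqrtc z)] since principal roots have nonnegative real part. *)
Lemma ccont_sqrtc z : 0 < Re (sqrtc z) -> ccont (@sqrtc R) z.
Proof.
move=> z0 e e0; exists (e * Re (sqrtc z)); first by rewrite mulr_gt0.
move=> w wz; have E : (sqrtc w - sqrtc z) * (sqrtc w + sqrtc z) = w - z.
  by rewrite -subr_sqr !sqr_sqrtc.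
have h : Re (sqrtc z) <= cabs (sqrtc w + sqrtc z).
  apply: le_trans (cabs_Re _); apply: le_trans (ler_norm _).
  by rewrite !ReImE lerDr Re_sqrtc_ge0.
rewrite -(ler_pM2r z0); apply: le_trans (_ : cabs (w - z) <= _); last exact: ltW.
by rewrite -E cabsM ler_wpM2l// cabs_ge0.
Qed.

Definition radial a n j z : R[i] := a + (j%:R / n%:R) * (z - a).

Fixpoint sqrt_chain G a n j z : R[i] :=
  if j is i.+1 then
    sqrt_chain G a n i z * sqrtc (G (radial a n i.+1 z) / G (radial a n i z))
  else 1.

(* Along each radius the square root is continued by finitely many principal
   square roots of quotients close to 1. *)
Lemma sqrt_branch G a s : 0 < s -> (forall z, cabs (z - a) <= s -> ccont G z) ->
  (forall z, cabs (z - a) <= s -> G z != 0) -> G a = 1 ->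
  exists k, [/\ k a = 1, forall z, cabs (z - a) <= s -> k z ^+ 2 = G z &
    forall z, cabs (z - a) < s -> ccont k z].
Proof.
move=> s0 Gc G0 Ga.
have [|B B0 HB] := @disc_bounded _ (fun z => (G z)^-1) a s.
  by move=> z za; apply: ccontV; [exact: G0|exact: Gc].
have B2 : 0 < (2 * B)^-1 by rewrite invr_gt0; lra.
have [d d0 Hd] := disc_unif_cont B2 Gc.
(* Consecutive points on a radius are then closer than [d], so consecutive quotients of [G] lie
   within [1 / 2] of [1], where the principal root is continuous. *)
have [n nP] : exists n, s / d < n%:R by exists (Num.trunc (s / d)).+1; apply: truncnS_gt.
have n0 : 0 < n%:R :> R by apply: le_lt_trans nP; rewrite divr_ge0 ?ltW.
have nC : (n%:R : R[i]) != 0.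
  by apply/eqP => n00; move: n0; rewrite -(cabs_nat R n) n00 cabs0 ltxx.
have radN j z : (j <= n)%N -> cabs (radial a n j z - a) <= cabs (z - a).
  move=> jn; rewrite /radial addrC addKr cabsM cabs_div !cabs_nat ler_piMl ?cabs_ge0//.
  by rewrite ler_pdivrMr// mul1r ler_nat.
have rad0 z : radial a n 0 z = a by rewrite /radial mul0r mul0r addr0.
have radn z : radial a n n z = z by rewrite /radial divff// mul1r addrC subrK.
have radc j z : ccont (radial a n j) z.
  apply: ccontD; first exact: ccont_cst.
  apply: ccontM; first exact: ccont_cst.
  by apply: ccontB; [exact: ccont_id|exact: ccont_cst].
have rad_step j z : (j < n)%N -> cabs (z - a) <= s ->
    cabs (G (radial a n j.+1 z) / G (radial a n j z) - 1) < 1.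
  move=> jn za; have zj := le_trans (radN j z (ltnW jn)) za; have zj1 := le_trans (radN j.+1 z jn) za.
  have Gj := G0 _ zj.
  have -> : G (radial a n j.+1 z) / G (radial a n j z) - 1 =
     (G (radial a n j.+1 z) - G (radial a n j z)) * (G (radial a n j z))^-1 by field.
  rewrite cabsM; apply: le_lt_trans (_ : (2 * B)^-1 * B < 1); last first.
    have -> : (2 * B)^-1 * B = 1 / 2 by field; rewrite gt_eqF.
    lra.
  apply: ler_pM; rewrite ?cabs_ge0 ?HB//; apply: Hd => //.
  have -> : radial a n j.+1 z - radial a n j z = (z - a) / n%:R.
    by rewrite /radial -natr1; field.
  rewrite cabs_div cabs_nat ltr_pdivrMr//; move: nP; rewrite ltr_pdivrMr// mulrC; lra.
exists (sqrt_chain G a n n); split.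
- elim: {1 4}n (leqnn n) => [//|j IH] jn /=; rewrite IH ?(ltnW jn)// mul1r.
  have rada i : radial a n i a = a by rewrite /radial subrr mulr0 addr0.
  by rewrite !rada Ga divr1 sqrtc1.
- move=> z za; rewrite -{2}(radn z).
  elim: {1 4 6}n (leqnn n) => [_|j IH jn] /=; first by rewrite rad0 Ga expr1n.
  rewrite exprMn IH ?(ltnW jn)// sqr_sqrtc mulrC divfK// G0//.
  exact: le_trans (radN j z (ltnW jn)) za.
move=> z /ltW za; elim: {1 4}n (leqnn n) => [_|j IH jn] /=; first exact: ccont_cst.
apply: ccontM; first exact/IH/ltnW.
apply: (@ccont_comp (fun z => G (radial a n j.+1 z) / G (radial a n j z))); last first.
  by apply/ccont_sqrtc/Re_sqrtc_gt0/rad_step.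
have zj := le_trans (radN j z (ltnW jn)) za; have zj1 := le_trans (radN j.+1 z jn) za.
apply: ccontM; first by apply: ccont_comp; [exact: radc|exact: Gc].
by apply: ccontV; [exact: G0|apply: ccont_comp; [exact: radc|exact: Gc]].
Qed.

(** The radial retraction onto the closed disc. Composition with it extends a nonvanishing
    continuous function beyond the disc, so that a square root is continuous up to the boundary
    circle. *)
Definition retr a s z : R[i] := a + (z - a) / (Num.max 1 (cabs (z - a) / s))%:C.

Lemma retr_ccont a s z : 0 < s -> ccont (retr a s) z.
Proof.
move=> s0; apply: ccontD; first exact: ccont_cst.
apply: ccontM; first by apply: ccontB; [exact: ccont_id|exact: ccont_cst].
apply: ccontV.
  apply/eqP => /(congr1 (@complex.Re R)) /=; have : 1 <= Num.max 1 (cabs (z - a) / s) by rewrite le_max lexx.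
  by move=> h1 h2; move: h1; rewrite h2; lra.
move=> e e0; exists (e * s); first by rewrite mulr_gt0.
move=> w wz; rewrite -rmorphB cabsR.
have h : `|cabs (w - a) / s - cabs (z - a) / s| <= e.
  rewrite -mulrBl normrM (gtr0_norm (_ : 0 < s^-1)) ?invr_gt0// ler_pdivrMr//.
  apply: le_trans (ltW wz); rewrite ler_norml; have := cabs_tri z w a.
  by have := cabs_tri w z a; rewrite (cabs_distC z w); lra.
move: h; move: (cabs (w - a) / s) (cabs (z - a) / s) => u v; rewrite !ler_norml.
by have [?|?] := leP 1 u; have [?|?] := leP 1 v; lra.
Qed.

Lemma retr_in a s z : 0 < s -> cabs (retr a s z - a) <= s.
Proof.
move=> s0; rewrite /retr addrC addKr cabs_div cabsR.
have h1 : 1 <= Num.max 1 (cabs (z - a) / s) by rewrite le_max lexx.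
rewrite ger0_norm; last by lra.
rewrite ler_pdivrMr; last by lra.
have : cabs (z - a) / s <= Num.max 1 (cabs (z - a) / s) by rewrite le_max lexx orbT.
by rewrite ler_pdivrMr// mulrC.
Qed.

Lemma retr_id a s z : 0 < s -> cabs (z - a) <= s -> retr a s z = z.
Proof.
move=> s0 za; rewrite /retr max_l ?rmorph1 ?divr1; first by rewrite addrC subrK.
by rewrite ler_pdivrMr// mul1r.
Qed.

(** Continuity of the inverse at [H z0], by compactness of the disc: near a point [z] other than
    [z0], the values of [H] stay away from [H z0] by a fixed part of [cabs (H z - H z0)]. *)
Lemma inj_inv_cont H a s z0 e : 0 < e -> (forall z, cabs (z - a) <= s -> ccont H z) ->
  (forall z, cabs (z - a) <= s -> H z = H z0 -> z = z0) ->
  exists2 d, 0 < d & forall z, cabs (z - a) <= s -> cabs (H z - H z0) < d -> cabs (z - z0) < e.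
Proof.
move=> e0 Hc Hi.
apply: (@disc_unif _ (fun z d => cabs (H z - H z0) < d -> cabs (z - z0) < e)).
  by move=> z d d' _ dd h1 h2; apply: h1; exact: lt_le_trans dd.
move=> z za; have [->|zz] := eqVneq z z0; first by exists e.
have M0 : 0 < cabs (H z - H z0).
  by apply: cabs_gt0; rewrite subr_eq0; apply: contra zz => /eqP/Hi ->.
have [d d0 Hd] := Hc z za (cabs (H z - H z0) / 3) ltac:(lra).
exists (Num.min d (cabs (H z - H z0) / 3)); first by rewrite lt_min d0 /=; lra.
move=> w wa; rewrite !lt_min => /andP[/Hd h1 _] /andP[_ h2].
by have := cabs_tri (H w) (H z) (H z0); rewrite (cabs_distC (H z) (H w)); lra.
Qed.

(** [k w - k z] is [g w - g z] divided by [k w + k z], and the denominator is continuous and nonzero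
    at [z]. *)
Lemma cdiff_sqrt k g z d : 0 < d -> (forall w, cabs (w - z) < d -> k w ^+ 2 = g w) -> k z != 0 ->
  ccont k z -> cdiff g z -> cdiff k z.
Proof.
move=> d0 kg kz kc [q qc E].
have two : (2 : R[i]) != 0 by rewrite pnatr_eq0.
have kkc : ccont (fun w => k w + k z) z by apply: ccontD => //; exact: ccont_cst.
have kk0 : k z + k z != 0 by rewrite -mulr2n -mulr_natl mulf_neq0.
have [d' d'0 kkn] := ccont_neq0 kkc kk0.
apply: (@eq_cdiff _ (fun w => k z + q w / (k w + k z) * (w - z)) _ _ (Num.min d d')).
- by rewrite lt_min d0.
- move=> w; rewrite lt_min => /andP[/kg wk /kkn wn].
  have zz : cabs (z - z) < d by rewrite subrr cabs0.
  have h : q w * (w - z) = (k w - k z) * (k w + k z).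
    by rewrite -subr_sqr wk (kg z zz) (E w); ring.
  by rewrite mulrAC h mulfK// addrC subrK.
exists (fun w => q w / (k w + k z)); first by apply: ccontM => //; exact: ccontV.
by move=> w; rewrite subrr mulr0 addr0.
Qed.

End Koebe.

(** * A Koebe type bound *)

Section KoebeBound.
Variable R : realType.
Implicit Types (z w c v l a b p : R[i]) (x y s r e d t : R) (g h k G H : R[i] -> R[i]).

Lemma itv_connected (A : R -> Prop) :
  (forall t, 0 <= t <= 1 -> exists2 d, 0 < d & forall u, 0 <= u <= 1 -> `|u - t| < d -> (A u <-> A t)) ->
  A 0 -> A 1.
Proof.
move=> Al; suff : A 0 <-> A (0 + 1) by rewrite add0r => -[].
apply: (@square_ind _ (fun x y s => A x <-> A (x + s)) 0 0 1) => //.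
  move=> x y s s0 h1 h2 _ _; have -> : x + s = x + s / 2 + s / 2 by lra.
  tauto.
move=> p q; rewrite add0r => p01 _; have [d d0 H] := Al p p01; exists d => // x y s s0 sd x0 xs _ _ xp _.
have := H x ltac:(lra) ltac:(rewrite ltr_norml; lra).
have := H (x + s) ltac:(lra) ltac:(rewrite ltr_norml; lra).
tauto.
Qed.

(** A local estimate compares only with its base point, so a small interval is split there;
    bisection adds up the lengths. For a vanishing derivative [e] is arbitrary, which gives
    constancy. *)
Lemma itv_lipschitz (F : R -> R[i]) e :
  (forall t, 0 <= t <= 1 -> exists2 d, 0 < d & forall u, 0 <= u <= 1 -> `|u - t| < d ->
     cabs (F u - F t) <= e * `|u - t|) -> cabs (F 1 - F 0) <= e.
Proof.
move=> Fl; suff : cabs (F (0 + 1) - F 0) <= e * 1 by rewrite add0r mulr1.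
apply: (@square_ind _ (fun x y s => cabs (F (x + s) - F x) <= e * s) 0 0 1) => //.
  move=> x y s s0 h1 h2 _ _; have -> : x + s = x + s / 2 + s / 2 by lra.
  by apply: le_trans (cabs_tri (F (x + s / 2)) _ _) _; lra.
move=> p q; rewrite add0r => p01 _; have [d d0 H] := Fl p p01; exists d => // x y s s0 sd x0 xs _ _ xp _.
have h1 := H x ltac:(lra) ltac:(rewrite ltr_norml; lra).
have h2 := H (x + s) ltac:(lra) ltac:(rewrite ltr_norml; lra).
rewrite ler0_norm in h1; last by lra.
rewrite ger0_norm in h2; last by lra.
by apply: le_trans (cabs_tri (F p) _ _) _; rewrite (cabs_distC (F p)); lra.
Qed.

(* A weak form of Koebe's quarter theorem. Let [w0] be an omitted value of [h]
   which is almost nearest to [h a]. The square root [k] of the normalization of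
   [h - w0] omits a neighborhood of [-1], because the image of [h] contains a disc
   around [h a] whose square roots with positive real part are values of [k].
   Hence [1 / (k + 1)] is bounded and the Schwarz lemma applies to it. *)
Lemma koebe_bound h a s z : 0 < s -> (forall w, cabs (w - a) < s -> cdiff h w) ->
  (forall u v, cabs (u - a) < s -> cabs (v - a) < s -> h u = h v -> u = v) ->
  (forall w, cabs (w - a) < s -> h w != 0) -> cabs (z - a) <= s / 640 ->
  cabs (h z) <= 53 * cabs (h a).
Proof.
move=> s0 hd hi h0 za.
pose s1 := s / 2; have s1_gt0 : 0 < s1 by rewrite /s1; lra.
have aa0 : cabs (a - a) = 0 by rewrite subrr cabs0.
have in_s w : cabs (w - a) <= s1 -> cabs (w - a) < s by rewrite /s1; lra.
have hc w : cabs (w - a) <= s1 -> ccont h w by move=> /in_s/hd/cdiff_ccont.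
have [||d d0 Hd] := @inj_inv_cont _ h a s1 a (s1 / 2) _ hc; first by lra.
  by move=> u /in_s us; apply: hi => //; rewrite aa0.
pose omitted w := forall u, cabs (u - a) <= s1 -> h u <> w.
pose E : set R := [set x | exists2 w, omitted w & x = cabs (w - h a)].
have E0 : E (cabs (h a)) by exists 0; [move=> u /in_s/h0/eqP|rewrite sub0r cabsN].
(* By injectivity [h] stays at distance [d] from [h a] on the annulus, so the minimum principle
   yields every value within [d / 2] of [h a]. *)
have Elb : lbound E (d / 2).
  move=> _ [w wo ->]; rewrite leNgt; apply/negP => wd.
  have [u u1 u2] : exists2 u, cabs (u - a) <= 2 * (s1 / 2) & h u = w.
    apply: (@attained_center _ h a (s1 / 2) (d / 2)).
    - by lra.
    - by move=> u ua; apply: hd; apply: in_s; lra.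
    - move=> u u1 u2; have : d <= cabs (h u - h a).
        by rewrite leNgt; apply/negP => /(Hd u ltac:(lra)); lra.
      by have := cabs_tri w (h u) (h a); lra.
    - by rewrite cabs_distC.
  by apply: (wo u) => //; lra.
have Elb' : has_lbound E by exists (d / 2).
have rho_le x : E x -> inf E <= x by apply: ge_inf.
have rho0 : 0 < inf E by apply: lt_le_trans (lb_le_inf _ Elb); [lra|exists (cabs (h a))].
have [_ [w0 w0o ->] w0_lt] := @inf_adherent _ E _ rho0 (conj (ex_intro _ _ E0) Elb').
have rho_ha : inf E <= cabs (h a) := rho_le _ E0.
pose b := h a - w0.
have b0 : b != 0 by rewrite subr_eq0; apply/eqP/w0o; rewrite aa0; lra.
have Nb : cabs b < 2 * inf E by rewrite /b cabs_distC; lra.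
have Nb0 := cabs_gt0 b0.
pose H w := (h w - w0) / b.
have H0 w : cabs (w - a) <= s1 -> H w != 0.
  by move=> ws; rewrite mulf_neq0 ?invr_eq0// subr_eq0; apply/eqP/w0o.
have Hinj u v : cabs (u - a) <= s1 -> cabs (v - a) <= s1 -> H u = H v -> u = v.
  move=> us vs /(mulIf _); rewrite invr_eq0 => /(_ b0) /addIr; apply: hi; exact: in_s.
have Hc w : cabs (w - a) <= s1 -> ccont H w.
  by move=> ws; apply: ccontM; [apply: ccontB; [exact: hc|exact: ccont_cst]|exact: ccont_cst].
have Ha : H a = 1 by rewrite /H divff.
(* The corresponding value of [h] is at distance less than [cabs b / 2], hence less than [inf E],
   from [h a]; it cannot be omitted. *)
have Hsurj v : cabs (v - 1) < 1 / 2 -> exists2 u, cabs (u - a) <= s1 & H u = v.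
  move=> v1; apply: contrapT => nu.
  have : E (cabs ((w0 + v * b) - h a)).
    exists (w0 + v * b) => // u us hu; apply: nu; exists u => //.
    by rewrite /H hu addrC addKr mulfK.
  move=> /rho_le; have -> : w0 + v * b - h a = (v - 1) * b by rewrite /b; ring.
  rewrite cabsM; have : cabs (v - 1) * cabs b < 1 / 2 * cabs b by rewrite ltr_pM2r.
  lra.
have s2_gt0 : 0 < 2 * s1 by lra.
(* [H] is known to be nonzero only on the closed disc of radius [s1]; the retraction gives a branch
   on a larger disc, continuous on the whole closed one. *)
have [|||k [ka k2 kc]] := @sqrt_branch _ (fun w => H (retr a s1 w)) a (2 * s1) s2_gt0.
- move=> w _; apply: (@ccont_comp _ (retr a s1)); first exact: retr_ccont.
  by apply: Hc; exact: retr_in.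
- by move=> w _; apply: H0; exact: retr_in.
- by rewrite retr_id// aa0; lra.
have kH w : cabs (w - a) <= s1 -> k w ^+ 2 = H w by move=> ws; rewrite k2 ?retr_id//; lra.
(* If [k w] were near [-1], then [u = H w] would be near [1] and the segment from [1] to [u] would
   consist of values of [H]. Along the unique preimages the real part of [k] cannot vanish, because
   [k ^ 2] stays within [1 / 2] of [1]; being positive at [a], it would be positive at [w]. *)
have k1 w : cabs (w - a) <= s1 -> 1 / 5 <= cabs (k w + 1).
  move=> ws; rewrite leNgt; apply/negP => kw.
  have km : cabs (k w - 1) <= 11 / 5.
    have -> : k w - 1 = (k w + 1) - 2 by ring.
    by apply: le_trans (cabsB _ _) _; rewrite cabs_nat; lra.
  pose u := H w.
  have u1 : cabs (u - 1) < 1 / 2.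
    rewrite /u -kH//; have -> : k w ^+ 2 - 1 = (k w - 1) * (k w + 1) by ring.
    rewrite cabsM; apply: (@le_lt_trans _ _ (11 / 5 * (1 / 5))); last by lra.
    by apply: ler_pM; rewrite ?cabs_ge0//; lra.
  pose path t : R[i] := 1 + t%:C * (u - 1).
  have pathN t : 0 <= t <= 1 -> cabs (path t - 1) < 1 / 2.
    move=> /andP[t0 t1]; rewrite /path addrC addKr cabsM cabsR ger0_norm//.
    by apply: le_lt_trans u1; rewrite ler_piMl ?cabs_ge0.
  pose A t := forall v, cabs (v - a) <= s1 -> H v = path t -> 0 < Re (k v).
  have A0 : A 0.
    move=> v vs; rewrite /path mul0r addr0 -Ha => /Hinj ->//; last by rewrite aa0; lra.
    by rewrite ka.
  have : A 1.
    apply: itv_connected A0 => t t01.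
    have [v vs Hv] := Hsurj _ (pathN t t01).
    have kv : Re (k v) != 0.
      apply/eqP => kv0; have := pathN t t01; rewrite -Hv -kH// => h1_.
      have := le_lt_trans (cabs_Re _) h1_; have -> : Re (k v ^+ 2 - 1) = Re (k v ^+ 2) - 1 by case: (k v ^+ 2).
      rewrite expr2 !ReImE kv0 mul0r sub0r -expr2 ltr_norml; have := sqr_ge0 (Im (k v)); lra.
    have kcv : ccont k v by apply: kc; lra.
    have kv0 : 0 < `|Re (k v)| by rewrite normr_gt0.
    have [e e0 He] := kcv (`|Re (k v)| / 2) ltac:(lra).
    have [|d' d'0 Hd'] := @inj_inv_cont _ H a s1 v e e0 Hc.
      by move=> z' z's; apply: Hinj.
    exists d' => // t' t'01 tt'.
    have [v' vs' Hv'] := Hsurj _ (pathN t' t'01).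
    have vv' : cabs (v' - v) < e.
      apply: Hd' => //; rewrite Hv Hv' /path.
      have -> : 1 + t'%:C * (u - 1) - (1 + t%:C * (u - 1)) = (t' - t)%:C * (u - 1).
        by rewrite rmorphB; ring.
      rewrite cabsM cabsR; apply: le_lt_trans tt'; rewrite ler_piMr//; lra.
    have := le_trans (cabs_Re _) (He v' vv').
    have -> : Re (k v' - k v) = Re (k v') - Re (k v) by rewrite !ReImE.
    move=> kk; have {kk}sgn : (0 < Re (k v')) = (0 < Re (k v)).
      move: kk kv kv0; move: (Re (k v)) (Re (k v')) => x y.
      rewrite ler_norml => /andP[h1 h2] x0 _; case: (ltgtP 0 x) x0 h1 h2 => [xp|xn|<-].
      - by rewrite gtr0_norm// => _ h1 h2; apply/idP; lra.
      - by rewrite ltr0_norm// => _ h1 h2; apply/negbTE; rewrite -leNgt; lra.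
      - by [].
    split=> AA.
      by move=> v2 v2s H2; rewrite (Hinj v2 v)// ?H2 ?Hv// -sgn; apply: AA.
    by move=> v2 v2s H2; rewrite (Hinj v2 v')// ?H2 ?Hv'// sgn; apply: AA.
  move=> /(_ w ws); rewrite /path rmorph1 mul1r addrC subrK => /(_ erefl) kp.
  move: kw; have : 1 < cabs (k w + 1).
    apply: lt_le_trans (cabs_Re _); apply: lt_le_trans (ler_norm _).
    by have -> : Re (k w + 1) = Re (k w) + 1 by [case: (k w)]; lra.
  lra.
have kd w : cabs (w - a) < s1 -> cdiff k w.
  move=> ws; apply: (@cdiff_sqrt _ k H w (s1 - cabs (w - a))); first by lra.
  - by move=> v vw; apply: kH; have := cabs_tri w v a; lra.
  - by apply/eqP => kw; have := kH w (ltW ws); rewrite kw expr0n /= => /esym/eqP; apply/negP/H0/ltW.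
  - by apply: kc; lra.
  apply: cdiffM; last exact: cdiff_cst.
  by apply: cdiffB; [apply/hd/in_s/ltW|exact: cdiff_cst].
have kp0 w : cabs (w - a) <= s1 -> k w + 1 != 0.
  by move=> /k1 kw; apply/eqP => kw0; move: kw; rewrite kw0 cabs0; lra.
pose m w := (k w + 1)^-1.
have md w : cabs (w - a) < s1 -> cdiff m w.
  move=> ws; apply: cdiffV; first exact/kp0/ltW.
  by apply: cdiffD; [exact: kd|exact: cdiff_cst].
have zs1 : cabs (z - a) <= s1 by rewrite /s1; have := cabs_ge0 (z - a); lra.
(* A point outside the disc, put in the place of the exceptional point of [schwarz_lip]. *)
pose p := a + (2 * s1)%:C.
have pE : cabs (p - a) = 2 * s1 by rewrite /p addrC addKr cabsR ger0_norm//; lra.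
have np w : cabs (w - a) <= s1 -> p != w by move=> ws; apply/eqP => pw; move: ws; rewrite -pw pE; lra.
have mz : cabs (m z - m a) <= 16 * 5 / s1 * cabs (z - a).
  apply: (@schwarz_lip _ m a p z s1 5) => //.
  - by apply: np; rewrite aa0; lra.
  - exact: np.
  - by move=> w ws _; exact: md.
  - by move=> w ws; exact/cdiff_ccont/md.
  - move=> w ws; rewrite cabsV -[X in _ <= X]invrK lef_pV2 ?posrE ?invr_gt0//; last exact/cabs_gt0/kp0/ltW.
    by have := k1 w (ltW ws); lra.
  by rewrite /s1; lra.
(* The radius [s / 640] is chosen for this: [m a] is [1 / 2], so [m z] stays away from [0] and [k z]
   is bounded. *)
have mz' : cabs (m z - m a) <= 1 / 4.
  apply: le_trans mz _; have : 16 * 5 / s1 * cabs (z - a) <= 16 * 5 / s1 * (s / 640).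
    by rewrite ler_wpM2l// divr_ge0//; lra.
  by have -> : 16 * 5 / s1 * (s / 640) = 1 / 4 by [rewrite /s1; field; rewrite gt_eqF].
have ma : cabs (m a) = 1 / 2.
  by rewrite /m ka cabsV -[1 + 1]/(2%:R : R[i]) cabs_nat div1r.
have kz : cabs (k z) <= 5.
  have m4 : 1 / 4 <= cabs (m z) by have := cabs_sub (m a) (m z); rewrite (cabs_distC (m a)); lra.
  have k4 : cabs (k z + 1) <= 4.
    move: m4; rewrite /m cabsV -[(cabs _)^-1]div1r ler_pdivlMr; first by lra.
    exact/cabs_gt0/kp0.
  have -> : k z = (k z + 1) - 1 by ring.
  by apply: le_trans (cabsB _ _) _; rewrite cabs1; lra.
have hz : h z = H z * b + w0 by rewrite /H divfK// subrK.
have Hz : cabs (H z) <= 25.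
  rewrite -kH// cabsX; have -> : 25 = 5 ^+ 2 :> R by ring.
  by apply: lerXn2r; rewrite ?nnegrE ?cabs_ge0.
have w0N : cabs w0 <= cabs (h a) + cabs b.
  by have -> : w0 = h a - b by [rewrite /b; ring]; exact: cabsB.
(* The total is at most [26 * cabs b + cabs (h a)] with [cabs b < 2 * cabs (h a)], whence [53]. *)
rewrite hz; apply: le_trans (cabsD _ _) _; rewrite cabsM.
have : cabs (H z) * cabs b <= 25 * cabs b by rewrite ler_wpM2r// ltW.
lra.
Qed.

End KoebeBound.

(** * Injective maps of large discs are almost affine *)

Section AlmostAffine.
Variable R : realType.
Implicit Types (z w c v l a b p : R[i]) (x y s r e d t : R) (g h k : R[i] -> R[i]).

Lemma le_of_sqr (x y : R) : 0 <= y -> x ^+ 2 <= y ^+ 2 -> x <= y.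
Proof.
move=> y0 xy; rewrite leNgt; apply/negP => yx.
have : 0 < (x - y) * (x + y) by apply: mulr_gt0; lra.
by rewrite -subr_sqr; lra.
Qed.

(** The model is [g u - g c] with [g] injective, which vanishes at [c] and nowhere else, so
    [koebe_bound] applies to it on discs that avoid [c]. *)
Definition punctured_inj h c r :=
  [/\ forall u, u != c -> cabs (u - c) < r -> cdiff h u,
      forall u v, u != c -> v != c -> cabs (u - c) < r -> cabs (v - c) < r -> h u = h v -> u = v &
      forall u, u != c -> cabs (u - c) < r -> h u != 0].

(** A chain of Koebe discs along the segment from [u] to [c + p * (u - c)]. Each disc reaches up to
    the puncture; the condition on [Re p] keeps the segment away from it, and the whole chain stays
    within [r] of [c]. *)
Lemma harnack_segment : exists2 C, 0 < C & forall h c r u p, punctured_inj h c r ->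
  u != c -> 6 * cabs (u - c) <= r -> 0 <= Re p -> 1 / 3 <= cabs p -> cabs p <= 3 ->
  cabs (h (c + p * (u - c))) <= C * cabs (h u).
Proof.
(* A step has length at most [4 / n] relative to [cabs (u - c)] and must not exceed
   [cabs (q t) / 640]; [20] works because [20 * (3 / 10) >= 4]. *)
have [n nP] : exists n, 640 * 20 < n%:R :> R.
  by exists (Num.trunc (640 * 20 : R)).+1; apply: truncnS_gt.
have n0 : 0 < n%:R :> R by lra.
exists (53 ^+ n); first by rewrite exprn_gt0.
move=> h c r u p [hd hi h0] uc ur p0 p1 p2.
have uc0 : 0 < cabs (u - c) by apply: cabs_gt0; rewrite subr_eq0.
pose q t : R[i] := 1 + t%:C * (p - 1).
have q_lb t : 0 <= t <= 1 -> 3 / 10 <= cabs (q t).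
  move=> /andP[t0 t1]; apply: le_of_sqr; first exact: cabs_ge0.
  have p12 : 1 / 9 <= cabs p ^+ 2.
    have -> : 1 / 9 = (1 / 3) ^+ 2 :> R by field.
    by apply: lerXn2r; rewrite ?nnegrE ?cabs_ge0//; lra.
  have -> : cabs (q t) ^+ 2 = (1 - t) ^+ 2 + t ^+ 2 * cabs p ^+ 2 + 2 * (t * (1 - t) * Re p).
    rewrite !cabs_sqr; have -> : q t = (1 - t)%:C + t%:C * p by rewrite rmorphB rmorph1 /q; ring.
    by rewrite !ReImE; ring.
  have h1 : 0 <= t * (1 - t) * Re p by apply: mulr_ge0 => //; apply: mulr_ge0 => //; lra.
  have h2 : t ^+ 2 * (1 / 9) <= t ^+ 2 * cabs p ^+ 2 by rewrite ler_wpM2l// sqr_ge0.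
  (* [(1 - t) ^ 2 + t ^ 2 / 9] has its minimum [1 / 10] at [t = 9 / 10]. *)
  have h3 := sqr_ge0 (10 * t - 9); lra.
have q_ub t : 0 <= t <= 1 -> cabs (q t) <= 3.
  move=> /andP[t0 t1]; have -> : q t = (1 - t)%:C + t%:C * p by rewrite rmorphB rmorph1 /q; ring.
  apply: le_trans (cabsD _ _) _; rewrite cabsM !cabsR !ger0_norm ?subr_ge0//.
  have : t * cabs p <= t * 3 by rewrite ler_wpM2l.
  lra.
pose pt t := c + q t * (u - c).
have ptN t : cabs (pt t - c) = cabs (q t) * cabs (u - c) by rewrite /pt addrC addKr cabsM.
suff H j : (j <= n)%N -> cabs (h (pt (j%:R / n%:R))) <= 53 ^+ j * cabs (h u).
  by have := H n (leqnn _); rewrite divff ?gt_eqF// /pt /q rmorph1 mul1r [1 + _]addrC subrK.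
elim: j => [_|j IH jn]; first by rewrite mul0r /pt /q mul0r addr0 mul1r [c + _]addrC subrK expr0 mul1r.
have tj i : (i <= n)%N -> 0 <= (i%:R : R) / n%:R <= 1.
  by move=> i_n; rewrite divr_ge0 ?ler0n//= ler_pdivrMr// mul1r ler_nat.
have t0 := tj j (ltnW jn); have t1 := tj j.+1 jn.
set t := j%:R / n%:R in t0 IH *; set t' := j.+1%:R / n%:R in t1 *.
have ptp : 0 < cabs (pt t - c) by rewrite ptN mulr_gt0//; have := q_lb t t0; lra.
have pt3 : cabs (pt t - c) <= 3 * cabs (u - c) by rewrite ptN ler_pM2r// q_ub.
have in_pun v : cabs (v - pt t) < cabs (pt t - c) -> v != c /\ cabs (v - c) < r.
  move=> vt; split; first by apply/eqP => vc; move: vt; rewrite vc cabs_distC ltxx.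
  by have := cabs_tri (pt t) v c; lra.
rewrite exprS -mulrA; apply: le_trans (_ : 53 * cabs (h (pt t)) <= _); last first.
  by rewrite ler_pM2l// IH// ltnW.
apply: (@koebe_bound _ h (pt t) (cabs (pt t - c))) => //.
- by move=> v /in_pun[v1 v2]; apply: hd.
- by move=> v1 v2 /in_pun[? ?] /in_pun[? ?]; apply: hi.
- by move=> v /in_pun[v1 v2]; apply: h0.
have -> : pt t' - pt t = (t' - t)%:C * (p - 1) * (u - c) by rewrite /pt /q rmorphB; ring.
have -> : t' - t = n%:R^-1 by rewrite /t' /t -natr1; field; rewrite gt_eqF.
rewrite !cabsM cabsR ger0_norm ?invr_ge0//.
rewrite ptN [leRHS]mulrAC ler_pM2r//.
have p1N : cabs (p - 1) <= 4 by apply: le_trans (cabsB _ _) _; rewrite cabs1; lra.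
rewrite mulrC ler_pdivrMr//; apply: le_trans p1N _.
apply: le_trans (_ : cabs (q t) / 640 * (640 * 20) <= _); last first.
  by apply: ler_wpM2l; [have := cabs_ge0 (q t); clear; lra|exact: ltW].
have -> : cabs (q t) / 640 * (640 * 20) = 20 * cabs (q t) by field.
by have := q_lb t t0; clear; lra.
Qed.

(** Two segments suffice: the principal square root [p] of the ratio of [v - c] and [u - c] has
    nonnegative real part, and multiplying by it twice leads from [u] to [v]. The ratio of radii is
    at most [8], so [cabs p] lies between [1 / 3] and [3]. *)
Lemma harnack_annulus : exists2 C, 0 < C & forall h c r u v, punctured_inj h c r ->
  r / 48 <= cabs (u - c) -> cabs (u - c) <= r / 6 -> r / 48 <= cabs (v - c) -> cabs (v - c) <= r / 6 ->
  0 < r -> cabs (h v) <= C * cabs (h u).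
Proof.
have [C C0 H] := harnack_segment; exists (C * C); first by rewrite mulr_gt0.
move=> h c r u v hP u1 u2 v1 v2 r0.
have uc0 : 0 < cabs (u - c) by lra.
have uc : u != c by apply/eqP => E; move: uc0; rewrite E subrr cabs0 ltxx.
have uc' : u - c != 0 by rewrite subr_eq0.
pose q := (v - c) / (u - c); pose p := sqrtc q.
have pp : p ^+ 2 = q by exact: sqr_sqrtc.
have p2 : cabs p ^+ 2 = cabs (v - c) / cabs (u - c) by rewrite -cabsX pp cabs_div.
have p0 := cabs_ge0 p; have Rp : 0 <= Re p := Re_sqrtc_ge0 q.
have p3 : cabs p <= 3.
  by apply: le_of_sqr => //; rewrite p2 ler_pdivrMr//; lra.
have p13 : 1 / 3 <= cabs p.
  by apply: le_of_sqr => //; rewrite p2 ler_pdivlMr//; lra.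
pose m := c + p * (u - c).
have mN : cabs (m - c) = cabs p * cabs (u - c) by rewrite /m addrC addKr cabsM.
have m0 : 0 < cabs (m - c) by rewrite mN mulr_gt0//; lra.
have mc : m != c by apply/eqP => E; move: m0; rewrite E subrr cabs0 ltxx.
have m6 : 6 * cabs (m - c) <= r.
  suff: cabs (m - c) <= r / 6 by lra.
  apply: le_of_sqr; first by lra.
  rewrite mN exprMn p2 [_ ^+ 2]expr2 mulrA divfK ?gt_eqF//.
  by rewrite expr2; apply: ler_pM => //; rewrite cabs_ge0.
have -> : v = c + p * (m - c).
  by rewrite /m [c + p * (u - c) - c]addrC addKr mulrA -expr2 pp /q divfK// addrC subrK.
apply: le_trans (H _ _ _ _ _ hP mc m6 Rp p13 p3) _; rewrite -mulrA ler_pM2l//.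
by apply: (H _ _ r) => //; lra.
Qed.

(** Otherwise the derivative vanishes along the segment from [0] to [1], so that [g 0 = g 1],
    against injectivity. *)
Lemma exists_deriv_neq0 g r : 1 < r -> (forall u, cabs u < r -> cdiff g u) ->
  (forall u v, cabs u < r -> cabs v < r -> g u = g v -> u = v) ->
  exists w k, [/\ cabs w <= 1, ccont k w, forall u, g u = g w + k u * (u - w) & k w != 0].
Proof.
move=> r1 gd gi; apply: contrapT => nw.
have D0 w k : cabs w <= 1 -> ccont k w -> (forall u, g u = g w + k u * (u - w)) -> k w = 0.
  move=> w1 kc E; apply: contrapT => k0; apply: nw; exists w, k; split=> //.
  exact/eqP.
suff : (1 : R[i]) = 0 by move/eqP; rewrite oner_eq0.
apply: gi; rewrite ?cabs1 ?cabs0//; first by lra.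
apply/eqP; rewrite -subr_eq0; apply/eqP/cabs_eq0/le_anti; rewrite cabs_ge0 andbT.
apply/ler_addgt0Pr => e e0; rewrite add0r.
apply: (@itv_lipschitz _ (fun t => g t%:C)) => t /andP[t0 t1].
have tN : cabs (t%:C : R[i]) <= 1 by rewrite cabsR ger0_norm.
have [|k kc E] := gd t%:C; first by lra.
have [d d0 Hd] := kc e e0; exists d => // u u01 ut.
rewrite (E u%:C) [g t%:C + _]addrC addrK cabsM -rmorphB cabsR ler_wpM2r//.
by have := Hd u%:C; rewrite (D0 _ _ tN kc E) subr0; apply; rewrite -rmorphB cabsR.
Qed.

(* With [w] such that [g' w] is nonzero, the difference quotient
   [k u = (g u - g w) / (u - w)] has no zeros, and it is comparable to a constant
   on a large annulus, hence inside it, by the maximum principle for [k] and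
   [1 / k]. By the Schwarz lemma [k] is almost constant near [w]. *)
Lemma almost_affine : exists2 C, 0 < C & forall g r, C <= r ->
  (forall u, cabs u < r -> cdiff g u) ->
  (forall u v, cabs u < r -> cabs v < r -> g u = g v -> u = v) ->
  exists2 w, cabs w <= 1 & forall u, C * cabs (u - (w + 1)) <= r ->
    cabs (g u - g w - (g (w + 1) - g w) * (u - w)) <=
      C / r * cabs (g (w + 1) - g w) * cabs (u - (w + 1)) * cabs (u - w).
Proof.
have [C C0 HC] := harnack_annulus.
(* [1024] places [u] in the range [s / 8] of [schwarz_lip] for [s = r' / 64]; the other term is the
   resulting Lipschitz factor, with [8 * (C * C)] for the ratio of the bounds of [k] and [2] for
   [r / r']. *)
pose C1 := 1024 + 2 * 16 * 8 * 64 * (C * C).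
have CC : 0 < C * C by rewrite mulr_gt0.
exists C1 => [|g r rC gd gi]; first by rewrite /C1; lra.
have r_gt : 1024 < r by move: rC; rewrite /C1; lra.
have [w [k0 [w1 k0c E0 k0w]]] := exists_deriv_neq0 (ltac:(lra) : 1 < r) gd gi.
exists w => //.
pose r' := r / 2; have r'0 : 0 < r' by rewrite /r'; lra.
have in_r u : cabs (u - w) < r' -> cabs u < r.
  by have := cabsD (u - w) w; rewrite subrK /r'; lra.
pose k u := if u == w then k0 w else (g u - g w) / (u - w).
have kE u : u != w -> k u = (g u - g w) / (u - w) by rewrite /k => /negbTE ->.
have kk0 u : k u = k0 u.
  rewrite /k; case: eqVneq => [->//|uw]; rewrite E0 [g w + _]addrC addrK mulfK//.
  by rewrite subr_eq0.
have gE u : g u - g w = k u * (u - w) by rewrite kk0 (E0 u); ring.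
have kc u : cabs (u - w) < r' -> ccont k u.
  move=> ur; have [->|uw] := eqVneq u w.
    by apply: (@eq_ccont _ k0 _ _ 1) => // v _.
  have d0 : 0 < cabs (u - w) by apply: cabs_gt0; rewrite subr_eq0.
  apply: (@eq_ccont _ (fun u => (g u - g w) / (u - w)) _ _ _ d0).
    move=> v vu; rewrite kE//; apply/eqP => vw; move: vu.
    by rewrite vw cabs_distC ltxx.
  apply: ccontM; first by apply: ccontB; [exact/cdiff_ccont/gd/in_r|exact: ccont_cst].
  apply: ccontV; first by rewrite subr_eq0.
  by apply: ccontB; [exact: ccont_id|exact: ccont_cst].
have kd u : u != w -> cabs (u - w) < r' -> cdiff k u.
  move=> uw ur; have d0 : 0 < cabs (u - w) by apply: cabs_gt0; rewrite subr_eq0.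
  apply: (@eq_cdiff _ (fun u => (g u - g w) / (u - w)) _ _ _ d0).
    move=> v vu; rewrite kE//; apply/eqP => vw; move: vu.
    by rewrite vw cabs_distC ltxx.
  apply: cdiff_div; first by rewrite subr_eq0.
    by apply: cdiffB; [exact/gd/in_r|exact: cdiff_cst].
  by apply: cdiffB; [exact: cdiff_id|exact: cdiff_cst].
have kn0 u : cabs (u - w) < r' -> k u != 0.
  move=> ur; have [->|uw] := eqVneq u w; first by rewrite kk0.
  rewrite kE// mulf_neq0 ?invr_eq0 ?subr_eq0//; apply: contra uw => /eqP/gi ->//.
    exact: in_r.
  by apply: in_r; rewrite subrr cabs0.
have hP : punctured_inj (fun u => g u - g w) w r'.
  split.
  - by move=> u uw ur; apply: cdiffB; [exact/gd/in_r|exact: cdiff_cst].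
  - by move=> u v uw vw ur vr /addIr; apply: gi; exact: in_r.
  - move=> u uw ur; rewrite gE mulf_neq0 ?subr_eq0//; exact: kn0.
(* A reference point in the annulus of [harnack_annulus]: all bounds on [k] and its inverse are
   expressed through [K]. *)
pose u1 := w + (r' / 32)%:C.
have u1N : cabs (u1 - w) = r' / 32 by rewrite /u1 addrC addKr cabsR ger0_norm//; lra.
pose K := cabs (g u1 - g w).
have K0 : 0 < K.
  rewrite /K gE cabsM u1N mulr_gt0//; last by lra.
  by apply/cabs_gt0/kn0; lra.
have up u : r' / 48 <= cabs (u - w) -> cabs (u - w) <= r' / 6 -> cabs (k u) <= 48 * C * K / r'.
  move=> h1 h2; have h3 : cabs (g u - g w) <= C * K.
    by apply: (HC (fun u => g u - g w) w r' u1 u) => //; lra.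

  have uw0 : 0 < cabs (u - w) by lra.
  move: h3; rewrite gE cabsM => h3; rewrite ler_pdivlMr//.
  have : cabs (k u) * (r' / 48) <= cabs (k u) * cabs (u - w) by rewrite ler_wpM2l ?cabs_ge0.
  lra.
have low u : r' / 48 <= cabs (u - w) -> cabs (u - w) <= r' / 6 -> cabs ((k u)^-1) <= C * r' / (6 * K).
  move=> h1 h2; have h3 : K <= C * cabs (g u - g w).
    by apply: (HC (fun u => g u - g w) w r' u u1) => //; lra.

  have kp : 0 < cabs (k u) by apply/cabs_gt0/kn0; lra.
  move: h3; rewrite gE cabsM => h3; rewrite cabsV -[(cabs _)^-1]div1r ler_pdivrMr//.
  rewrite mulrAC ler_pdivlMr; last by lra.
  have : C * cabs (k u) * cabs (u - w) <= C * cabs (k u) * (r' / 6).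
    by rewrite ler_wpM2l// mulr_ge0// ltW.
  lra.
have annul u v : cabs (v - w) <= r' / 32 -> r' / 16 <= cabs (u - v) -> cabs (u - v) <= 2 * (r' / 16) ->
    r' / 48 <= cabs (u - w) /\ cabs (u - w) <= r' / 6.
  move=> h1 h2 h3; have := cabs_tri v u w; have := cabs_tri w u v; rewrite (cabs_distC w v).
  by split; lra.
have in_r' u v : cabs (v - w) <= r' / 32 -> cabs (u - v) <= 2 * (r' / 16) -> cabs (u - w) < r'.
  by move=> h1 h2; have := cabs_tri v u w; lra.
have kup v : v != w -> cabs (v - w) <= r' / 32 -> cabs (k v) <= 48 * C * K / r'.
  move=> vw vr; apply: (@max_mod _ k v (r' / 16) w w); rewrite 1?eq_sym//; first by lra.
  - by move=> u ur uw _; apply: kd => //; apply: in_r' ur.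
  - by move=> u ur; apply: kc; apply: in_r' ur.
  by move=> u h1 h2; have [? ?] := annul u v vr h1 h2; apply: up.
have klow v : v != w -> cabs (v - w) <= r' / 32 -> cabs ((k v)^-1) <= C * r' / (6 * K).
  move=> vw vr; apply: (@max_mod _ (fun u => (k u)^-1) v (r' / 16) w w); rewrite 1?eq_sym//; first by lra.
  - by move=> u ur uw _; apply: cdiffV; [apply: kn0|apply: kd => //]; apply: in_r' ur.
  - by move=> u ur; apply: ccontV; [apply: kn0|apply: kc]; apply: in_r' ur.
  by move=> u h1 h2; have [? ?] := annul u v vr h1 h2; apply: low.
(* The maximum principle excludes the center [w]; there the bound follows by continuity. *)
have kup' v : cabs (v - w) <= r' / 32 -> cabs (k v) <= 48 * C * K / r'.
  have [-> _|vw] := eqVneq v w; last exact: kup.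
  apply/ler_addgt0Pr => e e0.
  have [d d0 Hd] := kc w ltac:(rewrite subrr cabs0; lra) e e0.
  pose x := Num.min (d / 2) (r' / 32).
  have x0 : 0 < x by rewrite lt_min; apply/andP; split; lra.
  have xd : x <= d / 2 by rewrite ge_min lexx.
  have xr : x <= r' / 32 by rewrite ge_min lexx orbT.
  pose u := w + x%:C.
  have uN : cabs (u - w) = x by rewrite /u addrC addKr cabsR ger0_norm// ltW.
  have uw : u != w by apply/eqP => E; move: uN; rewrite E subrr cabs0; lra.
  have h1 := kup u uw ltac:(lra); have h2 := Hd u ltac:(lra).
  by have := cabs_sub (k w) (k u); rewrite (cabs_distC (k w)); lra.
(* The Schwarz lemma needs a center where [k] is known to be differentiable, hence not [w]; and
   [k (w + 1)] is the increment of [g] from [w] to [w + 1]. *)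
pose a := w + 1.
have aw : cabs (a - w) = 1 by rewrite /a addrC addKr cabs1.
have a_w : a != w by apply/eqP => E; move: aw; rewrite E subrr cabs0; lra.
have gaE : g (w + 1) - g w = k a by rewrite gE -/a /a [w + 1]addrC addrK mulr1.
move=> u uC.
have ua : cabs (u - a) <= r' / 64 / 8.
  have : 1024 * cabs (u - a) <= C1 * cabs (u - a).
    by apply: ler_wpM2r; [exact: cabs_ge0|rewrite /C1; lra].
  by move: uC; rewrite -/a /r'; lra.
have [->|u_w] := eqVneq u w; first by rewrite !subrr cabs0 !mulr0 subrr cabs0.
have kk : cabs (k u - k a) <= 16 * (48 * C * K / r') / (r' / 64) * cabs (u - a).
  have in32 v : cabs (v - a) < r' / 64 -> cabs (v - w) <= r' / 32.
    by have := cabs_tri a v w; rewrite aw /r'; lra.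
  apply: (@schwarz_lip _ k a w) => //; rewrite 1?eq_sym//; first by lra.
  - by move=> v /in32 vr vw; apply: kd => //; lra.
  - by move=> v /in32 vr; apply: kc; lra.
  - by move=> v /in32; apply: kup'.
have ka : 6 * K <= cabs (k a) * (C * r').
  have := klow a a_w ltac:(rewrite aw /r'; lra).
  have kp : 0 < cabs (k a) by apply/cabs_gt0/kn0; rewrite aw /r'; lra.
  rewrite cabsV -[(cabs _)^-1]div1r ler_pdivrMr// mulrAC ler_pdivlMr; last by lra.
  by rewrite mul1r; lra.
rewrite gaE gE -mulrBl cabsM; apply: ler_wpM2r; first exact: cabs_ge0.
apply: le_trans kk _; rewrite -/a; apply: ler_wpM2r; first exact: cabs_ge0.
have -> : 16 * (48 * C * K / r') / (r' / 64) = 16 * 8 * 64 * C * (6 * K) / (r' * r').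
  by field; rewrite gt_eqF.
have -> : C1 / r * cabs (k a) = (C1 / 2 * cabs (k a) * r') / (r' * r').
  by rewrite /r'; field; rewrite gt_eqF//; lra.
apply: ler_wpM2r; first by rewrite invr_ge0 ltW// mulr_gt0.
have h1 : 16 * 8 * 64 * C * (6 * K) <= 16 * 8 * 64 * C * (cabs (k a) * (C * r')).
  by rewrite ler_wpM2l//; lra.
have h2 : 16 * 8 * 64 * (C * C) * (cabs (k a) * r') <= C1 / 2 * (cabs (k a) * r').
  by apply: ler_wpM2r; [rewrite mulr_ge0 ?cabs_ge0 ?ltW|rewrite /C1; lra].
lra.
Qed.

End AlmostAffine.

(** * Covering by affine values, chordal estimates, Moebius maps *)

Section SphereMaps.
Variable R : realType.
Implicit Types (z w c v l b p u : R[i]) (x y : sphere R) (s r e d t : R) (g h k : R[i] -> R[i]).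

(** A Rouche type argument. Within [e] of [z] the map [g] differs from its affine approximation by
    at most [e / 8 * cabs b], while at distance at least [e / 2] the affine map differs from its
    value at [z] by at least [e / 2 * cabs b]; so that value is attained. The square comes from the
    two distances, to [w] and to [w + 1], in [almost_affine]. *)
Lemma affine_param : exists2 C, 3 <= C & forall g r, C <= r ->
  (forall u, cabs u < r -> cdiff g u) ->
  (forall u v, cabs u < r -> cabs v < r -> g u = g v -> u = v) ->
  exists2 w, cabs w <= 1 & let b := g (w + 1) - g w in b != 0 /\
    forall t e, 0 < t -> 0 < e -> C * (t + e + 2) ^+ 2 <= r -> C * (t + e + 2) ^+ 2 <= r * e / 8 ->
    forall z, cabs z <= t -> exists2 u, cabs (u - z) <= e & g u = g w - b * w + b * z.
Proof.
have [C0 C00 HC] := @almost_affine R; pose C := C0 + 3.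
exists C => [|g r rC gd gi]; first by rewrite /C; lra.
have r3 : 3 <= r by move: rC; rewrite /C; lra.
have [w w1 Hw] := HC g r ltac:(move: rC; rewrite /C; lra) gd gi.
exists w => //= ; set b := g (w + 1) - g w.
have w2 : cabs (w + 1) <= 2 by apply: le_trans (cabsD _ _) _; rewrite cabs1; lra.
have b0 : b != 0.
  rewrite subr_eq0; apply/eqP => /gi E; have : w + 1 = w by apply: E; lra.
  by apply/eqP; rewrite -subr_eq0 addrC addKr oner_neq0.
have Nb := cabs_gt0 b0; split => // t e t0 e0 rt re z zt.
pose T := t + e + 2.
have TE : T = t + e + 2 by [].
have {}rt : C * T ^+ 2 <= r := rt.
have {}re : C * T ^+ 2 <= r * e / 8 := re.
have T2 : 2 < T by lra.
have TT : T <= T ^+ 2 by rewrite expr2 ler_peMl//; lra.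
have CT : C0 * T ^+ 2 <= C * T ^+ 2 by rewrite ler_wpM2r ?sqr_ge0// /C; lra.
have in_r u : cabs (u - z) <= e -> cabs u < r.
  move=> uz; have : cabs u <= t + e by have := cabsD (u - z) z; rewrite subrK; lra.
  have : 3 * T ^+ 2 <= C * T ^+ 2 by rewrite ler_wpM2r ?sqr_ge0// /C; lra.
  lra.
have err u : cabs (u - z) <= e -> cabs (g u - (g w - b * w + b * u)) <= e / 8 * cabs b.
  move=> uz; have ut : cabs u <= t + e by have := cabsD (u - z) z; rewrite subrK; lra.
  have -> : g u - (g w - b * w + b * u) = g u - g w - b * (u - w) by ring.
  have uw1 : cabs (u - (w + 1)) <= T by apply: le_trans (cabsB _ _) _; lra.
  have uw : cabs (u - w) <= T by apply: le_trans (cabsB _ _) _; lra.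
  apply: le_trans (Hw u _) _.
    have : C0 * cabs (u - (w + 1)) <= C0 * T by rewrite ler_wpM2l// ltW.
    have : C0 * T <= C0 * T ^+ 2 by rewrite ler_wpM2l// ltW.
    lra.
  rewrite -/b.
  have -> : C0 / r * cabs b * cabs (u - (w + 1)) * cabs (u - w) =
    C0 * (cabs (u - (w + 1)) * cabs (u - w)) / r * cabs b by ring.
  apply: ler_wpM2r; first exact: cabs_ge0.
  rewrite ler_pdivrMr; last by lra.
  have : C0 * (cabs (u - (w + 1)) * cabs (u - w)) <= C0 * T ^+ 2.
    by apply: ler_wpM2l; [exact: ltW|rewrite expr2; apply: ler_pM; rewrite ?cabs_ge0].
  lra.
have lin u : g w - b * w + b * u - (g w - b * w + b * z) = b * (u - z) by ring.
have [u u1 u2] : exists2 u, cabs (u - z) <= 2 * (e / 2) & g u = g w - b * w + b * z.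
  apply: (@attained_center _ g z (e / 2) (e / 4 * cabs b)); first by lra.
  - by move=> u uz; apply/gd/in_r; lra.
  - move=> u u1 u2; have h1 := err u ltac:(lra).
    have := cabs_tri (g u) (g w - b * w + b * u) (g w - b * w + b * z).
    rewrite lin cabsM (cabs_distC _ (g u)).
    have : 0 < e * cabs b by rewrite mulr_gt0.
    have : cabs b * (e / 2) <= cabs b * cabs (u - z) by rewrite ler_pM2l.
    lra.
  - have := err z ltac:(rewrite subrr cabs0; lra).
    have : 0 < e * cabs b by rewrite mulr_gt0.
    lra.
exists u => //; lra.
Qed.

Lemma sinvK : involutive (@sinv R).
Proof.
case=> [z|] /=; last by rewrite eqxx.
by case: eqVneq => [->//|z0] /=; rewrite invr_eq0 (negbTE z0) invrK.
Qed.

Lemma homog_sinv x : exists2 l, l != 0 &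
  homog (sinv x) = (l * (homog x).2, l * (homog x).1).
Proof.
case: x => [z|] /=; last by exists 1; rewrite ?oner_neq0// mulr0 mulr1.
have [->|z0] /= := eqVneq z 0; first by exists 1; rewrite ?oner_neq0// mulr0 mulr1.
by exists z^-1; rewrite ?invr_neq0// mulr1 mulVf.
Qed.

Lemma chordal_sinv x y : chordal (sinv x) (sinv y) = chordal x y.
Proof.
have nE (l : R[i]) (P : R[i] * R[i]) : hnorm (l * P.2, l * P.1) = cabs l * hnorm P.
  rewrite /hnorm /= -!/(cabs _) !cabsM !exprMn -mulrDr sqrtrM ?sqr_ge0// sqrtr_sqr.
  by rewrite ger0_norm ?cabs_ge0// addrC.
have nx := hnorm_gt0 x; have ny := hnorm_gt0 y.
rewrite !chordalE; have [l l0 ->] := homog_sinv x; have [m m0 ->] := homog_sinv y.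
rewrite !nE -!/(cabs _) /hdet /=; have Nl := cabs_gt0 l0; have Nm := cabs_gt0 m0.
set P := homog x in nx *; set Q := homog y in ny *.
have -> : l * P.2 * (m * Q.1) - l * P.1 * (m * Q.2) = - (l * m * (P.1 * Q.2 - P.2 * Q.1)) by ring.
by rewrite cabsN !cabsM; field; apply/and4P; split; rewrite gt_eqF.
Qed.

Lemma chordal_le z w : chordal (Some z) (Some w) <= 2 * cabs (z - w).
Proof.
rewrite /chordal -!/(cabs _).
have sq u : 1 <= Num.sqrt (1 + cabs u ^+ 2).
  by rewrite -[X in X <= _]sqrtr1 ler_wsqrtr// lerDl sqr_ge0.
rewrite ler_pdivrMr; last by rewrite mulr_gt0//; apply: lt_le_trans (sq _).
by rewrite ler_peMr ?mulr_ge0 ?cabs_ge0// mulr_ege1.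
Qed.

(** [A^-1] is half the distance from [z] to infinity. So [x] is finite and not much nearer to
    infinity than [z], which makes the chordal and Euclidean distances comparable. *)
Lemma chordal_ball z x (A := Num.sqrt (1 + cabs z ^+ 2)) : chordal (Some z) x < A^-1 ->
  exists2 w, x = Some w & cabs (w - z) <= chordal (Some z) x * A ^+ 2.
Proof.
have sq u : 1 <= Num.sqrt (1 + cabs u ^+ 2).
  by rewrite -[X in X <= _]sqrtr1 ler_wsqrtr// lerDl sqr_ge0.
have A1 : 1 <= A := sq z.
have zN : chordal (Some z) None = 2 / A by [].
case: x => [w|] h1; last first.
  by exfalso; move: h1; rewrite zN; have : 0 < A^-1 by [rewrite invr_gt0; lra]; lra.
exists w => //; pose B := Num.sqrt (1 + cabs w ^+ 2); have B1 : 1 <= B := sq w.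
have BA : B <= 2 * A.
  have : A^-1 <= 2 / B.
    have := chordal_triangle (Some w) (Some z) None; rewrite zN.
    have -> : chordal (Some w) None = 2 / B by [].
    have : 2 / A = A^-1 + A^-1 by field; lra.
    by lra.
  rewrite -[A^-1]div1r ler_pdivlMr; last by lra.
  rewrite mulrAC ler_pdivrMr; lra.
have : cabs (z - w) * 2 = chordal (Some z) (Some w) * (A * B).
  rewrite /chordal -!/(cabs _) -/A -/B; field; apply/andP; split; lra.
rewrite cabs_distC => h3.
have h4 : chordal (Some z) (Some w) * (A * B) <= chordal (Some z) (Some w) * (2 * A ^+ 2).
  apply: ler_wpM2l; last first.
    have : A * B <= A * (2 * A) by rewrite ler_pM2l; lra.
    by rewrite expr2; lra.
  by rewrite /chordal divr_ge0 ?mulr_ge0 ?sqrtr_ge0 ?normc_ge0.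
lra.
Qed.

Lemma chordal_close z e : 0 < e -> exists2 d, 0 < d & forall x,
  chordal (Some z) x < d -> exists2 w, x = Some w & cabs (w - z) < e.
Proof.
move=> e0; pose A := Num.sqrt (1 + cabs z ^+ 2).
have A0 : 0 < A by rewrite sqrtr_gt0 ltr_pwDl// sqr_ge0.
have A2 : 0 < A ^+ 2 by rewrite exprn_gt0.
exists (Num.min A^-1 (e / A ^+ 2)); first by rewrite lt_min invr_gt0 divr_gt0// andbT.
move=> x; rewrite lt_min => /andP[/chordal_ball[w xw wz] h2].
exists w => //; apply: le_lt_trans wz _.
by move: h2; rewrite -/A ltr_pdivlMr.
Qed.

Lemma chordal_bounded z x B : cabs z <= B -> chordal (Some z) x < (1 + B)^-1 ->
  exists2 w, x = Some w & cabs (w - z) <= (1 + B) ^+ 2 * chordal (Some z) x.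
Proof.
move=> zB zx; have B0 : 0 <= B by apply: le_trans zB; exact: cabs_ge0.
have zB2 : cabs z ^+ 2 <= B ^+ 2 by apply: lerXn2r; rewrite ?nnegrE ?cabs_ge0.
have s0 : 0 < Num.sqrt (1 + cabs z ^+ 2) by rewrite sqrtr_gt0 ltr_pwDl// sqr_ge0.
have [] := @chordal_ball z x.
  apply: lt_le_trans zx _; rewrite lef_pV2 ?posrE//; last by lra.
  rewrite -[1 + B]ger0_norm; last by lra.
  by rewrite -sqrtr_sqr ler_wsqrtr//; lra.
move=> w -> h; exists w => //; apply: le_trans h _.
rewrite sqr_sqrtr ?addr_ge0 ?sqr_ge0// mulrC; apply: ler_wpM2r; last by lra.
by rewrite /chordal divr_ge0 ?mulr_ge0 ?sqrtr_ge0 ?normc_ge0.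
Qed.

(** Either chart is allowed wherever both make sense, which makes the notion symmetric under
    inversion; [cdifferentiable_mdiff] proves the equivalence with [cdifferentiable_at]. *)
Definition mdiff (psi : R[i] -> sphere R) u := exists g d,
  [/\ 0 < d, cdiff g u & (forall w, cabs (w - u) < d -> psi w = Some (g w)) \/
                         (forall w, cabs (w - u) < d -> psi w = sinv (Some (g w)))].

Lemma mdiff_sinv psi u : mdiff psi u -> mdiff (fun w => sinv (psi w)) u.
Proof.
move=> [g [d [d0 gd H]]]; exists g, d; split=> //; case: H => H; [right|left] => w /H ->//.
by rewrite sinvK.
Qed.

Lemma mdiff_finite psi u z : mdiff psi u -> psi u = Some z ->
  exists g d, [/\ 0 < d, cdiff g u & forall w, cabs (w - u) < d -> psi w = Some (g w)].
Proof.
move=> [g [d [d0 gd [H|H]]]] uz; first by exists g, d.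
have gu : g u != 0.
  have := H u ltac:(by rewrite subrr cabs0); rewrite uz /=; case: eqVneq => //.
have [d' d'0 Hd'] := ccont_neq0 (cdiff_ccont gd) gu.
exists (fun w => (g w)^-1), (Num.min d d'); split.
- by rewrite lt_min d0.
- exact: cdiffV.
by move=> w; rewrite lt_min => /andP[/H -> /Hd' gw] /=; rewrite (negbTE gw).
Qed.

Lemma mdiff_cont psi u e : mdiff psi u -> 0 < e ->
  exists2 d, 0 < d & forall w, cabs (w - u) < d -> chordal (psi u) (psi w) < e.
Proof.
move=> [g [d [d0 gd H]]] e0.
have [d' d'0 Hd'] := cdiff_ccont gd (e := e / 4) ltac:(lra).
exists (Num.min d d'); first by rewrite lt_min d0.
move=> w; rewrite lt_min => /andP[wd /Hd' wd'].
have := chordal_le (g u) (g w); rewrite cabs_distC => h.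
have uu : cabs (u - u) < d by rewrite subrr cabs0.
by case: H => H; rewrite !H// ?chordal_sinv; lra.
Qed.

Definition sdet x y : R[i] := hdet (homog x) (homog y).

Lemma sdet_le x y : cabs (sdet x y) <= hnorm (homog x) * hnorm (homog y).
Proof.
rewrite /sdet; case: (homog x) (homog y) => [a b] [c' d'].
have -> : hdet (a, b) (c', d') = hdot (a, b) ((d')^*, - (c')^*).
  rewrite /hdet /hdot /=; case: a b c' d' => [? ?] [? ?] [? ?] [? ?].
  by apply/eqP; rewrite eq_complex /=; apply/andP; split; apply/eqP; ring.
apply: le_trans (hdot_le _ _) _.
by rewrite /hnorm /= normcN !normcC [X in _ * Num.sqrt X]addrC.
Qed.

Lemma sdet_neq0 x y : x <> y -> sdet x y != 0.
Proof.
move=> xy; apply/eqP => xy0; apply: xy; apply: chordal_positivity.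
by rewrite chordalE -/(sdet x y) xy0 -/(cabs 0) cabs0 mulr0 mul0r.
Qed.

Lemma sdet_eq0 x y : sdet x y = 0 -> x = y.
Proof.
by move=> xy; apply: chordal_positivity; rewrite chordalE -/(sdet x y) xy -/(cabs 0) cabs0 mulr0 mul0r.
Qed.

(** The Moebius map with zero [x1] and pole [x0], up to a scalar, in homogeneous coordinates so that
    any of the points may be infinite. *)
Definition mob x0 x1 x : R[i] := sdet x x1 / sdet x x0.

Lemma mob_sub x0 x1 x y : x <> x0 -> y <> x0 ->
  (mob x0 x1 x - mob x0 x1 y) * (sdet x x0 * sdet y x0) = sdet x y * sdet x1 x0.
Proof.
move=> /sdet_neq0 hx /sdet_neq0 hy.
have -> : (mob x0 x1 x - mob x0 x1 y) * (sdet x x0 * sdet y x0) =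
  sdet x x1 * sdet y x0 - sdet y x1 * sdet x x0.
  by rewrite /mob; field; rewrite hx hy.
by rewrite /sdet /hdet; ring.
Qed.

(** The factor [sdet x1 x0] of [mob_sub] becomes [chordal x1 x0]; everything else cancels up to
    norms, so the constant is the same for all pairs [x0], [x1]. *)
Lemma mob_chordal x0 x1 x y e : x <> x0 -> y <> x0 -> x0 <> x1 -> 0 <= e ->
  cabs (mob x0 x1 x - mob x0 x1 y) <= e * cabs (mob x0 x1 y) ->
  chordal x y * chordal x1 x0 <= 4 * e.
Proof.
move=> hx hy h01 e0 he.
have nx := hnorm_gt0 x; have ny := hnorm_gt0 y; have n0 := hnorm_gt0 x0; have n1 := hnorm_gt0 x1.
rewrite !chordalE -!/(sdet _ _) -!/(cabs _).
have -> : 2 * cabs (sdet x y) / (hnorm (homog x) * hnorm (homog y)) *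
   (2 * cabs (sdet x1 x0) / (hnorm (homog x1) * hnorm (homog x0))) =
   4 * cabs (sdet x y * sdet x1 x0) / (hnorm (homog x) * hnorm (homog y) * hnorm (homog x0) * hnorm (homog x1)).
  by rewrite cabsM; field; apply/and4P; split; rewrite gt_eqF.
rewrite ler_pdivrMr ?mulr_gt0//.
have D0 := sdet_neq0 hy; have Dy := cabs_gt0 D0.
rewrite -mob_sub// !cabsM.
have h1 : cabs (mob x0 x1 x - mob x0 x1 y) * (cabs (sdet x x0) * cabs (sdet y x0)) <=
   e * cabs (mob x0 x1 y) * (cabs (sdet x x0) * cabs (sdet y x0)).
  by rewrite ler_wpM2r// mulr_ge0 ?cabs_ge0.
have h2 : e * cabs (mob x0 x1 y) * (cabs (sdet x x0) * cabs (sdet y x0)) =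
   e * (cabs (sdet y x1) * cabs (sdet x x0)).
  by rewrite /mob cabs_div; field; rewrite gt_eqF.
have : e * (cabs (sdet y x1) * cabs (sdet x x0)) <=
   e * ((hnorm (homog y) * hnorm (homog x1)) * (hnorm (homog x) * hnorm (homog x0))).
  by rewrite ler_wpM2l//; apply: ler_pM; rewrite ?cabs_ge0 ?sdet_le.
lra.
Qed.

End SphereMaps.

(** * Two omitted values and the rescaling sequence *)

Section Core.
Variable R : realType.
Implicit Types (z w c v l b p u : R[i]) (x y : sphere R) (s r e d t : R) (g h k : R[i] -> R[i]).

(** In either chart [mob] is a quotient of affine expressions in [g]; near infinity the scalar [l]
    relating the homogeneous coordinates cancels. *)
Lemma mob_mdiff x0 x1 (psi : R[i] -> sphere R) u : mdiff psi u -> psi u <> x0 ->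
  cdiff (fun w => mob x0 x1 (psi w)) u.
Proof.
move=> [g [d [d0 gd H]]] ux0.
have uu : cabs (u - u) < d by rewrite subrr cabs0.
pose num (x : sphere R) w := (homog x).2 * g w - (homog x).1.
pose num' (x : sphere R) w := (homog x).2 - (homog x).1 * g w.
have numd x : cdiff (num x) u.
  by apply: cdiffB; [apply: cdiffM => //|]; exact: cdiff_cst.
have numd' x : cdiff (num' x) u.
  by apply: cdiffB; [|apply: cdiffM => //]; exact: cdiff_cst.
have sdu := sdet_neq0 ux0.
case: H => H.
  have E x w : cabs (w - u) < d -> sdet (psi w) x = num x w.
    by move=> /H ->; rewrite /sdet /hdet /num /=; ring.
  apply: (@eq_cdiff _ (fun w => num x1 w / num x0 w) _ _ d) => //.
    by move=> w wd; rewrite /mob !E.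
  by apply: cdiff_div => //; rewrite -E.
have E w : cabs (w - u) < d -> exists2 l, l != 0 & forall x, sdet (psi w) x = l * num' x w.
  move=> /H ->; have [l l0 E] := homog_sinv (Some (g w)); exists l => // x.
  by rewrite /sdet /hdet E /num' /=; ring.
apply: (@eq_cdiff _ (fun w => num' x1 w / num' x0 w) _ _ d) => //.
  by move=> w /E[l l0 El]; rewrite /mob !El -mulf_div divff// mul1r.
apply: cdiff_div => //; have [l l0 El] := E u uu.
by move: sdu; rewrite El mulf_eq0 negb_or => /andP[].
Qed.

(** [mob x0 x1] turns [psi] into a finite, injective, nonvanishing [h]. By [koebe_bound] it is at
    most [53 * cabs (h 0)] on the disc of radius [r / 640], and the Schwarz lemma there bounds its
    variation relative to [h 0], which [mob_chordal] translates back. *)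
Lemma two_omitted : exists2 C, 0 < C & forall x0 x1 (psi : R[i] -> sphere R) r,
  0 < r -> x0 <> x1 -> (forall u, cabs u < r -> mdiff psi u) ->
  (forall u v, cabs u < r -> cabs v < r -> psi u = psi v -> u = v) ->
  (forall u, cabs u < r -> psi u <> x0 /\ psi u <> x1) ->
  forall u, C * cabs u <= r -> chordal (psi u) (psi 0) * chordal x1 x0 <= C * cabs u / r.
Proof.
have [K [K0 KE]] : exists K : R, 0 < K /\ K = 16 * 53 * 640 by exists (16 * 53 * 640); split; [lra|reflexivity].
exists (4 * K); first by lra.
move=> x0 x1 psi r r0 x01 pd pi po u ur.
pose h w := mob x0 x1 (psi w).
have hd w : cabs w < r -> cdiff h w by move=> wr; apply: mob_mdiff; [exact: pd|case: (po w wr)].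
have hi w v : cabs w < r -> cabs v < r -> h w = h v -> w = v.
  move=> wr vr hwv; apply: pi => //; apply: sdet_eq0.
  have [w0 _] := po w wr; have [v0 _] := po v vr.
  have := mob_sub x1 w0 v0; rewrite -/(h w) -/(h v) hwv subrr mul0r => /esym/eqP.
  rewrite mulf_eq0 => /orP[/eqP//|]; rewrite (negbTE (sdet_neq0 _))//.
  by move=> /esym.
have h0 w : cabs w < r -> h w != 0.
  by move=> wr; have [w0 w1] := po w wr; rewrite mulf_neq0 ?invr_neq0 ?sdet_neq0.
have r640 : 0 < r / 640 by lra.
have hb w : cabs (w - 0) < r / 640 -> cabs (h w) <= 53 * cabs (h 0).
  move=> w0; apply: (@koebe_bound _ h 0 r) => //; rewrite ?ltW//.
  - by move=> v; rewrite subr0; exact: hd.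
  - by move=> v1 v2; rewrite !subr0; exact: hi.
  - by move=> v; rewrite subr0; exact: h0.
have u0 := cabs_ge0 u.
have {}ur : 640 * 8 * cabs u <= r.
  by apply: le_trans ur; apply: ler_wpM2r => //; lra.
have N00 : cabs (0 : R[i]) = 0 by exact: cabs0.
have [p0 _] := po 0 ltac:(lra); have [pu _] := po u ltac:(lra).
pose q : R[i] := r%:C.
have qN : cabs q = r by rewrite cabsR ger0_norm// ltW.
have q0 : q != 0 by apply/eqP => E; move: qN; rewrite E cabs0; lra.
have qu : q != u by apply/eqP => E; move: qN; rewrite E; lra.
have hu : cabs (h u - h 0) <= 16 * (53 * cabs (h 0)) / (r / 640) * cabs (u - 0).
  apply: (@schwarz_lip _ h 0 q) => //.
  - by move=> w; rewrite subr0 => wr _; apply: hd; lra.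
  - by move=> w; rewrite subr0 => wr; apply: cdiff_ccont; apply: hd; lra.
  - by rewrite subr0; lra.
have -> : 4 * K * cabs u / r = 4 * (K * cabs u / r) by field; rewrite gt_eqF.
apply: mob_chordal => //; first by apply: divr_ge0; [apply: mulr_ge0; [exact: ltW|]|exact: ltW].
apply: le_trans hu _; rewrite subr0 le_eqVlt; apply/orP; left; apply/eqP.
by rewrite -/(h 0) KE; field; rewrite gt_eqF.
Qed.

Variables (f : sphere R -> sphere R) (psi : nat -> R[i] -> sphere R).
Hypothesis fpsi : forall n u, f (psi n.+1 u) = psi n u.
Hypothesis psi_good : forall r, exists M, forall n, (M <= n)%N ->
  (forall u, cabs u < r -> mdiff (psi n) u) /\
  (forall u v, cabs u < r -> cabs v < r -> psi n u = psi n v -> u = v).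
Hypothesis f_pairs : exists a1 b1 a2 b2 : sphere R, [/\ f a1 = f b1, f a2 = f b2, a1 <> b1, a2 <> b2 &
  [/\ a1 <> a2, a1 <> b2, b1 <> a2 & b1 <> b2]].

(** Injectivity of [psi n] makes [f] injective on the image of [psi n.+1], whence the shift of the
    index. Which point of each pair is omitted may change with [n], so [dd] is the least of the four
    possible distances. *)
Lemma psi_shrink r e : 0 < e -> exists M, forall n, (M <= n)%N -> forall u, cabs u <= r ->
  chordal (psi n u) (psi n 0) < e.
Proof.
move=> e0; have [C C0 HC] := two_omitted.
have [a1 [b1 [a2 [b2 [f1 f2 ab1 ab2 [n1 n2 n3 n4]]]]]] := f_pairs.
pose dd := Num.min (Num.min (chordal a2 a1) (chordal b2 a1)) (Num.min (chordal a2 b1) (chordal b2 b1)).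
have cpos x y : x <> y -> 0 < chordal y x.
  move=> xy; rewrite lt_neqAle; apply/andP; split.
    by apply/eqP => /esym/chordal_positivity /esym.
  by rewrite chordalE divr_ge0 ?mulr_ge0 ?normc_ge0 ?ltW ?hnorm_gt0.
have dd0 : 0 < dd by rewrite !lt_min !cpos.
pose r1 := `|r| + 1.
have rr1 : r <= r1 by rewrite /r1; have := ler_norm r; lra.
have r1_gt0 : 0 < r1 by rewrite /r1; have := normr_ge0 r; lra.
pose r2 := C * r1 * (1 + 2 / (e * dd)).
have ed : 0 < e * dd by rewrite mulr_gt0.
have r2_0 : 0 < r2 by rewrite !mulr_gt0// ltr_pwDl// divr_ge0 ?ltW.
have [M HM] := psi_good r2.
exists M.+1 => -[//|n]; rewrite ltnS => Mn u ur.
have [_ in_] := HM n Mn; have [pd pi] := HM n.+1 (leqW Mn).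
have omit (a b : sphere R) : f a = f b -> a <> b -> (forall u, cabs u < r2 -> psi n.+1 u <> a) \/
    (forall u, cabs u < r2 -> psi n.+1 u <> b).
  move=> fab ab; have [|na] := pselect (forall u, cabs u < r2 -> psi n.+1 u <> a); first by left.
  right=> v vr vb; apply: na => w wr wa; apply: ab; rewrite -wa -vb.
  by congr (psi _ _); apply: in_ => //; rewrite -(fpsi n w) -(fpsi n v) wa vb.
have key x0 x1 : x0 <> x1 -> dd <= chordal x1 x0 -> (forall u, cabs u < r2 -> psi n.+1 u <> x0) ->
    (forall u, cabs u < r2 -> psi n.+1 u <> x1) -> chordal (psi n.+1 u) (psi n.+1 0) < e.
  move=> x01 ddx o0 o1.
  have ch0 : 0 <= chordal (psi n.+1 u) (psi n.+1 0).
    by rewrite chordalE divr_ge0 ?mulr_ge0 ?normc_ge0 ?ltW ?hnorm_gt0.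
  have ur1 : C * cabs u <= C * r1 by rewrite ler_pM2l//; lra.
  have Cr : C * r1 <= r2.
    rewrite /r2 [leRHS]mulrDr mulr1 lerDl; apply: mulr_ge0; first by apply: mulr_ge0; exact: ltW.
    by apply: divr_ge0 => //; exact: ltW.
  have := HC x0 x1 (psi n.+1) r2 r2_0 x01 pd pi (fun w wr => conj (o0 w wr) (o1 w wr)) u ltac:(lra).
  have h1 : C * cabs u / r2 <= e * dd / 2.
    rewrite ler_pdivrMr//; apply: le_trans ur1 _; rewrite /r2.
    have -> : e * dd / 2 * (C * r1 * (1 + 2 / (e * dd))) = C * r1 + e * dd / 2 * (C * r1).
      by field; apply/andP; split; rewrite gt_eqF.
    rewrite lerDl; apply: mulr_ge0; first lra.
    by apply: mulr_ge0; exact: ltW.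
  have : chordal (psi n.+1 u) (psi n.+1 0) * dd <= chordal (psi n.+1 u) (psi n.+1 0) * chordal x1 x0.
    by rewrite ler_wpM2l.
  move=> h2 h3; rewrite -(ltr_pM2r dd0); lra.
case: (omit _ _ f1 ab1) => oa; case: (omit _ _ f2 ab2) => ob.
- by apply: (key a1 a2) => //; rewrite /dd !ge_min lexx.
- by apply: (key a1 b2) => //; rewrite /dd !ge_min lexx ?orbT.
- by apply: (key b1 a2) => //; rewrite /dd !ge_min lexx ?orbT.
- by apply: (key b1 b2) => //; rewrite /dd !ge_min lexx ?orbT.
Qed.

(* The chart at infinity is only used if the points [psi n 0] tend to infinity. *)
Lemma cluster_point : exists (sg : sphere R -> sphere R) (x : R[i]) (B : R),
  (sg = id \/ sg = sinv /\ x = 0) /\ forall d m, 0 < d -> exists n (y : R[i]),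
    [/\ (m <= n)%N, sg (psi n 0) = Some y, cabs y <= B & cabs (y - x) < d].
Proof.
have [[B H]|nH] := pselect (exists B, forall m, exists n (y : R[i]),
    [/\ (m <= n)%N, psi n 0 = Some y & cabs y <= B]); last first.
  exists sinv, 0, 1; split; first by right.
  move=> d m d0; apply: contrapT => nm; apply: nH; exists (1 + d^-1) => m'.
  have di : 0 < d^-1 by rewrite invr_gt0.
  apply: contrapT => nm'; apply: nm; exists (maxn m m').
  case E : (psi (maxn m m') 0) => [z|]; last first.
    by exists 0; rewrite leq_maxl subr0 cabs0; split.
  have [z1|z1] := leP (cabs z) (1 + d^-1).
    by exfalso; apply: nm'; exists (maxn m m'), z; rewrite leq_maxr.
  exists z^-1; rewrite leq_maxl /= subr0 cabsV.
  have -> : (z == 0) = false by apply/eqP => z0; move: z1; rewrite z0 cabs0; lra.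
  split => //; first by rewrite invf_le1; lra.
  by rewrite -[X in _ < X]invrK ltf_pV2 ?posrE//; lra.
pose sg (y : sphere R) := y.
suff [x Hx] : exists x : R[i], forall d m, 0 < d -> exists n (y : R[i]),
    [/\ (m <= n)%N, sg (psi n 0) = Some y, cabs y <= B & cabs (y - x) < d].
  by exists sg, x, B; split => //; left.
apply: contrapT => nx.
have loc (x : R[i]) : exists d m, 0 < d /\ forall n (y : R[i]), (m <= n)%N -> sg (psi n 0) = Some y ->
    cabs y <= B -> d <= cabs (y - x).
  apply: contrapT => nd; apply: nx; exists x => // d m d0.
  apply: contrapT => nn; apply: nd; exists d, m; split=> // n y mn ny y1.
  by rewrite leNgt; apply/negP => yx; apply: nn; exists n, y.
(* The condition [d^-1 <= n%:R] expresses largeness of [n] through the parameter that [disc_unif]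
   makes uniform; the same device recurs in [leaf_good]. *)
have [||d d0 Hd] := @disc_unif _ (fun z d => forall n, d^-1 <= n%:R -> sg (psi n 0) <> Some z) 0 B.
- move=> z d d' d'0 dd Hz n dn; apply: Hz; apply: le_trans dn.
  by rewrite lef_pV2 ?posrE //; apply: lt_le_trans dd.
- move=> z _; have [d [m [d0 Hm]]] := loc z.
  exists (Num.min d m.+1%:R^-1); first by rewrite lt_min d0 invr_gt0 ltr0n.
  have dm : m.+1%:R <= (Num.min d m.+1%:R^-1)^-1.
    rewrite -[X in X <= _]invrK lef_pV2 ?posrE ?lt_min ?d0 ?invr_gt0 ?ltr0n//.
    by rewrite ge_min lexx orbT.
  move=> w; rewrite subr0 lt_min => w1 /andP[wd _] n mn nw.
  have mn' : (m <= n)%N by apply: ltnW; rewrite -(ler_nat R); exact: le_trans dm mn.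
  by have := Hm n w mn' nw w1; lra.
have [n [y [n1 n2 n3]]] := H (Num.trunc d^-1).+1.
apply: (Hd y _ n) => //; first by rewrite subr0.
by apply: le_trans (ltW (truncnS_gt d^-1)) _; rewrite ler_nat.
Qed.

(** A diagonal choice: for each [m] an index at which [psi n] is injective and nearly constant on
    the disc of radius [r m], with [psi n 0] near the cluster point. Read in the chart [sg] it is a
    map [g] to which [affine_param] applies, with [z = g w - b * w] and [rho = b]. *)
Lemma zalcman_core : exists (sg : sphere R -> sphere R) (x : R[i]), (sg = id \/ sg = sinv /\ x = 0) /\
  exists (n : nat -> nat) (z rho : nat -> R[i]),
  [/\ forall m, (m <= n m)%N, forall m, rho m != 0,
      forall e, 0 < e -> exists M, forall m, (M <= m)%N -> cabs (rho m) <= e,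
      forall e, 0 < e -> exists M, forall m, (M <= m)%N -> cabs (z m - x) <= e &
      forall t e, 0 < t -> 0 < e -> exists M, forall m, (M <= m)%N -> forall w, cabs w <= t ->
        exists2 u, cabs (u - w) <= e & psi (n m) u = sg (Some (z m + rho m * w))].
Proof.
have [C C3 HC] := @affine_param R.
have [sg [x [B0 [sgP Hx]]]] := cluster_point.
pose B := `|B0|.
have B_ge0 : 0 <= B by exact: normr_ge0.
have B2 : 0 < (1 + B) ^+ 2 by rewrite exprn_gt0//; lra.
have sgK y : sg (sg y) = y by case: sgP => [->|[-> _]]; rewrite ?sinvK.
have sgc y y' : chordal (sg y) (sg y') = chordal y y' by case: sgP => [->|[-> _]]; rewrite ?chordal_sinv.
exists sg, x; split=> //.
pose r m : R := C + 4 + m%:R.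
have step m : exists q : nat * R[i] * R[i], [/\ (m <= q.1.1)%N, q.2 != 0, cabs q.2 <= 2 / m.+1%:R,
    cabs (q.1.2 - x) <= 4 / m.+1%:R &
    forall t e, 0 < t -> 0 < e -> C * (t + e + 2) ^+ 2 <= r m -> C * (t + e + 2) ^+ 2 <= r m * e / 8 ->
    forall w, cabs w <= t -> exists2 u, cabs (u - w) <= e & psi q.1.1 u = sg (Some (q.1.2 + q.2 * w))].
  have m0 : 0 <= m%:R :> R by [].
  have r0 : 4 < r m by rewrite /r; lra.
  have [M1 HM1] := psi_good (r m).
  have [e1 e1E] : exists e1 : R, e1 = m.+1%:R^-1 by exists m.+1%:R^-1.
  have em : 0 < e1 by rewrite e1E invr_gt0 ltr0n.
  have em1 : e1 <= 1 by rewrite e1E invf_le1 ?ler1n ?ltr0n.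
  (* By [chordal_bounded] this chordal closeness keeps [g] within [e1] of [y]; hence [2 * e1] for
     the slope, and [e1 + e1 + 2 * e1] for the distance from [g w - b * w] to [x]. *)
  have em4 : 0 < e1 / (2 * (1 + B) ^+ 2) by rewrite divr_gt0//; lra.
  have [M2 HM2] := @psi_shrink (r m) _ em4.
  have [n [y [nM ny y1' yx]]] := Hx e1 (maxn m (maxn M1 M2)) em.
  have y1 : cabs y <= B by apply: le_trans y1' _; exact: ler_norm.
  move: nM; rewrite !geq_max => /and3P[mn M1n M2n].
  have [pd pi] := HM1 n M1n; have sh := HM2 n M2n.
  (* The default is never taken on the disc of radius [r m], by [gE]. *)
  pose g u := odflt 0 (sg (psi n u)).
  have gE u : cabs u <= r m -> sg (psi n u) = Some (g u) /\ cabs (g u - y) <= e1.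
    move=> /sh; rewrite -sgc ny chordal_sym /g => h.
    move: h; rewrite ltr_pdivlMr; last by lra.
    move=> h.
    have [|w wE wy] := chordal_bounded y1 (x := sg (psi n u)).
      rewrite -[(1 + B)^-1]div1r ltr_pdivlMr; last by lra.
      have : 0 <= chordal (Some y) (sg (psi n u)).
        by rewrite chordalE divr_ge0 ?mulr_ge0 ?normc_ge0 ?ltW ?hnorm_gt0.
      set c := chordal _ _ in h * => c0.
      have : 0 <= c * B by rewrite mulr_ge0.
      have : 0 <= c * (B ^+ 2) by rewrite mulr_ge0 ?sqr_ge0.
      lra.
    by rewrite wE; split=> //=; lra.
  have gd u : cabs u < r m -> cdiff g u.
    move=> ur; have [uE _] := gE u (ltW ur).
    have md : mdiff (fun w => sg (psi n w)) u.
      by case: sgP => [->|[-> _]]; [exact: pd|apply/mdiff_sinv/pd].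
    have [g' [d [d0 g'd Hg']]] := mdiff_finite md uE.
    apply: (@eq_cdiff _ g' _ _ d) => // w /Hg'; rewrite /g => ->//.
  have gi u v : cabs u < r m -> cabs v < r m -> g u = g v -> u = v.
    move=> ur vr guv; apply: pi => //; rewrite -[psi n u]sgK -[psi n v]sgK.
    by congr sg; rewrite (gE u (ltW ur)).1 (gE v (ltW vr)).1 guv.
  have [w w1 /= [b0 Hw]] := HC g (r m) ltac:(rewrite /r; lra) gd gi.
  set b := g (w + 1) - g w in b0 Hw.
  have w2 : cabs (w + 1) <= 2 by apply: le_trans (cabsD _ _) _; rewrite cabs1; lra.
  have [_ gw] := gE w ltac:(lra); have [_ gw1] := gE (w + 1) ltac:(lra).
  have bN : cabs b <= 2 * e1.
    by have := cabs_tri y (g (w + 1)) (g w); rewrite (cabs_distC y) -/b; lra.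
  rewrite -e1E; exists (n, g w - b * w, b); split => //=.
    have -> : g w - b * w - x = (g w - y) + (y - x) - b * w by ring.
    apply: le_trans (cabsB _ _) _; rewrite cabsM; have := cabsD (g w - y) (y - x).
    have : cabs b * cabs w <= cabs b * 1 by rewrite ler_wpM2l ?cabs_ge0.
    lra.
  move=> t e t0 e0 h1 h2 v vt; have [u uv gu] := Hw t e t0 e0 h1 h2 v vt.
  exists u => //; rewrite -gu; have ur : cabs u <= r m.
    have := cabsD (u - v) v; rewrite subrK => uu.
    pose T := t + e + 2; have T2 : 2 <= T by rewrite /T; lra.
    have : T <= T ^+ 2 by rewrite expr2 ler_peMl//; lra.
    have : 1 * T ^+ 2 <= C * T ^+ 2 by rewrite ler_wpM2r ?sqr_ge0//; lra.
    by move: h1; rewrite -/T /T; lra.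
  by rewrite -[psi n u]sgK (gE u ur).1.
have [q Hq] := choice step.
have arch (a : R) : exists M, forall m, (M <= m)%N -> a <= m%:R.
  exists (Num.trunc a).+1 => m Mm; apply: le_trans (ltW (truncnS_gt a)) _.
  by rewrite ler_nat.
have small (a e : R) : 0 < e -> exists M, forall m, (M <= m)%N -> a / m.+1%:R <= e.
  move=> e0; have [M HM] := arch (a / e); exists M => m /HM.
  rewrite !ler_pdivrMr ?ltr0n// -natr1 => h; have : 0 <= e by lra.
  by move: h; rewrite mulrC; lra.
exists (fun m => (q m).1.1), (fun m => (q m).1.2), (fun m => (q m).2); split.
- by move=> m; have [] := Hq m.
- by move=> m; have [] := Hq m.
- move=> e /(small 2)[M HM]; exists M => m /HM h.
  by have [_ _ h1 _ _] := Hq m; exact: le_trans h.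
- move=> e /(small 4)[M HM]; exists M => m /HM h.
  by have [_ _ _ h1 _] := Hq m; exact: le_trans h.
move=> t e t0 e0; pose T := t + e + 2.
have [M1 HM1] := arch (C * T ^+ 2); have [M2 HM2] := arch (C * T ^+ 2 * 8 / e).
exists (maxn M1 M2) => m; rewrite geq_max => /andP[/HM1 h1 /HM2 h2].
have [_ _ _ _ H] := Hq m; apply: H => //; rewrite -/T /r; first by lra.
move: h2; rewrite ler_pdivrMr// => h2.
have : 0 <= C * e by rewrite mulr_ge0 ?ltW//; lra.
lra.
Qed.

End Core.

(** * Meromorphic maps and leaves in terms of moduli *)

Section Interface.
Variable R : realType.
Implicit Types (u v w z : R[i]) (x y : sphere R) (d e : R).

Lemma normr_cabs z : `|z| = (cabs z)%:C.
Proof. by rewrite normc_def; case: z. Qed.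

Lemma gt0C (e : R[i]) : 0 < e -> 0 < Re e /\ e = (Re e)%:C.
Proof. by case: e => a b; rewrite ltcE /= => /andP[/eqP -> ->]. Qed.

Lemma nbhs_cplxP (u : Cplx R) (A : set (Cplx R)) :
  nbhs u A <-> exists2 d, 0 < d & forall w, cabs (w - u) < d -> A w.
Proof.
split.
  move=> /nbhs_normP[/= e e0 H]; have [eR eE] := gt0C e0.
  exists (Re e) => // w wu; apply: H => /=.
  by rewrite eE distrC normr_cabs ltcR.
move=> [d d0 H]; apply/(nbhs_normP (u : Cplx R) A); exists d%:C; first by rewrite /= ltcR.
by move=> w /=; rewrite distrC normr_cabs ltcR; exact: H.
Qed.

Lemma nbhs_sphere (x : sphere R) (A : set (sphere R)) :
  nbhs x A <-> exists2 d, 0 < d & forall y, chordal x y < d -> A y.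
Proof.
split.
  by move=> /nbhs_ballP[/= e e0 H]; exists e => // y xy; exact: H.
by move=> [d d0 H]; apply/(nbhs_ballP x); exists d.
Qed.

Lemma continuous_sphereP (g : Cplx R -> sphere R) (u : Cplx R) :
  {for u, continuous g} <-> forall e, 0 < e ->
    exists2 d, 0 < d & forall w, cabs (w - u) < d -> chordal (g u) (g w) < e.
Proof.
split.
  move=> gc e e0; apply/(nbhs_cplxP u [set w | chordal (g u) (g w) < e]).
  by apply: (gc [set y | chordal (g u) y < e]); apply/nbhs_sphere; exists e.
move=> H A /nbhs_sphere[e e0 HA]; apply/nbhs_cplxP; have [d d0 Hd] := H e e0.
by exists d => // w /Hd/HA.
Qed.

Lemma derivable_cdiff (g : Cplx R -> Cplx R) (u : Cplx R) : derivable g u 1 <-> cdiff g u.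
Proof.
split.
  move=> /cvg_ex[/= l /cvgrPdist_lt gl].
  exists (fun w => if w == u then l else (g w - g u) / (w - u)); last first.
    move=> w; case: eqVneq => [->|wu]; first by rewrite subrr mulr0 addr0.
    by rewrite divfK ?subr_eq0// addrC subrK.
  move=> e e0; rewrite eqxx.
  have /= : (0 : R[i]) < e%:C by rewrite ltcR.
  move=> /gl; rewrite near_withinE => /nbhs_cplxP[d d0 Hd]; exists d => // w wu.
  case: eqVneq => [_|w_u]; first by rewrite subrr cabs0 ltW.
  have := Hd (w - u); rewrite subr0 => /(_ wu); rewrite subr_eq0 => /(_ w_u).
  rewrite normr_cabs ltcR cabs_distC => /ltW.
  by rewrite /GRing.scale /= mulr1 subrK mulrC.
move=> [k kc E]; apply/cvg_ex; exists (k u); apply/cvgrPdist_lt => /= e e0.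
have [eR eE] := gt0C e0.
have [d d0 Hd] := kc (Re e / 2) ltac:(lra).
rewrite near_withinE; apply/nbhs_cplxP; exists d => // h; rewrite subr0 => hd h0.
have -> : h^-1 *: (g (h *: (1 : Cplx R) + u) - g u) = k (h + u).
  rewrite /GRing.scale /= mulr1 (E (h + u)) [g u + _]addrC addrK addrK.
  by rewrite mulrCA mulVf// mulr1.
have := Hd (h + u); rewrite addrK => /(_ hd) h1.
by rewrite normr_cabs eE ltcR cabs_distC; lra.
Qed.

Lemma cdifferentiable_mdiff (psi : Cplx R -> sphere R) (u : Cplx R) :
  cdifferentiable_at psi u <-> mdiff psi u.
Proof.
split.
  move=> [/continuous_sphereP pc]; case E : (psi u) => [z|] /derivable_cdiff gd.
    have [e e0 He] := chordal_close z ltr01.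
    have [d d0 Hd] := pc e e0.
    exists (fun w => odflt 0 (psi w)), d; split => //; left => w /Hd.
    by rewrite E => /He[w' ->].
  have [e e0 He] := chordal_close (0 : R[i]) ltr01.
  have [d d0 Hd] := pc e e0.
  exists (fun w => odflt 0 (sinv (psi w))), d; split => //; right => w /Hd.
  rewrite E -chordal_sinv => /He[w' Ew' _].
  by rewrite Ew' -[LHS]sinvK Ew'.
move=> pd; split; first by apply/continuous_sphereP => e; exact: mdiff_cont.
case E : (psi u) => [z|]; apply/derivable_cdiff.
  have [g [d [d0 gd H]]] := mdiff_finite pd E.
  by apply: (eq_cdiff d0 _ gd) => w /H ->.
have E' : sinv (psi u) = Some 0 by rewrite E.
have [g [d [d0 gd H]]] := mdiff_finite (mdiff_sinv pd) E'.
by apply: (eq_cdiff d0 _ gd) => w /H ->.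
Qed.

Lemma nonconstant_sinv (psi : Cplx R -> sphere R) : nonconstant_meromorphic psi ->
  nonconstant_meromorphic (sinv \o psi).
Proof.
move=> [pd pn]; split.
  by move=> z; apply/cdifferentiable_mdiff/mdiff_sinv/cdifferentiable_mdiff.
move=> [c cP]; apply: pn; exists (sinv c) => z.
by rewrite -[psi z]sinvK; congr sinv; exact: cP.
Qed.

Section Leaf.
Variables (f : sphere R -> sphere R) (z0 : orbits R) (phi : Cplx R -> orbits R).
Hypothesis phi_iso : conformal_iso f z0 phi.

Lemma phi_regular u : regular_orbits f (phi u).
Proof.
have [[phif _ _] _ _ _] := phi_iso.
have [gam [_ reg _ <-]] := phif u I.
by apply: reg; rewrite in_itv /= ler01 lexx.
Qed.

Lemma pullback_eq (w z : orbits R) U0 n : box f z U0 w -> pullback f w U0 n = pullback f z U0 n.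
Proof.
move=> [_ H]; elim: n => [//|n IH] /=; rewrite IH.
by apply/esym/same_connected_component/(H n.+1).
Qed.

(** Agreement at index [n] passes to larger indices by injectivity of [f] on the pullbacks, and to
    smaller ones by applying [f]. *)
Lemma box_inj (w w' z : orbits R) U0 M n : univalent_from f z U0 M ->
  box f z U0 w -> box f z U0 w' -> (M <= n)%N -> w n = w' n -> w = w'.
Proof.
move=> uni [bw pw] [bw' pw'] Mn E; apply/funext => m.
have up k : w (n + k)%N = w' (n + k)%N.
  elim: k => [|k IH]; first by rewrite addn0.
  rewrite addnS; apply: (uni (n + k).+1).
  - by apply: (leq_trans Mn); rewrite -addnS leq_addr.
  - by rewrite inE.
  - by rewrite inE.
  by rewrite bw bw'.
have down j : forall i, w (i + j)%N = w' (i + j)%N -> w i = w' i.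
  elim: j => [|j IH] i; first by rewrite addn0.
  by rewrite addnS -addSn => /IH h; rewrite -bw -bw' h.
by apply: (down n); rewrite addnC up.
Qed.

(** A box around [phi u] is also a box around each [phi v] in it, with the same pullbacks, so one
    neighborhood [U0] and one index [M] serve for all nearby [v]. *)
Lemma leaf_chart u : exists d M, [/\ 0 < d,
  forall v n, cabs (v - u) < d -> (M <= n)%N -> mdiff (fun v => phi v n) v &
  forall v w n, cabs (v - u) < d -> cabs (w - u) < d -> (M <= n)%N -> phi v n = phi w n -> v = w].
Proof.
have [[_ phii _] c1 c2 c3] := phi_iso.
have [U0 [U0o U0c [M uni] _]] := c2 u setT filterT.
have : leaf_nbhs f (phi u) (box f (phi u) U0) by exists U0; split=> //; exists M.
move=> /(c1 u)/nbhs_cplxP[d d0 Hd]; exists d, M; split=> //.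
  move=> v n /Hd vb Mn; apply/cdifferentiable_mdiff; apply: (c3 v U0) => //.
    case: U0o => U0o _; split=> //; case: vb => _ /(_ 0%N); exact.
  move=> m nm x y; rewrite (pullback_eq _ vb); apply: uni; exact: leq_trans nm.
move=> v w n /Hd vb /Hd wb Mn E; apply: phii; rewrite ?inE//.
exact: (box_inj uni vb wb Mn E).
Qed.

(** Compactness for pairs of points. Near the diagonal [leaf_chart] applies; for [u != v] the orbits
    differ at some index [m], by continuity so do those of nearby points, and orbits that differ at
    [m] differ at all later indices. *)
Lemma leaf_good r : exists M, forall n, (M <= n)%N ->
  (forall u, cabs u < r -> mdiff (fun v => phi v n) u) /\
  (forall u v, cabs u < r -> cabs v < r -> phi u n = phi v n -> u = v).
Proof.
have arch (a : R) : 0 < a -> exists M, forall n, (M <= n)%N -> a <= n%:R.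
  move=> a0; exists (Num.trunc a).+1 => n Mn; apply: le_trans (ltW (truncnS_gt a)) _.
  by rewrite ler_nat.
have le_inv (d d' a : R) : 0 < d' -> d' <= d -> d'^-1 <= a -> d^-1 <= a.
  by move=> d'0 dd; apply: le_trans; rewrite lef_pV2 ?posrE//; apply: lt_le_trans dd.
have ge_inv (M n : nat) d : 0 < d -> (Num.min d M.+1%:R^-1)^-1 <= n%:R -> (M <= n)%N.
  move=> d0 h; apply: ltnW; rewrite -(ler_nat R); apply: le_trans h.
  rewrite -[X in X <= _]invrK lef_pV2 ?posrE ?lt_min ?d0 ?invr_gt0 ?ltr0n//.
  by rewrite ge_min lexx orbT.
have [||d1 d1_gt0 H1] := @disc_unif _ (fun u d => forall n, d^-1 <= n%:R ->
    mdiff (fun v => phi v n) u) 0 r.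
- by move=> z d d' d'0 dd H n h; apply: H; exact: le_inv h.
- move=> z _; have [d [M [d0 Hd _]]] := leaf_chart z.
  exists (Num.min d M.+1%:R^-1); first by rewrite lt_min d0 invr_gt0 ltr0n.
  move=> w _; rewrite lt_min => /andP[wd _] n /(ge_inv _ _ _ d0) Mn; exact: Hd.
pose P u v d := forall n, d^-1 <= n%:R -> phi u n = phi v n -> u = v.
have Pmon u v d d' : 0 < d' -> d' <= d -> P u v d -> P u v d'.
  by move=> d'0 dd H n h; apply: H; exact: le_inv h.
have Ploc u v : cabs (u - 0) <= r -> cabs (v - 0) <= r ->
    exists2 d, 0 < d & forall u' v', cabs (u' - 0) <= r -> cabs (v' - 0) <= r ->
      cabs (u' - u) < d -> cabs (v' - v) < d -> P u' v' d.
  move=> ur vr; have [->|uv] := eqVneq u v.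
    have [d [M [d0 _ Hd]]] := leaf_chart v.
    exists (Num.min d M.+1%:R^-1); first by rewrite lt_min d0 invr_gt0 ltr0n.
    move=> u' v' _ _; rewrite !lt_min => /andP[ud _] /andP[vd _] n /(ge_inv _ _ _ d0) Mn; exact: Hd.
  (* [m] is taken beyond [d1^-1] so that the coordinate of index [m] is continuous on the disc;
     orbits equal at all such indices are equal. *)
  have [m [mM muv]] : exists m, d1^-1 <= m%:R /\ phi u m <> phi v m.
    have [M HM] := arch d1^-1 ltac:(by rewrite invr_gt0).
    apply: contrapT => nm; case/eqP: uv.
    have [[_ phii _] _ _ _] := phi_iso; apply: phii; rewrite ?inE//; apply/funext => i.
    have eqM : phi u (i + M)%N = phi v (i + M)%N.
      apply: contrapT => ne; apply: nm; exists (i + M)%N; split=> //.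
      by apply: HM; rewrite leq_addl.
    have [bu _] := phi_regular u; have [bv _] := phi_regular v.
    elim: M i eqM {HM} => [|M IH] i; first by rewrite addn0.
    by rewrite addnS -addSn => /IH h; rewrite -bu -bv h.
  have ch0 : 0 < chordal (phi u m) (phi v m).
    rewrite lt_neqAle; apply/andP; split; first by apply/eqP => /esym/chordal_positivity.
    by rewrite chordalE divr_ge0 ?mulr_ge0 ?normc_ge0 ?ltW ?hnorm_gt0.
  have [du du0 Hu] := mdiff_cont (H1 u ur m mM) (e := chordal (phi u m) (phi v m) / 2) ltac:(lra).
  have [dv dv0 Hv] := mdiff_cont (H1 v vr m mM) (e := chordal (phi u m) (phi v m) / 2) ltac:(lra).
  exists (Num.min (Num.min du dv) m.+1%:R^-1); first by rewrite !lt_min du0 dv0 invr_gt0 ltr0n.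
  move=> u' v' _ _; rewrite !lt_min => /andP[/andP[/Hu hu _] _] /andP[/andP[_ /Hv hv] _] n.
  move=> /(ge_inv _ _ _ _) mn E; exfalso.
  have {}mn : (m <= n)%N by apply: mn; rewrite lt_min du0.
  have Em : phi u' m = phi v' m.
    have [bu _] := phi_regular u'; have [bv _] := phi_regular v'.
    move: E; rewrite -(subnKC mn); elim: (n - m)%N => [|k IH]; first by rewrite addn0.
    by rewrite addnS => h; apply: IH; rewrite -bu -bv h.
  have := chordal_triangle (phi u' m) (phi u m) (phi v m).
  by rewrite {2}Em (chordal_sym (phi v' m)); lra.
(* Uniformity over the product of two discs, by applying the principle to [u] and, inside, to
   [v]. *)
have [||d2 d2_gt0 H2] := @disc_unif _ (fun u d => forall v, cabs (v - 0) <= r -> P u v d) 0 r.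
- by move=> z d d' d'0 d'd H v vr; apply: (Pmon z v d d') => //; exact: H.
- move=> u ur.
  have [||d d0 Hd] := @disc_unif _ (fun v d => forall u', cabs (u' - 0) <= r -> cabs (u' - u) < d -> P u' v d) 0 r.
  + move=> z d d' d'0 d'd H u' ur' uu'; apply: (Pmon u' z d d') => //; apply: H => //.
    exact: lt_le_trans d'd.
  + move=> v vr; have [d d0 Hd] := Ploc u v ur vr; exists d => // w wr wv u' ur' uu'.
    exact: Hd.
  exists d => // w wr wu v vr; exact: Hd.
have [M1 HM1] := arch d1^-1 ltac:(by rewrite invr_gt0).
have [M2 HM2] := arch d2^-1 ltac:(by rewrite invr_gt0).
exists (maxn M1 M2) => n; rewrite geq_max => /andP[/HM1 n1 /HM2 n2]; split.
  by move=> u ur; apply: H1 => //; rewrite subr0 ltW.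
by move=> u v ur vr; apply: (H2 u _ v _ n n2); rewrite subr0 ltW.
Qed.

End Leaf.

End Interface.

(** * Rational maps: pairs in a fibre, continuity *)

Section Rational.
Variable R : realType.
Implicit Types (u v w z c : R[i]) (x y : sphere R) (d e : R) (p q : {poly R[i]}).

Lemma deriv_eq0_size p : p^`() = 0 -> (size p <= 1)%N.
Proof.
move=> p0; apply/leq_sizeP => -[//|j] _.
have : p^`()`_j = 0 by rewrite p0 coef0.
by rewrite coef_deriv => /eqP; rewrite mulrn_eq0 => /eqP.
Qed.

Lemma exists_nonroot p : p != 0 -> exists z, p.[z] != 0.
Proof.
move=> p0; apply: contrapT => nz.
pose rs := [seq n%:R : R[i] | n <- iota 0 (size p)].
have : (size rs < size p)%N.
  apply: max_poly_roots => //.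
    by apply/allP => z _; apply/negPn/negP => zr; apply: nz; exists z.
  rewrite map_inj_uniq ?iota_uniq// => m n /eqP; rewrite eqr_nat => /eqP//.
by rewrite size_map size_iota ltnn.
Qed.

(** If the Wronskian vanished, [p] would by coprimality divide its own derivative, which has smaller
    size, so [p] would be constant; likewise [q]. *)
Lemma wronskian_neq0 p q : coprimep p q -> (2 < maxn (size p) (size q))%N ->
  p^`() * q - p * q^`() != 0.
Proof.
move=> cpq sz; apply/eqP => /eqP; rewrite subr_eq0 => /eqP W.
have deriv0 p' q' : coprimep p' q' -> p'^`() * q' = p' * q'^`() -> (size p' <= 1)%N.
  move=> c W'; have d : p' %| p'^`().
    by rewrite -(Gauss_dvdpl _ c) W' dvdp_mulr.
  apply: deriv_eq0_size; apply/eqP; apply: contraT => d0.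
  have p0 : p' != 0 by apply: contraNneq d0 => ->; rewrite deriv0.
  by have := leq_ltn_trans (dvdp_leq d0 d) (lt_size_deriv p0); rewrite ltnn.
have sp : (size p <= 1)%N by exact: deriv0 cpq W.
have sq : (size q <= 1)%N.
  by apply: (deriv0 q p); [rewrite coprimep_sym|rewrite mulrC -W mulrC].
by move: sz; rewrite leq_max ltnNge (leq_trans sp)// ltnNge (leq_trans sq).
Qed.

Section Degree.
Variables (p q : {poly R[i]}).
Hypothesis cpq : coprimep p q.
Hypothesis szpq : (2 < maxn (size p) (size q))%N.
Let W := p^`() * q - p * q^`().
Let n := (maxn (size p) (size q)).-1.
Let f := ratfun p q.

Lemma top_coef : (p`_n != 0) || (q`_n != 0).
Proof.
rewrite -negb_and; apply/negP => /andP[/eqP pn /eqP qn].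
have : (maxn (size p) (size q) <= n)%N.
  have sz (r : {poly R[i]}) : (size r <= n.+1)%N -> r`_n = 0 -> (size r <= n)%N.
    move=> rn r0; apply/leq_sizeP => j; rewrite leq_eqVlt => /orP[/eqP <-//|nj].
    by rewrite nth_default// (leq_trans rn).
  have nS : n.+1 = maxn (size p) (size q) by rewrite /n prednK// (leq_trans _ szpq).
  by rewrite geq_max !sz// nS ?leq_maxl ?leq_maxr.
by rewrite /n; move: szpq; case: (maxn _ _) => // m _ /=; rewrite ltnn.
Qed.

(* [z] is a simple root of [p - f(z) q], so there is another root, possibly at
   infinity. *)
Lemma second_preimage z : W.[z] != 0 -> q.[z] != 0 -> exists2 b, b <> Some z & f b = f (Some z).
Proof.
move=> Wz qz; pose c := p.[z] / q.[z]; pose r := p - c *: q.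
have fz : f (Some z) = Some c by rewrite /f /= (negbTE qz).
have [rn|rn] := eqVneq r`_n 0.
  exists None => //; rewrite fz /f /= -/n.
  move: rn; rewrite coefB coefZ => /eqP; rewrite subr_eq0 => /eqP pn.
  have qn : q`_n != 0.
    by apply/eqP => qn0; have := top_coef; rewrite pn qn0 mulr0 eqxx.
  by rewrite (negbTE qn) pn mulfK.
have rsz : (2 < size r)%N.
  have nr : (n < size r)%N by rewrite ltnNge; apply: contra rn => rn; rewrite nth_default.
  by apply: leq_trans nr; rewrite /n; move: szpq; case: (maxn _ _) => // -[|[]].
have rz : root r z by rewrite /root hornerD hornerN hornerZ /c divfK// subrr.
have /factor_theorem[m mE] := rz.
have m0 : m.[z] != 0.
  have : r^`().[z] != 0.
    rewrite derivB derivZ !hornerE /c.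
    have -> : p^`().[z] - p.[z] / q.[z] * q^`().[z] = W.[z] / q.[z].
      by rewrite /W !hornerE; field.
    by rewrite mulf_neq0 ?invr_neq0.
  by rewrite mE derivM derivXsubC mulr1 !hornerE subrr mulr0 add0r.
have /closed_rootP[z' z'r] : size m != 1%N.
  apply/eqP => m1; move: rsz; rewrite mE size_Mmonic ?monicXsubC ?size_XsubC ?m1//.
  by rewrite -size_poly_gt0 m1.
have z'z : z' != z by apply: contraNneq m0 => <-.
have rz' : r.[z'] = 0 by rewrite mE hornerM (rootP z'r) mul0r.
have pz' : p.[z'] = c * q.[z'].
  by move: rz'; rewrite hornerD hornerN hornerZ => /eqP; rewrite subr_eq0 => /eqP.
have qz' : q.[z'] != 0.
  apply/eqP => q0; have : root p z' by rewrite /root pz' q0 mulr0.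
  by move=> /(coprimep_root cpq); rewrite q0 eqxx.
exists (Some z'); first by move=> [E]; move: z'z; rewrite E eqxx.
by rewrite fz /f /= (negbTE qz') pz' mulfK.
Qed.

(** [z] avoids the zeros of the Wronskian and of [q], and [z'] moreover the fibre of [z]. Each has a
    second point in its fibre, and the two fibres are disjoint. *)
Lemma two_pairs : exists a1 b1 a2 b2 : sphere R,
  [/\ f a1 = f b1, f a2 = f b2, a1 <> b1, a2 <> b2 &
      [/\ a1 <> a2, a1 <> b2, b1 <> a2 & b1 <> b2]].
Proof.
have W0 : W != 0 by exact: wronskian_neq0.
have q0 : q != 0 by apply: contraNneq W0 => q0; rewrite /W q0 deriv0 !mulr0 subrr.
have [z] := exists_nonroot (mulf_neq0 W0 q0); rewrite hornerM mulf_eq0 negb_or => /andP[Wz qz].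
have [b bz fb] := second_preimage Wz qz.
pose c := p.[z] / q.[z]; pose r := p - c *: q.
have r0 : r != 0.
  apply: contraNneq W0 => /eqP; rewrite subr_eq0 => /eqP pE.
  have h (c' : R[i]) : (c' *: q)^`() * q - (c' *: q) * q^`() = 0.
    by rewrite derivZ -!mul_polyC; ring.
  by rewrite /W pE h.
have [z'] := exists_nonroot (mulf_neq0 (mulf_neq0 W0 q0) r0).
rewrite !hornerM !mulf_eq0 !negb_or => /andP[/andP[Wz' qz'] rz'].
have [b' bz' fb'] := second_preimage Wz' qz'.
have ff' : f (Some z) <> f (Some z').
  rewrite /f /= (negbTE qz) (negbTE qz') => -[E]; move: rz'.
  by rewrite hornerD hornerN hornerZ /c E divfK// subrr eqxx.
exists (Some z), b, (Some z'), b'; split=> //; try exact/nesym.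
split=> E; apply: ff'; first by rewrite E.
- by rewrite E fb'.
- by rewrite -fb E.
- by rewrite -fb E fb'.
Qed.

End Degree.

Lemma cdiff_horner p z : cdiff (fun w => p.[w]) z.
Proof.
elim/poly_ind: p => [|p c IH].
  apply: (@eq_cdiff _ (fun=> 0) _ _ 1) => //; last exact: cdiff_cst.
  by move=> w _; rewrite horner0.
apply: (@eq_cdiff _ (fun w => p.[w] * w + c) _ _ 1) => //.
  by move=> w _; rewrite !hornerE.
apply: cdiffD; last exact: cdiff_cst.
by apply: cdiffM => //; exact: cdiff_id.
Qed.

Definition ratio (a b : R[i]) : sphere R := if b == 0 then None else Some (a / b).

Lemma mdiff_ratio p q z : (p.[z] != 0) || (q.[z] != 0) ->
  mdiff (fun w => ratio p.[w] q.[w]) z.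
Proof.
have [qz|qz _] := eqVneq q.[z] 0.
  rewrite orbF => pz.
  have [d d0 Hd] := ccont_neq0 (cdiff_ccont (cdiff_horner p z)) pz.
  exists (fun w => q.[w] / p.[w]), d; split=> //.
    by apply: cdiff_div => //; exact: cdiff_horner.
  right=> w /Hd pw; rewrite /ratio /=.
  by rewrite mulf_eq0 invr_eq0 (negbTE pw) orbF invf_div.
have [d d0 Hd] := ccont_neq0 (cdiff_ccont (cdiff_horner q z)) qz.
exists (fun w => p.[w] / q.[w]), d; split=> //.
  by apply: cdiff_div => //; exact: cdiff_horner.
by left=> w /Hd qw; rewrite /ratio (negbTE qw).
Qed.

(** The polynomial [z ^ n * p(1 / z)]; reversing [p] and [q] with the same [n] describes the map
    near infinity. *)
Definition revp n p : {poly R[i]} := \poly_(i < n.+1) p`_(n - i).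

Lemma horner_revp n p z : (size p <= n.+1)%N -> z != 0 -> (revp n p).[z] = z ^+ n * p.[z^-1].
Proof.
move=> pn z0; rewrite horner_poly (horner_coef_wide _ pn) mulr_sumr (reindex_inj rev_ord_inj) /=.
apply: eq_bigr => i _; have iN : (i <= n)%N by rewrite -ltnS ltn_ord.
rewrite subSS subKn// mulrCA; congr (_ * _).
have -> : z ^+ n = z ^+ (n - i) * z ^+ i by rewrite -exprD subnK.
by rewrite -mulrA -exprMn divff// expr1n mulr1.
Qed.

(** In each chart the map is a quotient of polynomials without common zero at the point: by
    coprimality at a finite point, by the choice of [n] at infinity. *)
Lemma ratfun_cont p q : q != 0 -> coprimep p q -> forall x e, 0 < e ->
  exists2 d, 0 < d & forall y, chordal x y < d -> chordal (ratfun p q x) (ratfun p q y) < e.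
Proof.
move=> q0 cpq x e e0; set f := ratfun p q.
case: x => [z|].
  have nz : (p.[z] != 0) || (q.[z] != 0).
    by case: (boolP (root p z)) => [/(coprimep_root cpq) ->|]; [rewrite orbT|rewrite /root => ->].
  have [d1 d1_0 H1] := mdiff_cont (mdiff_ratio nz) e0.
  have [d d0 Hd] := chordal_close z d1_0.
  by exists d => // y /Hd[w -> wz]; exact: (H1 w wz).
pose n := (maxn (size p) (size q)).-1.
have nS : maxn (size p) (size q) = n.+1.
  by rewrite /n prednK// (leq_trans _ (leq_maxr _ _))// size_poly_gt0.
have pn : (size p <= n.+1)%N by rewrite -nS leq_maxl.
have qn : (size q <= n.+1)%N by rewrite -nS leq_maxr.
have r0 (r : {poly R[i]}) : (revp n r).[0] = r`_n by rewrite horner_coef0 coef_poly subn0.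
have nz : ((revp n p).[0] != 0) || ((revp n q).[0] != 0).
  rewrite !r0 -negb_and; apply/negP => /andP[/eqP p0 /eqP qn0].
  have sz (r : {poly R[i]}) : (size r <= n.+1)%N -> r`_n = 0 -> (size r <= n)%N.
    move=> rn rn0; apply/leq_sizeP => j; rewrite leq_eqVlt => /orP[/eqP <-//|nj].
    by rewrite nth_default// (leq_trans rn).
  by have := ltnn n; rewrite -nS geq_max (sz _ pn p0) (sz _ qn qn0).
have fE w : f (sinv (Some w)) = ratio (revp n p).[w] (revp n q).[w].
  rewrite /=; case: eqVneq => [->|w0]; first by rewrite !r0.
  rewrite /f /= !horner_revp// /ratio mulf_eq0 expf_eq0 (negbTE w0) andbF /=.
  by case: eqP => // _; rewrite -mulf_div divff ?mul1r// expf_neq0.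
have [d1 d1_0 H1] := mdiff_cont (mdiff_ratio nz) e0.
have [d d0 Hd] := chordal_close 0 d1_0.
exists d => // y; rewrite -chordal_sinv => /Hd[w yw wz].
have -> : y = sinv (Some w) by rewrite -yw sinvK.
have -> : f None = f (sinv (Some 0)) by rewrite /= eqxx.
by rewrite !fE; exact: H1.
Qed.

End Rational.

(** * The Julia set and the convergence *)

Section Final.
Variable R : realType.
Implicit Types (u v w : R[i]) (y : sphere R) (d e : R).

Lemma compact_Cplx_bounded (A : set (Cplx R)) : compact A -> exists M, forall w, A w -> cabs w <= M.
Proof.
move=> cA; have Nc : continuous (fun w : Cplx R => cabs w : R).
  move=> w B /nbhs_ballP[e /= e0 HB]; apply/(nbhs_cplxP w [set v | B (cabs v)]); exists e => // w' ww'; apply: HB.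
  rewrite -ball_normE /=; apply: le_lt_trans ww'; rewrite ler_norml; have := cabs_sub w w'; have := cabs_sub w' w.
  by rewrite (cabs_distC w w'); lra.
have /compact_bounded[M [_ HM]] : compact ((fun w : Cplx R => cabs w : R) @` A).
  by apply: continuous_compact => //; exact: continuous_subspaceT.
exists (M + 1) => w Aw; have := HM (M + 1) ltac:(lra) (cabs w) (ex_intro2 _ _ w Aw erefl).
by rewrite /= ger0_norm// cabs_ge0.
Qed.

(** If a filter on this set does not cluster at [z0], it avoids a neighborhood of [z0], and hence
    lives on finitely many terms. Sets of this form are the compact sets on which normality is
    tested. *)
Lemma compact_limit (b c : nat -> sphere R) (z0 : sphere R) :
  (forall e, 0 < e -> exists M, forall i, (M <= i)%N -> chordal z0 (b i) < e /\ chordal z0 (c i) < e) ->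
  compact [set y | y = z0 \/ exists i, y = b i \/ y = c i].
Proof.
move=> H F PF FK; apply: contrapT => nK.
have nz0 : ~ cluster F z0 by move=> cz; apply: nK; exists z0; split=> //; left.
have [B [V [FB Vz BV]]] : exists B V, [/\ F B, nbhs z0 V & forall y, B y -> ~ V y].
  apply: contrapT => nBV; apply: nz0 => B V FB Vz; apply: contrapT => BV.
  by apply: nBV; exists B, V; split=> // y By Vy; apply: BV; exists y.
have [d d0 Hd] := (nbhs_sphere z0 V).1 Vz; have [M HM] := H d d0.
pose S : set (sphere R) := b @` `I_M `|` c @` `I_M.
have cS : compact S.
  by apply: finite_compact; rewrite finite_setU; split; apply: finite_image; exact: finite_II.
have FS : F S.
  apply: filterS (filterI FB FK) => y [By]; case=> [yz|[i bc]].
    by exfalso; apply: (BV y By); apply: Hd; rewrite yz chordalxx.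
  have iM : (i < M)%N.
    rewrite ltnNge; apply/negP => /HM[h1 h2]; apply: (BV y By); apply: Hd.
    by case: bc => ->.
  by case: bc => ->; [left|right]; exists i.
have [y [Sy cy]] := cS F PF FS; apply: nK; exists y; split=> //; right.
by case: Sy => -[i _ <-]; exists i; [left|right].
Qed.

Lemma uniform_sphereP (T : choiceType) (A : set T) (F : nat -> T -> sphere R) (g : T -> sphere R) :
  {uniform A, F @ \oo --> g} <->
  forall e, 0 < e -> exists M, forall i, (M <= i)%N -> forall x, A x -> chordal (g x) (F i x) < e.
Proof.
split.
  move=> Fg e e0.
  have : nbhs (g : {uniform` A -> sphere R}) [set h : T -> sphere R | forall x, A x -> chordal (g x) (h x) < e].
    apply/uniform_nbhs; exists [set xy | chordal xy.1 xy.2 < e]; split => //.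
    by rewrite -entourage_ballE; exists e.
  by move=> /Fg[M _ HM]; exists M => i Mi; exact: HM.
move=> H P /uniform_nbhs[E [+ EP]]; rewrite -entourage_ballE => -[e /= e0 Ee].
have [M HM] := H e e0; exists M => // i Mi; apply: EP => x Ax; apply: Ee.
exact: HM.
Qed.

Lemma cvg_cplx (u : nat -> R[i]) (l : R[i]) :
  (forall e, 0 < e -> exists M, forall m, (M <= m)%N -> cabs (u m - l) <= e) ->
  (u : nat -> Cplx R) @ \oo --> (l : Cplx R).
Proof.
move=> H A /nbhs_cplxP[d d0 HA]; have [M HM] := H (d / 2) ltac:(lra).
by exists M => // m /HM h; apply: HA; lra.
Qed.

Lemma iter_cont (f : sphere R -> sphere R) :
  (forall y e, 0 < e -> exists2 d, 0 < d & forall y', chordal y y' < d -> chordal (f y) (f y') < e) ->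
  forall n y e, 0 < e -> exists2 d, 0 < d & forall y', chordal y y' < d ->
    chordal (iter n f y) (iter n f y') < e.
Proof.
move=> fc; elim=> [|n IH] y e e0; first by exists e.
have [d d0 Hd] := fc (iter n f y) e e0; have [d' d'0 Hd'] := IH y d d0.
by exists d' => // y' /Hd'/Hd.
Qed.

Lemma LM_sub_Zalcman (f : sphere R -> sphere R) (d : nat) :
  (2 <= d)%N -> rational_map_of_degree f d -> LM f `<=` Zalcman f.
Proof.
move=> d2 [p [q [q0 cpq dE fE]]] psi [z0 _ [psi_mero [phi [phi_iso phi0 psiE]]]].
have szpq : (2 < maxn (size p) (size q))%N.
  by move: d2; rewrite dE; case: (maxn _ _).
have fc : forall y e, 0 < e -> exists2 d, 0 < d & forall y', chordal y y' < d -> chordal (f y) (f y') < e.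
  by rewrite fE; exact: ratfun_cont.
have psif n u : f (phi u n.+1) = phi u n by have [bu _] := phi_regular phi_iso u; exact: bu.
have pairs := two_pairs cpq szpq; rewrite -fE in pairs.
have [sg [x [sgP [n [z [rho [nk rho0 rhol zl key]]]]]]] :=
  zalcman_core psif (leaf_good phi_iso) pairs.
have sgK y : sg (sg y) = y by case: sgP => [->|[-> _]]; rewrite ?sinvK.
have sgc y y' : chordal (sg y) (sg y') = chordal y y'.
  by case: sgP => [->|[-> _]]; rewrite ?chordal_sinv.
have iterE m u : iter m f (phi u m) = psi u.
  by rewrite psiE; elim: m => [//|m IH]; rewrite iterSr psif.
have psic u e : 0 < e -> exists2 d, 0 < d & forall w, cabs (w - u) < d -> chordal (psi u) (psi w) < e.
  by move=> e0; apply: mdiff_cont => //; apply/cdifferentiable_mdiff; exact: psi_mero.1.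
pose a m w := sg (Some (z m + rho m * w)).
have a_lim w e : 0 < e -> exists M, forall m, (M <= m)%N -> chordal (sg (Some x)) (a m w) < e.
  move=> e0; have Nw := cabs_ge0 w.
  pose e' := e / (4 * (1 + cabs w)).
  have e'0 : 0 < e' by rewrite divr_gt0//; lra.
  have [M1 HM1] := rhol e' e'0; have [M2 HM2] := zl e' e'0.
  exists (maxn M1 M2) => m; rewrite geq_max => /andP[/HM1 h1 /HM2 h2].
  rewrite sgc; apply: le_lt_trans (chordal_le _ _) _.
  have -> : x - (z m + rho m * w) = - ((z m - x) + rho m * w) by ring.
  rewrite cabsN; have h3 := cabsD (z m - x) (rho m * w); rewrite cabsM in h3.
  have h4 : cabs (rho m) * cabs w <= e' * cabs w by rewrite ler_wpM2r.
  have h5 : e' * (4 * (1 + cabs w)) = e by rewrite /e' divfK// gt_eqF//; lra.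
  lra.
have f_lim w e : 0 < e -> exists M, forall m, (M <= m)%N ->
    chordal (psi w) (iter (n m) f (a m w)) < e.
  move=> e0; have [d' d'0 Hd'] := psic w e e0.
  have Nw := cabs_ge0 w.
  have [M HM] := key (cabs w + 1) (d' / 2) ltac:(lra) ltac:(lra).
  exists M => m /HM/(_ w ltac:(lra))[u uw uE]; rewrite /a -uE iterE; apply: Hd'; lra.
(* The points [a m w1] and [a m w2] both tend to [sg (Some x)], while their iterates tend to the
   distinct values [psi w1] and [psi w2]; uniform convergence along a subsequence on a compact set
   containing them excludes this. *)
have julia : Julia f (sg (Some x)).
  move=> [U [Uo Ux] Un]; apply: psi_mero.2.
  apply: contrapT => nc.
  have [w1 [w2 w12]] : exists w1 w2, psi w1 <> psi w2.
    apply: contrapT => nw; apply: nc; exists (psi 0) => w; apply: contrapT => nw0.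
    by apply: nw; exists w, 0.
  (* The path [psi w1], [F1], [g (b i)], [G1], [G0], [G2], [g (c i)], [F2], [psi w2] has eight
     steps, each shorter than [e]. *)
  pose e := chordal (psi w1) (psi w2) / 8.
  have e0 : 0 < e.
    rewrite divr_gt0// lt_neqAle; apply/andP; split; first by apply/eqP => /esym/chordal_positivity.
    by rewrite chordalE divr_ge0 ?mulr_ge0 ?normc_ge0 ?ltW ?hnorm_gt0.
  have [k [g [kI Hg]]] := Un n.
  have ki i : (i <= k i)%N by elim: i => [//|i IH]; exact: leq_ltn_trans IH (kI _ _ _).
  have [dU dU0 HU] := (nbhs_sphere (sg (Some x)) U).1 (open_nbhs_nbhs (conj Uo Ux)).
  have [M1 HM1] := a_lim w1 dU dU0; have [M2 HM2] := a_lim w2 dU dU0.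
  (* The shift by [i0] places all points of [K] inside [U]. *)
  pose i0 := maxn M1 M2.
  pose b i := a (k (i0 + i)%N) w1; pose c i := a (k (i0 + i)%N) w2.
  pose K : set (sphere R) := [set y | y = sg (Some x) \/ exists i, y = b i \/ y = c i].
  have cK : compact K.
    apply: compact_limit => e' e'0.
    have [M3 HM3] := a_lim w1 e' e'0; have [M4 HM4] := a_lim w2 e' e'0.
    exists (maxn M3 M4) => i; rewrite geq_max => /andP[h3 h4].
    have hk : (i <= k (i0 + i))%N by apply: leq_trans (ki _); rewrite leq_addl.
    by split; [apply: HM3|apply: HM4]; apply: leq_trans hk.
  have KU : K `<=` U.
    move=> y [->//|[i bc]]; apply: HU.
    have hk : (i0 <= k (i0 + i))%N by apply: leq_trans (ki _); rewrite leq_addr.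
    move: (hk); rewrite geq_max => /andP[h1 h2].
    by case: bc => ->; [apply: HM1|apply: HM2].
  have [M HM] := (uniform_sphereP _ _ _).1 (Hg K cK KU) e e0.
  (* Continuity of one fixed iterate, uniformly close to [g] on [K], makes the values of [g] at
     [b i] and [c i] close to each other. *)
  have [dh dh0 Hh] := iter_cont fc (n (k M)) (sg (Some x)) e0.
  have [M3 HM3] := a_lim w1 dh dh0; have [M4 HM4] := a_lim w2 dh dh0.
  have [M5 HM5] := f_lim w1 e e0; have [M6 HM6] := f_lim w2 e e0.
  pose i := maxn (maxn M M3) (maxn M4 (maxn M5 M6)).
  pose j := k (i0 + i)%N.
  have ij : (i <= j)%N by apply: leq_trans (ki _); rewrite leq_addl.
  have : (i <= i)%N by [].
  rewrite {1}/i !geq_max => /andP[/andP[iM i3] /andP[i4 /andP[i5 i6]]].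
  have Kb : K (b i) by right; exists i; left.
  have Kc : K (c i) by right; exists i; right.
  have g1 := HM M (leqnn M) _ Kb; have g2 := HM M (leqnn M) _ Kc.
  have iM' : (M <= i0 + i)%N by apply: leq_trans iM _; rewrite leq_addl.
  have g3 := HM _ iM' _ Kb; have g4 := HM _ iM' _ Kc.
  have h1 := Hh _ (HM3 j (leq_trans i3 ij)); have h2 := Hh _ (HM4 j (leq_trans i4 ij)).
  have l1 := HM5 j (leq_trans i5 ij); have l2 := HM6 j (leq_trans i6 ij).
  rewrite -/j in g3 g4.
  have eE : chordal (psi w1) (psi w2) = 8 * e by rewrite /e; lra.
  move: g1 g2 g3 g4 h1 h2 l1 l2; rewrite -/(b i) -/(c i).
  set F1 := iter (n j) f (b i); set F2 := iter (n j) f (c i).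
  set G1 := iter (n (k M)) f (b i); set G2 := iter (n (k M)) f (c i).
  set G0 := iter (n (k M)) f (sg (Some x)).
  move=> g1 g2 g3 g4 h1 h2 l1 l2.
  have t1 := chordal_triangle F1 (psi w1) (psi w2).
  have t2 := chordal_triangle (g (b i)) F1 (psi w2).
  have t3 := chordal_triangle G1 (g (b i)) (psi w2).
  have t4 := chordal_triangle G0 G1 (psi w2).
  have t5 := chordal_triangle G2 G0 (psi w2).
  have t6 := chordal_triangle (g (c i)) G2 (psi w2).
  have t7 := chordal_triangle F2 (g (c i)) (psi w2).
  rewrite (chordal_sym F1 (g (b i))) in t2.
  rewrite (chordal_sym G1 G0) in t4.
  rewrite (chordal_sym G2 (g (c i))) in t6.
  rewrite (chordal_sym F2 (psi w2)) in t7.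
  clear -eE g1 g2 g3 g4 h1 h2 l1 l2 t1 t2 t3 t4 t5 t6 t7; lra.
exists (sg (Some x)) => //.
(* [F] stands for [f] or for its conjugate by inversion; the two charts differ only by [sg], which
   preserves chordal distances. *)
have zalc (F : sphere R -> sphere R) (psi' : Cplx R -> sphere R) :
    (forall m y, iter m F y = sg (iter m f (sg y))) -> psi' = sg \o psi ->
    nonconstant_meromorphic psi' -> Zalcman_finite F x psi'.
  move=> FE psiE' mero; split=> //; exists n, z, rho; split => //.
  - apply/cvgnyPge => A; exists A => // m /= Am; exact: leq_trans (nk m).
  - exact: cvg_cplx.
  - apply: cvg_cplx => e /rhol[M HM]; exists M => m /HM; by rewrite subr0.
  apply/fam_cvgP => A /compact_Cplx_bounded[M0 HM0].
  apply/uniform_sphereP => e e0; pose M := `|M0| + 1.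
  have M_gt : M0 < M by rewrite /M; have := ler_norm M0; lra.
  have M_0 : 0 < M by rewrite /M; have := normr_ge0 M0; lra.
  (* The iterate at the rescaled point [w] equals [psi u] with [u] near [w], so uniform continuity
     of [psi] on the disc gives uniform convergence. *)
  have [||d' d'0 Hd'] := @disc_unif R (fun w d => forall u, cabs (u - w) < d -> chordal (psi w) (psi u) < e) 0 M.
  - by move=> w d1 d3 _ dd H u uw; apply: H; exact: lt_le_trans dd.
  - move=> w _; have [d' d'0 Hd'] := psic w (e / 2) ltac:(lra).
    exists (d' / 2); first by lra.
    move=> w' _ ww' u uw'; have h1 := Hd' w' ltac:(lra).
    have h2 := Hd' u ltac:(have := cabs_tri w' u w; lra).
    have := chordal_triangle (psi w) (psi w') (psi u); rewrite (chordal_sym (psi w') (psi w)); lra.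
  have [M1 HM1] := key M (d' / 2) M_0 ltac:(lra).
  exists M1 => m /HM1 Hm w /HM0 wM; have [u uw uE] := Hm w ltac:(lra).
  rewrite psiE' FE -uE iterE /= sgc; apply: (Hd' w); last by lra.
  by rewrite subr0; lra.
case: (sgP) => [sgE|[sgE x0]].
  rewrite sgE; apply: zalc => //; first by rewrite sgE.
  by rewrite sgE.
(* In the chart at infinity the limit point is [None], and [psi] is the inversion of a Zalcman
   function of the conjugate map at [0]. *)
rewrite sgE x0 /= eqxx; exists (sinv \o psi); last by apply/funext => w; exact: sinvK.
rewrite -x0; apply: zalc; last exact: nonconstant_sinv.
  by move=> m y; elim: m => [|m IH] /=; [rewrite sgK|rewrite IH sgE sinvK].
by rewrite sgE.
Qed.

End Final.

Theorem mainTheorem8 (R : realType) (f : sphere R -> sphere R) (d : nat)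
    (d_ge2 : (2 <= d)%N) (f_rat : rational_map_of_degree f d) :
  LM f `<=` Zalcman f /\ lamination f (LM f) `<=` lamination f (Zalcman f).
Proof.
have LZ := LM_sub_Zalcman d_ge2 f_rat; split=> //.
apply: closure_subset; apply: image_subset => Psi H n.
by have [h1 h2] := H n; split=> //; exact: LZ.
Qed.
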